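(* Let $k,l$ be integers with $k\ge 1$, $0\le 2l\le k$, and let $\xi\in I$ be the element acting on $\mathbb{C}^7$ by $\sqrt{-1}\,k$ on $L_1$, $\sqrt{-1}\,l$ on $L_2$, $\sqrt{-1}(k-l)$ on $\overline{L}_3$, by the opposite values on the complex conjugate lines, and by $0$ on $L_0$. Let $\gamma\in U_\xi$ and $W=\gamma H_+$. (a) Suppose $0<2l<k$. Let $\xi_{k-i}=(k-l-i)\eta_1+l\eta_2$ for $0\le i\le k-2l$, and $\xi_{2(l-j)}=(l-j)\eta_1+(l-j)\eta_2$, $\xi_{2(l-j)-1}=(l-j)\eta_1+(l-j-1)\eta_2$ for $0\le j\le l-1$, and $\xi_0=0$. Then $\xi=\xi_k$, $\xi\preceq \xi_r$ for $r=0,\dots,k$, and, setting $\gamma_r=\mathcal{U}_{\xi,\xi_r}(\gamma)$, the loops $\beta_r=\gamma_{r-1}^{-1}\gamma_r$ ($r=1,\dots,k$) form a factorization $\gamma=\beta_1\beta_2\cdots\beta_k$ of length $k$ and type $(1,1,\dots,1)$. The subspaces $W^r=\gamma_rH_+$ are given by $$W^{k-i}=\lambda^i(W\cap\lambda^{-k}H_+)+(W\cap\lambda^{-l}H_+)+\lambda^{-i}(W\cap\lambda^{l+i}H_+)\qquad(0\le i\le k-2l),$$ and, for $0\le j\le l-1$, $$W^{2(l-j)}=\lambda^{k-2l+j}(W\cap\lambda^{-k+j}H_+)+\lambda^j(W\cap\lambda^{-l}H_+)+\lambda^{-j}(W\cap\lambda^jH_+)+\lambda^{-k+2l-j}(W\cap\lambda^{k-l}H_+)+\lambda^{2(l-j)}H_+,$$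 $$W^{2(l-j)-1}=\lambda^{k-2l+j}(W\cap\lambda^{-k+j+1}H_+)+\lambda^{j+1}(W\cap\lambda^{-l}H_+)+\lambda^{-j-1}(W\cap\lambda^{j+1}H_+)+\lambda^{-k+2l-j}(W\cap\lambda^{k-l-1}H_+)+\lambda^{2(l-j)-1}H_+.$$ (b) Suppose $l=k/2$, and let $\eta=\xi/l\in I$ and $\xi_{l-i}=(l-i)\eta$ for $0\le i\le l$. Then $\xi\preceq\xi_{l-i}$ for all $i$, and, setting $\gamma_r=\mathcal{U}_{\xi,\xi_r}(\gamma)$, the loops $\beta_r=\gamma_{r-1}^{-1}\gamma_r$ ($r=1,\dots,l$) form a factorization $\gamma=\beta_1\cdots\beta_l$ of length $l$ and type $(2,2,\dots,2)$, with $$W^{l-i}=\gamma_{l-i}H_+=\lambda^i(W\cap\lambda^{-2l+i}H_+)+\lambda^{-i}(W\cap\lambda^iH_+)+\lambda^{2(l-i)}H_+ .$$ (c) Suppose $l=0$, and let $\eta=\xi/k\in I$ and $\xi_{k-i}=(k-i)\eta$ for $0\le i\le k$. Then $\xi\preceq\xi_{k-i}$ for all $i$, and, setting $\gamma_r=\mathcal{U}_{\xi,\xi_r}(\gamma)$, the loops $\beta_r=\gamma_{r-1}^{-1}\gamma_r$ ($r=1,\dots,k$) form a factorization $\gamma=\beta_1\cdots\beta_k$ of length $k$ and type $(1,1,\dots,1)$, with $$W^{k-i}=\gamma_{k-i}H_+=\lambda^i(W\cap\lambda^{-k}H_+)+(W\cap H_+)+\lambda^{-i}(W\cap\lambda^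{i}H_+).$$
   Context: $G_2\subset SO(7)\subset U(7)$ is the automorphism group of the octonions acting on $\mathrm{Im}(\mathbb{O})=\mathbb{R}^7$, with Lie algebra $\mathfrak{g}$ and complexification $G_2^{\mathbb{C}}$, $\mathfrak{g}^{\mathbb{C}}$. Fix a maximal torus $T$ with Lie algebra $\mathfrak{t}$ and a Weyl chamber, with simple roots $\alpha_1$ (short), $\alpha_2$ (long). $\mathbb{C}^7=\bigoplus_{i=-3}^3L_i$ is the orthogonal decomposition into one-dimensional weight spaces, $L_{-i}=\overline{L_i}$, where $L_1,L_2,L_{-3}=\overline{L}_3$ have weights $2\alpha_1+\alpha_2$, $\alpha_1$, $\alpha_1+\alpha_2$ and $L_0$ has weight $0$. $\eta_1,\eta_2\in\mathfrak{t}$ are given by: $\eta_1=\sqrt{-1}$ on $L_1$, $0$ on $L_2$, $\sqrt{-1}$ on $\overline{L}_3$; $\eta_2=\sqrt{-1}$ on $L_1$, $\sqrt{-1}$ on $L_2$, $0$ on $\overline{L}_3$ (opposite values on conjugate lines, $0$ on $L_0$). $\Omega G_2$ is the group of smooth loops $\gamma:S^1\to G_2$ with $\gamma(1)=e$; $\Omega_{\mathrm{alg}}G_2$ is the subgroup of those $\gamma$ such that $\gamma,\gamma^{-1}$ have finite Fourier series. $\Lambda^+_{\mathrm{alg}}G_2^{\mathbb{C}}$ is the group of loops $S^1\to G_2^{\mathbb{C}}$ that extend holomorphically to $|\lambda|\le1$ and, together with their inverses, have finite Fourier series. $H=L^2(S^1,\mathbb{C}^7)$, and $H_+$ is the closed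 span of $\{\lambda^ie_j: i\ge 0\}$. $I=\{\xi\in\mathfrak{t}:\exp(2\pi\xi)=e\}$; for $\xi\in I$, $\gamma_\xi(\lambda)=\exp(-\sqrt{-1}\ln(\lambda)\xi)$ and $U_\xi\subset\Omega_{\mathrm{alg}}G_2$ is the set of loops $\gamma$ with $\gamma H_+=\Psi\gamma_\xi H_+$ for some $\Psi\in\Lambda^+_{\mathrm{alg}}G_2^{\mathbb{C}}$. A based loop $\gamma$ is determined by $\gamma H_+$. $\mathfrak{g}^\xi_i$ is the $\sqrt{-1}\,i$-eigenspace of $\mathrm{ad}\,\xi$ on $\mathfrak{g}^{\mathbb{C}}$ and $\mathfrak{p}^\xi_i=\bigoplus_{j\le i}\mathfrak{g}^\xi_j$. Write $\xi\preceq\xi'$ if $\mathfrak{p}^\xi_i\subset\mathfrak{p}^{\xi'}_i$ for all $i\ge0$; in that case $\mathcal{U}_{\xi,\xi'}:U_\xi\to U_{\xi'}$ is the well-defined map sending the loop with $\gamma H_+=\Psi\gamma_\xi H_+$ to the loop $\gamma'$ with $\gamma' H_+=\Psi\gamma_{\xi'}H_+$, $\Psi\in\Lambda^+_{\mathrm{alg}}G_2^{\mathbb{C}}$. For $m\ge0$, $\Omega^mG_2=\{\gamma\in\Omega_{\mathrm{alg}}G_2:\gamma=\sum_{i=-m}^m\lambda^i\zeta_i,\ \zeta_m\ne0\}$. A factorization of $\gamma$ of length $N$ and type $(k_1,\dots,k_N)$ is a sequence of loops $\beta_1,\dots,\beta_N$ with $\gamma=\beta_1\cdots\beta_N$ and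 $\beta_i\in\Omega^{k_i}G_2$ for each $i$. *)

(* Defs.v *)
From HB Require Import structures.
From mathcomp Require Import all_boot all_order all_algebra.
From mathcomp Require Import complex.
From mathcomp Require Import all_classical all_reals all_analysis.
Import Order.TTheory GRing.Theory Num.Theory.
Import numFieldNormedType.Exports.

Set Implicit Arguments.
Unset Strict Implicit.
Unset Printing Implicit Defensive.

Local Open Scope classical_set_scope.
Local Open Scope ring_scope.

(** * Octonions and G_2 *)

Section Octonions.
Variable K : comNzRingType.

(* A pair (a, u) is the octonion a + u with real part a and imaginary part u. *)
Local Notation octonion := (K^o * 'cV[K]_7)%type.

(* [fano i j k] holds iff (i, j, k) is a cyclic rotation of (n, n+1, n+3) mod 7
   for some n, i.e. iff e_i e_j = e_k in the multiplication table below. *)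
Definition fano (i j k : 'I_7) : bool :=
  has (fun d : nat * nat =>
         ((j : nat) == (i + d.1) %% 7)%N && ((k : nat) == (i + d.2) %% 7)%N)
      [:: (1, 3); (2, 6); (4, 5)]%N.

Definition cross (u v : 'cV[K]_7) : 'cV[K]_7 :=
  \col_k \sum_i \sum_j
    ((fano i j k)%:R - (fano j i k)%:R) * (u i ord0 * v j ord0).

Definition dotp (u v : 'cV[K]_7) : K := \sum_i u i ord0 * v i ord0.

(* The product with unit (1, 0), e_i^2 = -1 and e_i e_(i+1) = e_(i+3)
   (indices mod 7). *)
Definition omul (x y : octonion) : octonion :=
  (x.1 * y.1 - dotp x.2 y.2, x.1 *: y.2 + y.1 *: x.2 + cross x.2 y.2).

Definition octonion_automorphism (f : {linear octonion -> octonion}) : Prop :=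
  bijective f /\ forall x y, f (omul x y) = omul (f x) (f y).

(* The automorphisms of the octonion algebra over K, seen as matrices acting on
   the imaginary octonions K^7. *)
Definition AutO : set 'M[K]_7 :=
  [set A | exists f : {linear octonion -> octonion},
     octonion_automorphism f /\ forall u, f (0, u) = (0, A *m u)].

End Octonions.

Section G2.
Variable R : realType.
Local Notation C := R[i].

(* sqrt(-1), kept explicit rather than the chosen root [Num.imaginary]. *)
Definition imi : C := Complex 0 1.

Definition toC (A : 'M[R]_7) : 'M[C]_7 := map_mx (fun x : R => Complex x 0) A.

(* The compact group G_2, as a group of real 7 x 7 matrices. *)
Definition G2 : set 'M[R]_7 := @AutO R.

(* G_2 = Aut(O) is a real algebraic group; its complexification is the group of
   its complex points, Aut(O (x) C), acting on C^7 = Im(O) (x) C. *)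
Definition G2C : set 'M[C]_7 := @AutO C.

Definition expm (X : 'M[R]_7) : 'M[R]_7 :=
  \matrix_(i, j) limn (series (fun n : nat => (X ^+ n) i j / n`!%:R)).

(* The Lie algebra of a closed group of matrices. *)
Definition Lie (G : set 'M[R]_7) : set 'M[R]_7 :=
  [set X | forall s : R, G (expm (s *: X))].

Definition g2 : set 'M[R]_7 := Lie G2.

Definition g2C : set 'M[C]_7 :=
  [set Z | exists X Y, [/\ g2 X, g2 Y & Z = toC X + imi *: toC Y]].

(** * Maximal torus, roots, Weyl chamber *)

Definition is_torus (T : set 'M[R]_7) : Prop :=
  [/\ T `<=` G2,
      [/\ T 1, forall A B, T A -> T B -> T (A * B) & forall A, T A -> T A^-1],
      forall A B, T A -> T B -> A * B = B * A,
      compact T & connected T].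

Definition is_maximal_torus (T : set 'M[R]_7) : Prop :=
  is_torus T /\ forall T', is_torus T' -> T `<=` T' -> T' = T.

(* Weights and roots are the real-valued functionals w on t such that X in t
   acts by sqrt(-1) * w X; only their values on t matter. *)
Definition is_root (t : set 'M[R]_7) (a : 'M[R]_7 -> R) : Prop :=
  (exists2 X, t X & a X != 0) /\
  exists Z, [/\ g2C Z, Z != 0 &
    forall X, t X -> toC X * Z - Z * toC X = (imi * Complex (a X) 0) *: Z].

Definition regular (t : set 'M[R]_7) : set 'M[R]_7 :=
  [set X | t X /\ forall a, is_root t a -> a X != 0].

Definition is_weyl_chamber (t Ch : set 'M[R]_7) : Prop :=
  exists2 X, regular t X & Ch = connected_component (regular t) X.

Definition positive_root (t Ch : set 'M[R]_7) (a : 'M[R]_7 -> R) : Prop :=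
  is_root t a /\ forall X, Ch X -> 0 < a X.

Definition simple_root (t Ch : set 'M[R]_7) (a : 'M[R]_7 -> R) : Prop :=
  positive_root t Ch a /\
  ~ exists b c, [/\ positive_root t Ch b, positive_root t Ch c &
                    forall X, t X -> a X = b X + c X].

(* Root lengths are taken for the invariant inner product -tr(XY) on t, through
   the vectors representing the roots. *)
Definition shorter (t : set 'M[R]_7) (a b : 'M[R]_7 -> R) : Prop :=
  exists A B, [/\ t A /\ t B,
    forall X, t X -> a X = - \tr (A * X),
    forall X, t X -> b X = - \tr (B * X) &
    - \tr (A * A) < - \tr (B * B)].

Definition conjv (v : 'cV[C]_7) : 'cV[C]_7 := map_mx (@conjc R) v.

Definition hermv (u v : 'cV[C]_7) : C := \sum_i u i ord0 * conjc (v i ord0).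

(* X acts on V as the scalar sqrt(-1) c, c real. *)
Definition acts_on (X : 'M[R]_7) (V : {vspace 'cV[C]_7}) (c : R) : Prop :=
  forall v, v \in V -> toC X *m v = (imi * Complex c 0) *: v.

(* The fixed data: a maximal torus T, a Weyl chamber Ch in its Lie algebra, the
   short and long simple roots a1 and a2, and the weight lines L_i of C^7 for
   -3 <= i <= 3 (the values L_i for other i are irrelevant). *)
Definition G2_setup (T Ch : set 'M[R]_7) (a1 a2 : 'M[R]_7 -> R)
    (L : int -> {vspace 'cV[C]_7}) : Prop :=
  let t := Lie T in
  [/\ is_maximal_torus T /\ is_weyl_chamber t Ch,
      [/\ simple_root t Ch a1, simple_root t Ch a2 & shorter t a1 a2],
      [/\ forall i : 'I_7, \dim (L (i%:Z - 3)) = 1%N,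
          (\sum_(i < 7) L (i%:Z - 3))%VS = fullv,
          forall i j : 'I_7, i != j -> forall u v,
            u \in L (i%:Z - 3) -> v \in L (j%:Z - 3) -> hermv u v = 0 &
          forall (i : 'I_7) v, (conjv v \in L (3 - i%:Z)) = (v \in L (i%:Z - 3))] &
      forall X, t X ->
        [/\ acts_on X (L 1) (2 * a1 X + a2 X), acts_on X (L 2) (a1 X),
            acts_on X (L (-3)) (a1 X + a2 X) & acts_on X (L 0) 0]].

(* X acts by sqrt(-1) a on L_1, sqrt(-1) b on L_2, sqrt(-1) c on L_(-3), by the
   opposite values on the conjugate lines, and by 0 on L_0. *)
Definition acts_by (L : int -> {vspace 'cV[C]_7}) (X : 'M[R]_7) (a b c : R) :
    Prop :=
  [/\ [/\ acts_on X (L 1) a, acts_on X (L 2) b & acts_on X (L (-3)) c],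
      [/\ acts_on X (L (-1)) (- a), acts_on X (L (-2)) (- b) &
          acts_on X (L 3) (- c)] &
      acts_on X (L 0) 0].

(** * Loops *)

Definition circle : Type := {z : C | `|z| == 1}.

Lemma expi_subproof (t : R) : `|Complex (cos t) (sin t)| == 1 :> C.
Proof. by rewrite normc_def /= cos2Dsin2 sqrtr1. Qed.

Definition expi (t : R) : circle :=
  exist (fun z : C => `|z| == 1) (Complex (cos t) (sin t)) (expi_subproof t).

Definition lam (z : circle) : C := val z.

Definition loop : Type := circle -> 'M[C]_7.

Definition loop_inv (g : loop) : loop := fun z => (g z)^-1.

(* The loop \sum_(-m <= i <= m) lambda^i zeta_i. *)
Definition laurent (m : nat) (zeta : int -> 'M[C]_7) : loop :=
  fun z => \sum_(i < (2 * m).+1)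
             lam z ^ (i%:Z - m%:Z) *: zeta (i%:Z - m%:Z).

Definition finite_fourier (g : loop) : Prop :=
  exists m zeta, g = laurent m zeta.

Definition smooth (g : loop) : Prop :=
  forall (i j : 'I_7) (n : nat) (t : R),
    derivable (derive1n n (fun s => complex.Re (g (expi s) i j))) t 1 /\
    derivable (derive1n n (fun s => complex.Im (g (expi s) i j))) t 1.

Definition OmegaG2 : set loop :=
  [set g : loop | [/\ forall z, (@toC @` G2) (g z), smooth g & g (expi 0) = 1]].

Definition OmegaAlg : set loop :=
  [set g : loop | [/\ OmegaG2 g, finite_fourier g & finite_fourier (loop_inv g)]].

(* OmegaM m is Omega^m G_2. *)
Definition OmegaM (m : nat) : set loop :=
  [set g : loop | OmegaAlg g /\ exists zeta, g = laurent m zeta /\ zeta m%:Z != 0].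

Definition factorization (g : loop) (bs : seq loop) (ks : seq nat) : Prop :=
  [/\ size bs = size ks, g = (fun z => \prod_(b <- bs) b z) &
      forall i, (i < size bs)%N ->
        OmegaM (nth 0%N ks i) (nth (fun=> 1) bs i)].

(* Complex differentiability on a neighbourhood of the closed disc |z| <= 1. *)
Definition holomorphic_on_disc (f : C -> C) : Prop :=
  exists2 r : R, 1 < r & forall z : C, `|z| < Complex r 0 ->
    derivable (f : C^o -> C^o) z 1.

Definition LambdaPlusAlg : set loop :=
  [set Psi : loop | [/\ forall z, G2C (Psi z),
    exists F : C -> 'M[C]_7,
      [/\ forall z, F (lam z) = Psi z,
          forall x : C, `|x| <= 1 -> G2C (F x) &
          forall i j, holomorphic_on_disc (fun x => F x i j)],
    finite_fourier Psi & finite_fourier (loop_inv Psi)]].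

(** * The space H = L^2(S^1, C^7) and its subspaces *)

(* Subspaces of H are sets of square-integrable functions.  [Hplus] and all the
   sets built from it below are saturated for equality almost everywhere, so no
   quotient is needed. *)
Definition cfun : Type := circle -> 'cV[C]_7.

(* The angles parametrizing the circle once. *)
Definition angles : set R := [set t | 0 <= t <= 2 * pi].

Definition sqnormL2 (f : cfun) : \bar R :=
  (\int[lebesgue_measure]_(t in angles)
     (\sum_(j < 7) (complex.Re (f (expi t) j ord0) ^+ 2 +
                    complex.Im (f (expi t) j ord0) ^+ 2))%R%:E)%E.

Definition L2 : set cfun :=
  [set f : cfun | (forall j : 'I_7,
      measurable_fun angles (fun t => complex.Re (f (expi t) j ord0)) /\
      measurable_fun angles (fun t => complex.Im (f (expi t) j ord0))) /\
    (sqnormL2 f < +oo)%E].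

(* The linear span of the functions lambda^i e_j, i >= 0. *)
Definition span_nonneg : set cfun :=
  [set p : cfun | exists (n : nat) (c : nat -> 'I_7 -> C), p =
    fun z => \sum_(i < n) \sum_(j < 7) (c i j * lam z ^+ i) *: delta_mx j ord0].

Definition Hplus : set cfun :=
  [set f : cfun | L2 f /\ forall e : R, 0 < e ->
    exists2 p, span_nonneg p & (sqnormL2 (fun z => (f z - p z)%R) < e%:E)%E].

Definition mulW (g : loop) (W : set cfun) : set cfun :=
  [set (fun z => g z *m f z) | f in W].

(* lambda^n W *)
Definition shiftW (n : int) (W : set cfun) : set cfun :=
  [set (fun z => lam z ^ n *: f z) | f in W].

Definition addW (V W : set cfun) : set cfun :=
  [set h : cfun | exists f g, [/\ V f, W g & h = fun z => f z + g z]].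

(** * The sets U_xi and the maps between them *)

Definition lattice (t : set 'M[R]_7) : set 'M[R]_7 :=
  [set xi | t xi /\ expm ((2 * pi) *: xi) = 1].

(* - sqrt(-1) ln z, for one branch of ln; [gammaL xi] does not depend on the
   branch when exp (2 pi xi) = e. *)
Definition arg (z : circle) : R :=
  xget 0 [set s | 0 <= s < 2 * pi /\ expi s = z].

Definition gammaL (xi : 'M[R]_7) : loop := fun z => toC (expm (arg z *: xi)).

Definition Uset (xi : 'M[R]_7) : set loop :=
  [set g : loop | OmegaAlg g /\ exists2 Psi, LambdaPlusAlg Psi &
     mulW g Hplus = mulW Psi (mulW (gammaL xi) Hplus)].

Definition eigen_ad (xi : 'M[R]_7) (i : int) : set 'M[C]_7 :=
  [set Z | g2C Z /\ toC xi * Z - Z * toC xi = (imi * i%:~R) *: Z].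

(* The sum of the spaces [eigen_ad xi j] for j <= i. *)
Definition parabolic (xi : 'M[R]_7) (i : int) : set 'M[C]_7 :=
  [set Z | exists (n : nat) (Y : nat -> 'M[C]_7),
     (forall s, (s < n)%N -> eigen_ad xi (i - s%:Z) (Y s)) /\
     Z = \sum_(s < n) Y s].

Definition preceq (xi xi' : 'M[R]_7) : Prop :=
  forall i : nat, parabolic xi i%:Z `<=` parabolic xi' i%:Z.

(* The map U_xi -> U_xi', meaningful when [preceq xi xi'] (the target loop then
   exists and is unique). *)
Definition Umap (xi xi' : 'M[R]_7) (g : loop) : loop :=
  xget (fun=> 1) [set g' : loop | Uset xi' g' /\ exists Psi,
    [/\ LambdaPlusAlg Psi,
        mulW g Hplus = mulW Psi (mulW (gammaL xi) Hplus) &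
        mulW g' Hplus = mulW Psi (mulW (gammaL xi') Hplus)]].

(* The loops beta_r = gamma_(r-1)^-1 gamma_r for r = 1, ..., n. *)
Definition betas (gs : nat -> loop) (n : nat) : seq loop :=
  [seq (fun z => (gs r.-1 z)^-1 * gs r z) | r <- iota 1 n].

End G2.

(* Main.v *)
Require Import Defs.
From HB Require Import structures.
From mathcomp Require Import all_boot all_order all_algebra.
From mathcomp Require Import complex.
From mathcomp Require Import all_classical all_reals all_analysis.
From mathcomp Require Import measurable_realfun.
From mathcomp Require Import ring lra zify.
Import Order.TTheory GRing.Theory Num.Theory.
Import numFieldNormedType.Exports.
Set Implicit Arguments.
Unset Strict Implicit.
Unset Printing Implicit Defensive.
Local Open Scope classical_set_scope.
Local Open Scope ring_scope.

(** A holomorphic loop Psi in G_2^C preserves H_+.  Hence, if gamma H_+ = Psi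
    gamma_xi H_+ and if Q is a basis of weight vectors with xi acting by i c_a on
    the a-th one, the columns v_a of Psi Q give W = sum of the lam^(c_a) H_+ v_a
    ([gammaL_frameW]).  Such a set of columns is a frame.  Intersecting with
    lam^n H_+, shifting and adding subspaces with a common frame amounts to
    taking maxima with n, translates and minima of the exponents c_a
    ([frameW_cap], [frameW_shift], [frameW_add]).  The target loop U_(xi, xi')
    (gamma) has by definition the same frame, with the weights of xi' as
    exponents.  So each formula for W^r comes down to seven identities between
    integers (the lemmas on [cap_first] and its variants), and it shows at the
    same time that W^r is independent of Psi ([Umap_formula]).

    Four facts support this.

    Holomorphic loops preserve H_+ because they are polynomial
    ([LambdaPlus_poly]): a loop that is a Laurent polynomial and extends
    holomorphically to the disc has no negative powers, by Cauchy's theorem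
    ([holomorphic_mean0], from Goursat's lemma [rect_int0]).  A Laurent
    polynomial in H_+ has no negative powers either ([Hplus_low_coef0], by
    Bessel's inequality), so that the subspace determines the exponents.

    The target loop exists by the Iwasawa decomposition ([iwasawa]): a loop
    singular at lam = 0 is divided by unitary loops of degree one until it is
    invertible there ([unitary_factorization]); the product of these unitary
    loops takes values in G_2 because the loops that measure the failure of this
    are both holomorphic and antiholomorphic, hence constant
    ([unitary_factor_G2]).  It is unique, since a real loop without negative
    powers of lam has no positive powers ([OmegaAlg_inj]).

    The quotient gamma_(r-1)^-1 gamma_r maps H_+ into lam^(-m) H_+ exactly when
    no weight of xi_r is smaller than that of xi_(r-1) by more than m
    ([frame_quot]); by the same symmetry between powers it then is a Laurent
    polynomial of degree m, with a nonzero top coefficient if m is optimal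
    ([OmegaM_intro], [chain_factorization]).

    The relation between xi and xi_r follows from inequalities between
    differences of weights: an eigenvector of ad xi decomposes under ad xi_r, and
    its components stay in the Lie algebra because they are Fourier coefficients
    of its conjugates by the one-parameter group of xi_r ([preceq_weights]).
    This uses the description of the Lie algebra of G_2 as the space of
    derivations of the cross product ([g2P], [g2CP]). *)

(** * Automorphisms of the octonions as orthogonal matrices *)

Section Automorphisms.
Variable K : comNzRingType.
Implicit Types (u v w : 'cV[K]_7) (A B : 'M[K]_7).

Definition G2mat A : Prop :=
  A^T *m A = 1%:M /\ forall u v, A *m cross u v = cross (A *m u) (A *m v).

Lemma crossDl u v w : cross (u + v) w = cross u w + cross v w.
Proof.
apply/colP => k; rewrite !mxE -big_split; apply: eq_bigr => i _ /=.
by rewrite -big_split; apply: eq_bigr => j _ /=; rewrite !mxE; ring.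
Qed.

Lemma crossDr u v w : cross u (v + w) = cross u v + cross u w.
Proof.
apply/colP => k; rewrite !mxE -big_split; apply: eq_bigr => i _ /=.
by rewrite -big_split; apply: eq_bigr => j _ /=; rewrite !mxE; ring.
Qed.

Lemma crossZl a u v : cross (a *: u) v = a *: cross u v.
Proof.
apply/colP => k; rewrite !mxE mulr_sumr; apply: eq_bigr => i _ /=.
by rewrite mulr_sumr; apply: eq_bigr => j _ /=; rewrite !mxE; ring.
Qed.

Lemma crossZr a u v : cross u (a *: v) = a *: cross u v.
Proof.
apply/colP => k; rewrite !mxE mulr_sumr; apply: eq_bigr => i _ /=.
by rewrite mulr_sumr; apply: eq_bigr => j _ /=; rewrite !mxE; ring.
Qed.

Lemma cross0r u : cross u 0 = 0.
Proof. by have := crossZr 0 u 0; rewrite !scale0r. Qed.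

Lemma cross0l u : cross 0 u = 0.
Proof. by have := crossZl 0 0 u; rewrite !scale0r. Qed.

Lemma dotpE u v : dotp u v = (u^T *m v) ord0 ord0.
Proof. by rewrite mxE; apply: eq_bigr => i _; rewrite mxE. Qed.

Lemma dotp_trmx A u v : dotp (A *m u) v = dotp u (A^T *m v).
Proof. by rewrite !dotpE trmx_mul mulmxA. Qed.

Lemma dotp_delta i v : dotp (delta_mx i ord0) v = v i ord0.
Proof.
rewrite /dotp (bigD1 i) //= big1 ?addr0 ?mxE ?eqxx ?mul1r // => j ji.
by rewrite mxE (negbTE ji) mul0r.
Qed.

Lemma delta_mulmx_delta A i j :
  dotp (delta_mx i ord0) (A *m delta_mx j ord0) = A i j.
Proof. by rewrite dotp_delta -colE mxE. Qed.

(** An automorphism f fixes the unit (1, 0) and restricts to A on the imaginary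
    part; comparing f (u v) with f u * f v for imaginary u and v, the real part
    says that A preserves the dot product and the imaginary part that it
    preserves the cross product. *)
Lemma AutOP A : AutO A <-> G2mat A.
Proof.
split.
- move=> [f [[[g fK gK] fM] fA]].
  have f1 : f (1, 0) = (1, 0).
    have e1 : omul (f (1, 0)) (1, 0) = (1, 0).
      rewrite -{2}[(1, 0)]gK -[in RHS](gK (1, 0)) -fM.
      congr (f _); rewrite /omul /= mul1r scale1r scaler0 addr0 cross0l addr0.
      by rewrite /dotp big1 ?subr0 -?surjective_pairing // => i _; rewrite mxE mul0r.
    move: e1; rewrite /omul /=; case: (f (1, 0)) => a u /=.
    rewrite mulr1 scaler0 scale1r add0r cross0r addr0.
    by rewrite /dotp big1 ?subr0 // => i _; rewrite mxE mulr0.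
  have fE a u : f (a, u) = (a, A *m u).
    have -> : (a, u) = a *: (1, 0) + (0, u) :> (K^o * 'cV[K]_7)%type.
      by congr pair; rewrite /= ?addr0 ?scaler0 ?add0r //; exact/esym/mulr1.
    rewrite linearD linearZ /= f1 fA.
    by congr pair; rewrite /= ?addr0 ?scaler0 ?add0r //; exact: mulr1.
  have key u v : (- dotp u v, A *m cross u v) =
                 (- dotp (A *m u) (A *m v), cross (A *m u) (A *m v)).
    have := fM (0, u) (0, v).
    by rewrite /omul /= !fE /= !mul0r !scale0r !add0r.
  split; last by move=> u v; case: (key u v).
  apply/matrixP => i j; rewrite -delta_mulmx_delta -mulmxA -dotp_trmx.
  have [/oppr_inj <- _] := key (delta_mx i ord0) (delta_mx j ord0).
  by rewrite dotp_delta !mxE eqxx andbT.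
- move=> [AA Ac].
  have AA' : A *m A^T = 1%:M by apply: mulmx1C.
  pose h (x : K^o * 'cV[K]_7) : K^o * 'cV[K]_7 := (x.1, A *m x.2).
  have hL : linear h.
    move=> a x y; congr pair; rewrite //= mulmxDr -scalemxAr //.
  pose hl : {linear (K^o * 'cV[K]_7)%type -> (K^o * 'cV[K]_7)%type} := HB.pack h (GRing.isLinear.Build _ _ _ _ h hL).
  exists hl; split; last by move=> u.
  split.
    exists (fun x => (x.1, A^T *m x.2)) => -[a u]; rewrite /= /h /=;
    by rewrite mulmxA ?AA ?AA' mul1mx.
  move=> [a u] [b v]; rewrite /= /h /omul /= !mulmxDr -!scalemxAr Ac.
  by rewrite [dotp (A *m u) _]dotp_trmx mulmxA AA mul1mx.
Qed.

Lemma G2matM A B : G2mat A -> G2mat B -> G2mat (A *m B).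
Proof.
move=> [A1 A2] [B1 B2]; split.
  by rewrite trmx_mul mulmxA -(mulmxA B^T) A1 mulmx1.
by move=> u v; rewrite -!mulmxA B2 A2.
Qed.

Lemma G2matT A : G2mat A -> G2mat A^T.
Proof.
move=> [A1 A2]; have A1' := mulmx1C A1; split; first by rewrite trmxK.
move=> u v; have /(congr1 (mulmx A^T)) := A2 (A^T *m u) (A^T *m v).
by rewrite !mulmxA A1 A1' !mul1mx.
Qed.

Lemma colE_sum w : w = \sum_i w i ord0 *: delta_mx i ord0.
Proof. by rewrite {1}[w]matrix_sum_delta; apply: eq_bigr => i _; rewrite big_ord1. Qed.

Lemma cross_suml (F : 'I_7 -> 'cV[K]_7) w :
  cross (\sum_i F i) w = \sum_i cross (F i) w.
Proof.
elim/big_rec2: _ => [|i x y _ <-]; first by rewrite cross0l.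
by rewrite crossDl.
Qed.

Lemma cross_sumr (F : 'I_7 -> 'cV[K]_7) w :
  cross w (\sum_i F i) = \sum_i cross w (F i).
Proof.
elim/big_rec2: _ => [|i x y _ <-]; first by rewrite cross0r.
by rewrite crossDr.
Qed.

(** Bilinearity of the product reduces its preservation to a basis. *)
Lemma cross_basis A B C :
  (forall i j, A *m cross (delta_mx i ord0) (delta_mx j ord0) =
               cross (B *m delta_mx i ord0) (C *m delta_mx j ord0)) ->
  forall u v, A *m cross u v = cross (B *m u) (C *m v).
Proof.
move=> H u v.
rewrite [u]colE_sum [v]colE_sum !mulmx_sumr !cross_suml mulmx_sumr; apply: eq_bigr => i _.
rewrite !cross_sumr mulmx_sumr; apply: eq_bigr => j _.
by rewrite -!scalemxAr !crossZl !crossZr -!scalemxAr H.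
Qed.

End Automorphisms.

(** * The matrix exponential and the Lie algebra of G_2 *)

Section MatrixDerivative.
Variable R : realType.

Lemma is_derive_eqf (f g : R -> R) (x a b : R) :
  is_derive x 1 f a -> f =1 g -> a = b -> is_derive x 1 g b.
Proof. by move=> h /funext <- <-. Qed.

Lemma is_derive_uniq (f : R -> R) (x a b : R) :
  is_derive x 1 f a -> is_derive x 1 f b -> a = b.
Proof. by move=> h1 h2; rewrite -(@derive_val _ _ _ _ _ _ _ h1) (@derive_val _ _ _ _ _ _ _ h2). Qed.

Lemma is_derive_fsum n (h : 'I_n -> R -> R) (x : R) (d : 'I_n -> R) :
  (forall i, is_derive x 1 (h i) (d i)) ->
  is_derive x 1 (fun t => \sum_i h i t) (\sum_i d i).
Proof.
move=> H; apply: is_derive_eqf (is_derive_sum H) _ _ => // t.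
by rewrite fct_sumE.
Qed.

Lemma is_derive_fmul (f g : R -> R) (x a b : R) :
  is_derive x 1 f a -> is_derive x 1 g b ->
  is_derive x 1 (fun t => f t * g t) (a * g x + f x * b).
Proof.
move=> hf hg; apply: is_derive_eqf (is_deriveM hf hg) _ _ => //.
by rewrite addrC [g x *: _]mulrC.
Qed.

Lemma is_derive_fadd (f g : R -> R) (x a b : R) :
  is_derive x 1 f a -> is_derive x 1 g b ->
  is_derive x 1 (fun t => f t + g t) (a + b).
Proof. by move=> hf hg; apply: is_derive_eqf (is_deriveD hf hg) _ _. Qed.

Lemma is_derive_fscale (f : R -> R) (x a k : R) :
  is_derive x 1 f a -> is_derive x 1 (fun t => k * f t) (k * a).
Proof.
move=> hf; apply: is_derive_eqf (is_derive_fmul (is_derive_cst k _ _) hf) _ _ => //.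
by rewrite mul0r add0r.
Qed.

Definition mderive m n (F : R -> 'M[R]_(m, n)) (s : R) (D : 'M[R]_(m, n)) :=
  forall i j, is_derive s 1 (fun t => F t i j) (D i j).

Lemma mderive_mul m n p (F : R -> 'M[R]_(m, n)) (G : R -> 'M[R]_(n, p)) s DF DG :
  mderive F s DF -> mderive G s DG ->
  mderive (fun t => F t *m G t) s (DF *m G s + F s *m DG).
Proof.
move=> hF hG i j.
have := is_derive_fsum (fun k => is_derive_fmul (hF i k) (hG k j)).
by move=> h; apply: is_derive_eqf h _ _ => [t|]; rewrite ?mxE // big_split.
Qed.

Lemma mderive_cst m n (A : 'M[R]_(m, n)) s : mderive (fun=> A) s 0.
Proof. by move=> i j; rewrite mxE; exact: is_derive_cst. Qed.

Lemma mderive_sub m n (F G : R -> 'M[R]_(m, n)) s DF DG :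
  mderive F s DF -> mderive G s DG -> mderive (fun t => F t - G t) s (DF - DG).
Proof.
move=> hF hG i j.
apply: is_derive_eqf (is_derive_fadd (hF i j) (is_derive_fscale (-1) (hG i j))) _ _.
  by move=> t; rewrite !mxE mulN1r.
by rewrite !mxE mulN1r.
Qed.

Lemma mderive_tr m n (F : R -> 'M[R]_(m, n)) s DF :
  mderive F s DF -> mderive (fun t => (F t)^T) s DF^T.
Proof. by move=> h i j; rewrite mxE; apply: is_derive_eqf (h j i) _ _ => // t; rewrite mxE. Qed.

Lemma mderive_cross (F G : R -> 'cV[R]_7) s DF DG :
  mderive F s DF -> mderive G s DG ->
  mderive (fun t => cross (F t) (G t)) s (cross DF (G s) + cross (F s) DG).
Proof.
move=> hF hG k l.
have := is_derive_fsum (fun i => is_derive_fsum (fun j => is_derive_fscale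
   ((fano i j k)%:R - (fano j i k)%:R)
   (is_derive_fmul (hF i ord0) (hG j ord0)))).
move=> h; apply: is_derive_eqf h _ _ => [t|]; rewrite !mxE // -big_split.
apply: eq_bigr => i _; rewrite -big_split; apply: eq_bigr => j _ /=.
by rewrite mulrDr.
Qed.

Lemma mderive_uniq m n (F : R -> 'M[R]_(m, n)) s D1 D2 :
  mderive F s D1 -> mderive F s D2 -> D1 = D2.
Proof. by move=> h1 h2; apply/matrixP => i j; exact: is_derive_uniq (h1 i j) (h2 i j). Qed.

Lemma mderive0_cst m n (F : R -> 'M[R]_(m, n)) :
  (forall s, mderive F s 0) -> forall s t, F s = F t.
Proof.
move=> h s t; apply/matrixP => i j.
apply: (is_derive_0_is_cst (f := fun t => F t i j)) => u.
by have := h u i j; rewrite mxE.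
Qed.

End MatrixDerivative.

Section SeriesSum.
Variable R : realType.

Lemma series_fsum (I : Type) (r : seq I) (P : pred I) (F : I -> R ^nat) :
  (forall i, cvgn (series (F i))) ->
  cvgn (series (fun n => \sum_(i <- r | P i) F i n)) /\
  limn (series (fun n => \sum_(i <- r | P i) F i n)) =
    \sum_(i <- r | P i) limn (series (F i)).
Proof.
move=> h; elim: r => [|i r [IH1 IH2]].
  have -> : (fun n => \sum_(i <- [::] | P i) F i n) = (fun=> 0).
    by apply/funext => n; rewrite big_nil.
  have -> : series (fun=> 0 : R) = fun=> 0.
    by apply/funext => n; rewrite /series /= big1.
  by rewrite big_nil; split; [exact: is_cvg_cst | exact: lim_cst].
case Pi : (P i); last first.
  have -> : (fun n => \sum_(j <- i :: r | P j) F j n) =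
            (fun n => \sum_(j <- r | P j) F j n).
    by apply/funext => n; rewrite big_cons Pi.
  by rewrite big_cons Pi.
have -> : (fun n => \sum_(j <- i :: r | P j) F j n) =
          (F i + (fun n => \sum_(j <- r | P j) F j n))%R.
  by apply/funext => n; rewrite big_cons Pi.
split; first exact: is_cvg_seriesD.
by rewrite lim_seriesD // IH2 big_cons Pi.
Qed.

Lemma series_fscale (k : R) (f : R ^nat) : cvgn (series f) ->
  cvgn (series (fun n => k * f n)) /\
  limn (series (fun n => k * f n)) = k * limn (series f).
Proof. by move=> h; split; [exact: is_cvg_seriesZ | exact: lim_seriesZ]. Qed.

End SeriesSum.

Section MatrixExponential.
Variable R : realType.
Implicit Types (X Y A B : 'M[R]_7) (s : R).

Let entry_coef B X (i j : 'I_7) (n : nat) : R := (B *m X ^+ n) i j / n`!%:R.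

Lemma expr_entry_bound X : exists2 K : R, 0 <= K &
  forall n i j, `|(X ^+ n) i j| <= K ^+ n.
Proof.
exists (\sum_i \sum_j `|X i j|).
  by apply: sumr_ge0 => i _; apply: sumr_ge0.
have row_le i : \sum_j `|X i j| <= \sum_i \sum_j `|X i j|.
  rewrite [leRHS](bigD1 i) //= lerDl; apply: sumr_ge0 => k _; exact: sumr_ge0.
elim => [|n IH] i j.
  by rewrite !expr0 mxE; case: eqP => _; rewrite ?normr1 ?normr0.
rewrite !exprS mxE; apply: le_trans (ler_norm_sum _ _ _) _.
apply: (@le_trans _ _ (\sum_k `|X i k| * (\sum_i \sum_j `|X i j|) ^+ n)).
  by apply: ler_sum => k _; rewrite normrM ler_wpM2l.
rewrite -mulr_suml ler_wpM2r ?exprn_ge0 //.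
by apply: sumr_ge0 => k _; apply: sumr_ge0.
Qed.

Lemma expm_entry_cvg X i j s :
  cvgn (pseries (fun n => (X ^+ n) i j / n`!%:R) s).
Proof.
have [K K0 HK] := expr_entry_bound X.
apply: normed_cvg.
apply: series_le_cvg (is_cvg_series_exp_coeff (K * `|s|)) => n /=.
- exact: normr_ge0.
- by rewrite /exp_coeff /= divr_ge0 // exprn_ge0 // mulr_ge0.
rewrite /exp_coeff /= !normrM normfV normr_nat exprMn normrX mulrAC.
by rewrite ler_wpM2r ?invr_ge0 // ler_wpM2r ?exprn_ge0.
Qed.

Lemma expm_entryE X i j s :
  expm (s *: X) i j = limn (pseries (fun n => (X ^+ n) i j / n`!%:R) s).
Proof.
rewrite mxE; congr (lim (series _ @ \oo)); apply/funext => n.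
by rewrite exprZn mxE [s ^+ n * _]mulrC mulrAC.
Qed.

Let entry_coef_cvg B X i j s :
  cvgn (pseries (entry_coef B X i j) s) /\
  limn (pseries (entry_coef B X i j) s) = (B *m expm (s *: X)) i j.
Proof.
pose F (k : 'I_7) n := B i k * ((X ^+ n) k j / n`!%:R * s ^+ n).
have hF k : cvgn (series (fun n => (X ^+ n) k j / n`!%:R * s ^+ n)).
  exact: expm_entry_cvg.
have hF' k := series_fscale (B i k) (hF k).
have -> : pseries (entry_coef B X i j) s = series (fun n => \sum_k F k n).
  rewrite /pseries; congr (series _); apply/funext => n.
  rewrite /entry_coef /= mxE !mulr_suml; apply: eq_bigr => k _.
  by rewrite /F !mulrA.
have [h1 h2] := series_fsum (index_enum 'I_7) xpredT (fun k => (hF' k).1).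
split=> //; rewrite h2 mxE; apply: eq_bigr => k _.
by rewrite (hF' k).2 expm_entryE.
Qed.

Let entry_coef_diffs B X i j :
  pseries_diffs (entry_coef B X i j) = entry_coef (B *m X) X i j.
Proof.
apply/funext => n; rewrite /pseries_diffs /entry_coef exprS -mulmxA.
rewrite factS natrM invfM mulrCA; congr (_ * _).
by rewrite mulrA divff ?mul1r // pnatr_eq0.
Qed.

(** Term by term differentiation of the power series of each entry.  The
    derived series is again of the same kind, with coefficients multiplied by X. *)
Lemma expm_mderive X s : mderive (fun t => expm (t *: X)) s (X *m expm (s *: X)).
Proof.
move=> i j.
have e1 t : expm (t *: X) i j = limn (pseries (entry_coef 1%:M X i j) t).
  by rewrite (entry_coef_cvg _ _ _ _ _).2 mul1mx.
have e2 : (X *m expm (s *: X)) i j =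
    limn (pseries (pseries_diffs (entry_coef 1%:M X i j)) s).
  by rewrite entry_coef_diffs mul1mx (entry_coef_cvg _ _ _ _ _).2.
have := @pseries_snd_diffs R (entry_coef 1%:M X i j) (`|s| + 1) s.
rewrite !entry_coef_diffs mul1mx.
move=> /(_ (entry_coef_cvg _ _ _ _ _).1 (entry_coef_cvg _ _ _ _ _).1
           (entry_coef_cvg _ _ _ _ _).1) h.
rewrite e2 entry_coef_diffs mul1mx; apply: is_derive_eqf (h _) _ _ => //.
by rewrite [ltRHS]ger0_norm ?addr_ge0 // ltrDl.
Qed.

Lemma expm0 : expm (0 : 'M[R]_7) = 1%:M.
Proof.
apply/matrixP => i j; rewrite mxE; apply: cvg_lim => //.
rewrite -(cvg_shiftS _); apply: cvg_near_cst; apply: nearW => n.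
rewrite /series /= big_nat_recl //= big1 ?addr0.
  by rewrite expr0 divr1.
by move=> k _; rewrite expr0n /= mxE mul0r.
Qed.

End MatrixExponential.

Section LieAlgebra.
Variable R : realType.

Definition G2der (K : comNzRingType) (X : 'M[K]_7) : Prop :=
  X^T = - X /\
  forall u v, X *m cross u v = cross (X *m u) v + cross u (X *m v).

(** The squared norm of a solution is constant along a skew flow. *)
Lemma skew_flow_eq0 n (X : 'M[R]_n) (D : R -> 'cV[R]_n) :
  X^T = - X -> (forall t, mderive D t (X *m D t)) -> D 0 = 0 ->
  forall s, D s = 0.
Proof.
move=> XT dD D0 s.
have N0 : (D s)^T *m D s = 0.
  rewrite (mderive0_cst (F := fun t => (D t)^T *m D t) _ s 0) ?D0 ?mulmx0 // => t.
  have := mderive_mul (mderive_tr (dD t)) (dD t).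
  by rewrite trmx_mul XT mulmxN mulNmx -mulmxA addNr.
apply/colP => k; rewrite [RHS]mxE.
have := congr1 (fun M : 'M[R]_1 => M ord0 ord0) N0.
rewrite !mxE => /eqP; rewrite psumr_eq0; last first.
  by move=> i _; rewrite mxE -expr2 sqr_ge0.
by move=> /allP /(_ k (mem_index_enum _)); rewrite mxE mulf_eq0 orbb => /eqP.
Qed.

(** Differentiating the equations of the group along exp (s X) at s = 0 gives
    the equations of a derivation.  Conversely, if X is a derivation, then
    exp (s X) (u x v) and (exp (s X) u) x (exp (s X) v) solve the same linear
    equation with skew matrix X and agree at s = 0. *)
Lemma g2P (X : 'M[R]_7) : g2 X <-> G2der X.
Proof.
pose E s := expm (s *: X).
have E0 : E 0 = 1%:M by rewrite /E scale0r expm0.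
have dE s : mderive E s (X *m E s) := expm_mderive X s.
have dEu (u : 'cV[R]_7) s : mderive (fun t => E t *m u) s (X *m (E s *m u)).
  by have := mderive_mul (dE s) (mderive_cst u s); rewrite mulmx0 addr0 mulmxA.
have dEE s : mderive (fun t => (E t)^T *m E t) s
               ((E s)^T *m (X^T + X) *m E s).
  have := mderive_mul (mderive_tr (dE s)) (dE s).
  by rewrite trmx_mul mulmxDr mulmxDl !mulmxA.
split=> [gX|[XT Xc] s].
- have {}gX s : G2mat (E s) by apply/AutOP; exact: gX.
  split.
    have : mderive (fun t => (E t)^T *m E t) 0 0.
      by move=> i j; apply: is_derive_eqf (mderive_cst 1%:M 0 i j) _ _ => // t;
         rewrite (gX t).1.
    move=> /(mderive_uniq (dEE 0)); rewrite E0 trmx1 mul1mx mulmx1.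
    by move=> /eqP; rewrite addr_eq0 => /eqP.
  move=> u v; have := mderive_uniq (dEu (cross u v) 0).
  rewrite E0 !mul1mx; apply.
  have := mderive_cross (dEu u 0) (dEu v 0); rewrite E0 !mul1mx => h i j.
  by apply: is_derive_eqf (h i j) _ _ => // t; rewrite (gX t).2.
- apply/AutOP; rewrite -/(E s); split.
    have := @mderive0_cst _ _ _ (fun t => (E t)^T *m E t) _ s 0.
    rewrite E0 trmx1 mul1mx; apply=> t i j.
    by have := dEE t i j; rewrite XT addNr mulmx0 mul0mx.
  move=> u v; apply/eqP; rewrite -subr_eq0; apply/eqP.
  pose D t := E t *m cross u v - cross (E t *m u) (E t *m v).
  have dD t : mderive D t (X *m D t).
    rewrite mulmxBr Xc.
    exact: mderive_sub (dEu _ _) (mderive_cross (dEu _ _) (dEu _ _)).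
  apply: (skew_flow_eq0 XT dD).
  by rewrite /D E0 !mul1mx subrr.
Qed.

End LieAlgebra.

(** * Complexification *)

Section DerivationSpace.
Variable K : comNzRingType.

Lemma G2der_lin a (X Y : 'M[K]_7) : G2der X -> G2der Y -> G2der (a *: X + Y).
Proof.
move=> [X1 X2] [Y1 Y2]; split; first by rewrite linearD linearZ /= X1 Y1 opprD scalerN.
move=> u v; rewrite !mulmxDl -!scalemxAl X2 Y2.
by rewrite crossDl crossDr crossZl crossZr scalerDr addrACA.
Qed.

Lemma G2der0 : G2der (0 : 'M[K]_7).
Proof. by split=> [|u v]; rewrite ?trmx0 ?oppr0 // !mul0mx cross0l cross0r addr0. Qed.

Lemma G2der_conj (A X : 'M[K]_7) : G2mat A -> G2der X -> G2der (A *m X *m A^T).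
Proof.
move=> [A1 A2] [X1 X2]; have A1' := mulmx1C A1; have [_ AT2] := G2matT (conj A1 A2).
split; first by rewrite !trmx_mul trmxK X1 mulNmx mulmxN mulmxA.
move=> u v; rewrite -!mulmxA AT2 X2 mulmxDr !A2.
by rewrite !(mulmxA A A^T) A1' !mul1mx.
Qed.

(** Bilinearity of the product reduces the Leibniz rule to a basis. *)
Lemma der_basis (X : 'M[K]_7) :
  (forall i j, X *m cross (delta_mx i ord0) (delta_mx j ord0) =
     cross (X *m delta_mx i ord0) (delta_mx j ord0) +
     cross (delta_mx i ord0) (X *m delta_mx j ord0)) ->
  forall u v, X *m cross u v = cross (X *m u) v + cross u (X *m v).
Proof.
move=> H u v.
rewrite [u]colE_sum [v]colE_sum !mulmx_sumr !cross_suml mulmx_sumr -big_split.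
apply: eq_bigr => i _ /=; rewrite !cross_sumr mulmx_sumr -big_split.
apply: eq_bigr => j _ /=.
by rewrite -!scalemxAr !crossZl !crossZr -!scalemxAr H !scalerDr.
Qed.

End DerivationSpace.

Section BaseChange.
Variables (K K' : comNzRingType) (f : {rmorphism K -> K'}).
Local Notation "A ^f" := (map_mx f A).

Lemma map_cross (u v : 'cV[K]_7) : (cross u v)^f = cross u^f v^f.
Proof.
apply/colP => k; rewrite !mxE rmorph_sum; apply: eq_bigr => i _ /=.
rewrite rmorph_sum; apply: eq_bigr => j _ /=.
by rewrite !mxE !rmorphM rmorphB !rmorph_nat.
Qed.

Lemma map_delta m n (i : 'I_m) (j : 'I_n) :
  (delta_mx i j : 'M[K]_(m, n))^f = delta_mx i j.
Proof. by apply/matrixP => k l; rewrite !mxE rmorph_nat. Qed.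

Lemma G2mat_map (A : 'M[K]_7) : G2mat A -> G2mat A^f.
Proof.
move=> [A1 A2]; split; first by rewrite map_trmx -map_mxM A1 map_mx1.
apply: cross_basis => i j.
by rewrite -!map_delta -map_cross -!map_mxM A2 map_cross.
Qed.

Lemma G2der_map (A : 'M[K]_7) : G2der A -> G2der A^f.
Proof.
move=> [A1 A2]; split; first by rewrite map_trmx A1 map_mxN.
apply: der_basis => i j.
by rewrite -!map_delta -map_cross -!map_mxM A2 map_mxD !map_cross.
Qed.

Hypothesis finj : injective f.

Lemma map_mx_injective m n : injective (fun A : 'M[K]_(m, n) => A^f).
Proof.
move=> A B /matrixP H; apply/matrixP => i j; apply: finj.
by have := H i j; rewrite !mxE.
Qed.

Lemma G2mat_unmap (A : 'M[K]_7) : G2mat A^f -> G2mat A.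
Proof.
move=> [A1 A2]; split.
  by apply: map_mx_injective; rewrite map_mxM -map_trmx A1 map_mx1.
by move=> u v; apply: map_mx_injective; rewrite map_cross !map_mxM map_cross A2.
Qed.

Lemma G2der_unmap (A : 'M[K]_7) : G2der A^f -> G2der A.
Proof.
move=> [A1 A2]; split.
  by apply: map_mx_injective; rewrite -map_trmx A1 map_mxN.
move=> u v; apply: map_mx_injective.
by rewrite map_mxD !map_cross !map_mxM map_cross A2.
Qed.

End BaseChange.

Section Complexification.
Variable R : realType.
Local Notation C := R[i].

Definition conjm m n (A : 'M[C]_(m, n)) : 'M[C]_(m, n) := map_mx (@conjc R) A.

Lemma toC_inj : injective (@toC R).
Proof. exact: (map_mx_injective (@complexI R)). Qed.

Lemma conjm_real (B : 'M[C]_7) : conjm B = B -> exists A, toC A = B.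
Proof.
move=> /matrixP H; exists (map_mx (@complex.Re R) B).
apply/matrixP => i j; have := H i j; rewrite !mxE.
case: (B i j) => a b [/eqP]; rewrite -subr_eq0 -opprD oppr_eq0 -mulr2n.
by rewrite mulrn_eq0 => /eqP ->.
Qed.

Lemma conjm_toC (A : 'M[R]_7) : conjm (toC A) = toC A.
Proof. by apply/matrixP => i j; rewrite !mxE /= oppr0. Qed.

Lemma G2_toC (A : 'M[R]_7) : G2 A <-> G2mat (toC A).
Proof.
split=> [/AutOP|] h; first exact: (G2mat_map (real_complex R)).
by apply/AutOP; apply: (@G2mat_unmap _ _ (real_complex R)) h; exact: complexI.
Qed.

Lemma toC_G2P (B : 'M[C]_7) : (@toC R @` G2 (R:=R)) B <-> G2mat B /\ conjm B = B.
Proof.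
split=> [[A /G2_toC gA <-]|[gB /conjm_real [A AB]]]; first by rewrite conjm_toC.
by exists A => //; apply/G2_toC; rewrite AB.
Qed.

(** The equations of a derivation are linear with real coefficients, so that
    they hold for Z if and only if they hold for its real and imaginary parts. *)
Lemma g2CP (Z : 'M[C]_7) : g2C Z <-> G2der Z.
Proof.
split=> [[X [Y [/g2P gX /g2P gY ->]]]|gZ].
  rewrite addrC; apply: G2der_lin; exact: (G2der_map (real_complex R)).
have gZ' : G2der (conjm Z) := G2der_map (@conjc R) gZ.
exists (map_mx (@complex.Re R) Z), (map_mx (@complex.Im R) Z); split.
- apply/g2P; apply: (@G2der_unmap _ _ (real_complex R)); first exact: complexI.
  have -> : map_mx (real_complex R) (map_mx (@complex.Re R) Z) =
            2^-1 *: Z + (2^-1 *: conjm Z + 0).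
    by apply/matrixP => i j; rewrite !mxE ReJ_add; ring.
  exact: (G2der_lin _ gZ (G2der_lin _ gZ' (G2der0 _))).
- apply/g2P; apply: (@G2der_unmap _ _ (real_complex R)); first exact: complexI.
  have -> : map_mx (real_complex R) (map_mx (@complex.Im R) Z) =
            (- imi R / 2) *: Z + ((imi R / 2) *: conjm Z + 0).
    by apply/matrixP => i j; rewrite !mxE ImJ_sub /imi; ring.
  exact: (G2der_lin _ gZ (G2der_lin _ gZ' (G2der0 _))).
- by apply/matrixP => i j; rewrite !mxE {1}[Z i j]complexE.
Qed.

End Complexification.

(** * Polynomials on the unit circle and Laurent loops *)

Section CirclePolynomials.
Variable R : realType.
Local Notation C := R[i].
Local Notation circle := (circle R).
Implicit Types (z : circle) (p q : {poly C}).

Lemma lam_norm z : `|lam z| = 1.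
Proof. by apply/eqP; case: z. Qed.

Lemma lam_neq0 z : lam z != 0.
Proof. by rewrite -normr_eq0 lam_norm oner_eq0. Qed.

Lemma lam_mulJ z : lam z * conjc (lam z) = 1.
Proof. by rewrite -sqr_normc lam_norm expr1n. Qed.

Lemma conj_lam z : conjc (lam z) = (lam z)^-1.
Proof. by apply: (mulfI (lam_neq0 z)); rewrite lam_mulJ divff // lam_neq0. Qed.

Lemma lam_expi0 : lam (expi (0 : R)) = 1.
Proof. by rewrite /lam /= cos0 sin0. Qed.

(** The points (1 + n i) / (1 - n i) give infinitely many elements of the
    circle, so a polynomial is determined by its values there. *)
Lemma poly_circle0 p : (forall z, p.[lam z] = 0) -> p = 0.
Proof.
move=> p0.
pose w (n : nat) : C := Complex 1 n%:R / Complex 1 (- n%:R).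
have w0 n : Complex 1 (- n%:R) != 0 :> C by rewrite eq_complex /= oner_eq0.
have w1 n : `|w n| == 1.
  have := w0 n; rewrite -normr_eq0 normrM normfV => n0.
  by rewrite -[Complex 1 n%:R]conjcK normcJ divff.
have winj : injective w.
  move=> n m /eqP; rewrite eqr_div // => /eqP [].
  move=> _ H; have {}H : (n%:R : R) = m%:R by lra.
  by apply/eqP; rewrite -(eqr_nat R) H.
apply/eqP/negPn/negP => pn0.
have := @max_poly_roots _ p (mkseq w (size p)) pn0.
rewrite size_mkseq ltnn => H; suff : false by []; apply: H.
  apply/allP => x /mapP [n _ ->].
  by rewrite /root; apply/eqP; exact: (p0 (exist _ (w n) (w1 n))).
by rewrite mkseq_uniq.
Qed.

Lemma poly_circle_eq p q : (forall z, p.[lam z] = q.[lam z]) -> p = q.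
Proof.
by move=> H; apply/eqP; rewrite -subr_eq0; apply/eqP/poly_circle0 => z;
  rewrite hornerD hornerN H subrr.
Qed.

(** On the unit circle conjugation inverts lam, so that the conjugate of a
    polynomial, multiplied by lam^N, has the conjugate coefficients in the
    reverse order. *)
Lemma poly_circle_conj N p q : (size p <= N.+1)%N ->
  (forall z, lam z ^+ N * conjc p.[lam z] = q.[lam z]) ->
  q = \poly_(i < N.+1) conjc p`_(N - i).
Proof.
move=> sp H; apply: poly_circle_eq => z; rewrite -H.
rewrite (horner_coef_wide _ sp) horner_poly rmorph_sum mulr_sumr.
rewrite (reindex_inj rev_ord_inj); apply: eq_bigr => i _ /=.
rewrite subSS rmorphM rmorphXn /= conj_lam mulrCA; congr (_ * _).
have iN : (i <= N)%N by rewrite -ltnS.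
by rewrite -{1}(subnKC iN) exprD -mulrA exprVn divff ?mulr1 // expf_neq0 ?lam_neq0.
Qed.

(** A holomorphic polynomial whose conjugate is again holomorphic has no
    coefficient of positive degree. *)
Lemma poly_circle_conj_const p q :
  (forall z, conjc p.[lam z] = q.[lam z]) -> exists c, p = c%:P.
Proof.
move=> H; set N := size p.
have := @poly_circle_conj N p ('X^N * q) (leqnSn _).
move=> /(_ _) E; exists p`_0; apply/polyP => -[|j]; rewrite coefC //=.
have [jN|] := leqP j.+1 N; last by move=> h; rewrite nth_default // ltnW.
have {}E := E (fun z => _).
have : ('X^N * q)`_(N - j.+1) = conjc p`_j.+1.
  rewrite E; first by rewrite coef_poly ltnS leq_subr subKn.
  by move=> z; rewrite H hornerM hornerXn.
rewrite coefXnM ltn_subrL /= (leq_trans _ jN) // => /esym/eqP.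
by rewrite conjc_eq0 => /eqP.
Qed.

End CirclePolynomials.

Section LaurentLoops.
Variable R : realType.
Local Notation C := R[i].
Local Notation circle := (circle R).
Implicit Types z : circle.

Definition mxev m n (P : 'M[{poly C}]_(m, n)) z : 'M[C]_(m, n) :=
  map_mx (horner_eval (lam z)) P.

Lemma mxev_mul m n p (P : 'M[{poly C}]_(m, n)) (Q : 'M[{poly C}]_(n, p)) z :
  mxev (P *m Q) z = mxev P z *m mxev Q z.
Proof. exact: map_mxM. Qed.

Lemma mxevB m n (P Q : 'M[{poly C}]_(m, n)) z :
  mxev (P - Q) z = mxev P z - mxev Q z.
Proof. exact: map_mxB. Qed.

Lemma mxev_scale m n (a : {poly C}) (P : 'M[{poly C}]_(m, n)) z :
  mxev (a *: P) z = a.[lam z] *: mxev P z.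
Proof. exact: map_mxZ. Qed.

Lemma mxev_tr m n (P : 'M[{poly C}]_(m, n)) z : mxev P^T z = (mxev P z)^T.
Proof. by rewrite /mxev map_trmx. Qed.

Lemma mxev_cst m n (A : 'M[C]_(m, n)) z : mxev (map_mx polyC A) z = A.
Proof. by apply/matrixP => i j; rewrite !mxE /horner_eval hornerC. Qed.

Lemma mxev1 n z : mxev (1%:M : 'M[{poly C}]_n) z = 1%:M.
Proof. exact: map_mx1. Qed.

Lemma mxev_inj m n (P Q : 'M[{poly C}]_(m, n)) :
  (forall z, mxev P z = mxev Q z) -> P = Q.
Proof.
move=> H; apply/matrixP => i j; apply: poly_circle_eq => z.
by have /matrixP/(_ i j) := H z; rewrite !mxE.
Qed.

Definition coefmx m n (P : 'M[{poly C}]_(m, n)) (k : nat) : 'M[C]_(m, n) :=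
  map_mx (fun p : {poly C} => p`_k) P.

Lemma mxevE m n (P : 'M[{poly C}]_(m, n)) N z :
  (forall i j, (size (P i j) <= N)%N) ->
  mxev P z = \sum_(k < N) lam z ^+ k *: coefmx P k.
Proof.
move=> sP; apply/matrixP => i j; rewrite summxE mxE /horner_eval.
rewrite (horner_coef_wide _ (sP i j)); apply: eq_bigr => k _.
by rewrite !mxE mulrC.
Qed.

(** Laurent polynomials are handled as polynomials over a power of lam, which
    makes the theory of {poly C} and of matrices over it available. *)
Definition poly_over_lam (g : loop R) (n : nat) (P : 'M[{poly C}]_7) : Prop :=
  forall z, g z = lam z ^- n *: mxev P z.

Lemma laurent_coefmx m (P : 'M[{poly C}]_7) :
  (forall i j, (size (P i j) <= (2 * m).+1)%N) ->
  (fun z => lam z ^- m *: mxev P z) =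
    laurent m (fun j => coefmx P (absz (j + m%:Z))).
Proof.
move=> sP; apply/funext => z; rewrite (mxevE _ sP) scaler_sumr.
apply: eq_bigr => i _; rewrite subrK absz_nat scalerA; congr (_ *: _).
by rewrite expfzDr ?lam_neq0 // mulrC -exprnP -exprnN.
Qed.

Lemma size_bound m n (P : 'M[{poly C}]_(m, n)) :
  exists N, forall i j, (size (P i j) <= N)%N.
Proof.
exists (\max_i \max_j size (P i j))%N => i j.
by apply: leq_trans (leq_bigmax i); exact: (leq_bigmax j).
Qed.

Lemma poly_over_lam_shift g n P k : poly_over_lam g n P ->
  poly_over_lam g (k + n) ('X^k *: P).
Proof.
move=> H z; rewrite H mxev_scale hornerXn scalerA; congr (_ *: _).
by rewrite exprD invfM mulrC mulrA divff ?mul1r // expf_neq0 // lam_neq0.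
Qed.

Lemma finite_fourierP (g : loop R) :
  finite_fourier g <-> exists n P, poly_over_lam g n P.
Proof.
split=> [[m [zeta ->]]|[n [P H]]].
  exists m, (\matrix_(i, j) \poly_(k < (2 * m).+1) zeta (k%:Z - m%:Z) i j) => z.
  apply/matrixP => i j; rewrite mxE summxE mxE /horner_eval mxE horner_poly.
  rewrite mulr_sumr; apply: eq_bigr => k _; rewrite mxE.
  by rewrite expfzDr ?lam_neq0 // -exprnP -exprnN; ring.
have [N sP] := size_bound P.
exists (N + n)%N, (fun j => coefmx ('X^N *: P) (absz (j + (N + n)%N%:Z))).
rewrite -laurent_coefmx; first by apply/funext => z; exact: poly_over_lam_shift.
move=> i j; rewrite mxE; apply: leq_trans (size_polyMleq _ _) _.
rewrite size_polyXn addSn /=.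
by apply: leq_trans (leq_add (leqnn N) (sP i j)) _; lia.
Qed.

Lemma finite_fourier_mul (g h : loop R) :
  finite_fourier g -> finite_fourier h -> finite_fourier (fun z => g z * h z).
Proof.
move=> /finite_fourierP [n [P HP]] /finite_fourierP [m [Q HQ]].
apply/finite_fourierP; exists (n + m)%N, (P *m Q) => z.
by rewrite HP HQ mxev_mul exprD invfM -[LHS]/(_ *m _) -scalemxAl -scalemxAr scalerA.
Qed.

Lemma finite_fourier_ev (P : 'M[{poly C}]_7) n :
  finite_fourier (fun z => lam z ^- n *: mxev P z).
Proof. by apply/finite_fourierP; exists n, P. Qed.

End LaurentLoops.

(** * Trigonometric polynomials *)

Section CircleCalculus.
Variable R : realType.
Local Notation C := R[i].
Implicit Types (z : circle R) (t s : R).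

Lemma lam_expi_int t (n : int) :
  lam (expi t) ^ n = Complex (cos (n%:~R * t)) (sin (n%:~R * t)).
Proof.
have nat_case (k : nat) : lam (expi t) ^+ k = Complex (cos (k%:R * t)) (sin (k%:R * t)).
  elim: k => [|k IH]; first by rewrite expr0 mul0r cos0 sin0.
  rewrite exprS IH -addn1 natrD mulrDl mul1r cosD sinD /lam /=.
  by apply/eqP; rewrite eq_complex /=; apply/andP; split; apply/eqP; ring.
case: n => k; first exact: nat_case.
rewrite NegzE -exprnN -exprVn -conj_lam -rmorphXn /= nat_case /=.
by rewrite mulrNz mulNr cosN sinN.
Qed.

Lemma expi_arg z : expi (arg z) = z.
Proof.
rewrite /arg; case: xgetP => [s -> []//|noarg].
exfalso; pose a := complex.Re (lam z); pose b := complex.Im (lam z).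
have lamE : lam z = Complex a b by rewrite /a /b; case: (lam z).
have ab1 : a ^+ 2 + b ^+ 2 = 1.
  have := lam_norm z; rewrite normc_def -/a -/b => -[] /eqP.
  rewrite -(@eqrXn2 _ 2) ?sqrtr_ge0 //.
  by rewrite expr1n sqr_sqrtr ?addr_ge0 ?sqr_ge0 // => /eqP.
have aI : -1 <= a <= 1.
  rewrite -ler_norml -(@ler_pXn2r _ 2) ?nnegrE //.
  by rewrite expr1n real_normK ?num_real // -ab1 lerDl sqr_ge0.
have bE : `|b| = Num.sqrt (1 - a ^+ 2).
  by rewrite -ab1 addrAC subrr add0r sqrtr_sqr.
have [b0|b0] := leP 0 b.
  apply: (noarg (acos a)); split.
    by rewrite acos_ge0 //= (le_lt_trans (acos_lepi aI)) // ltr_pMl ?pi_gt0 // ltr1n.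
  apply: val_inj; rewrite [RHS]lamE /= acosK ?in_itv //= sin_acos // -bE ger0_norm //.
apply: (noarg (2 * pi - acos a)); split.
  have := acos_lepi aI; have := pi_gt0 R; rewrite subr_ge0 => pi0 acpi.
  rewrite (le_trans acpi) /=; last by rewrite ler_pMl // ler1n.
  rewrite ltrBlDr ltrDl lt_neqAle acos_ge0 // andbT; apply/eqP => ac0.
  have : a = 1 by rewrite -(@acosK _ a) ?in_itv // -ac0 cos0.
  move=> a1; move: bE; rewrite a1 expr1n subrr sqrtr0 => /eqP.
  by rewrite normr_eq0 (lt_eqF b0).
apply: val_inj; rewrite [RHS]lamE /= cosB sinB [2 * pi]mulrC mulr_natr cos2pi sin2pi.
rewrite !mul0r !mul1r addr0 sub0r acosK ?in_itv //= sin_acos // -bE.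
by rewrite ltr0_norm // opprK.
Qed.

Definition cderive (f : R -> C) t (d : C) :=
  is_derive t 1 (fun s => complex.Re (f s)) (complex.Re d) /\
  is_derive t 1 (fun s => complex.Im (f s)) (complex.Im d).

Lemma ReD (x y : C) : complex.Re (x + y) = complex.Re x + complex.Re y.
Proof. by case: x; case: y. Qed.
Lemma ImD (x y : C) : complex.Im (x + y) = complex.Im x + complex.Im y.
Proof. by case: x; case: y. Qed.
Lemma ReM (x y : C) :
  complex.Re (x * y) = complex.Re x * complex.Re y - complex.Im x * complex.Im y.
Proof. by case: x; case: y. Qed.
Lemma ImM (x y : C) :
  complex.Im (x * y) = complex.Re x * complex.Im y + complex.Im x * complex.Re y.
Proof. by case: x; case: y. Qed.

Lemma complex_eq (x y : C) :
  complex.Re x = complex.Re y -> complex.Im x = complex.Im y -> x = y.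
Proof. by case: x; case: y => a b c d /= -> ->. Qed.

Lemma cderive_cst (c : C) t : cderive (fun=> c) t 0.
Proof. by split; exact: is_derive_cst. Qed.

Lemma cderiveD (f g : R -> C) t a b :
  cderive f t a -> cderive g t b -> cderive (fun s => f s + g s) t (a + b).
Proof.
move=> [f1 f2] [g1 g2]; split.
  by apply: is_derive_eqf (is_derive_fadd f1 g1) _ _ => [s|]; rewrite ReD.
by apply: is_derive_eqf (is_derive_fadd f2 g2) _ _ => [s|]; rewrite ImD.
Qed.

Lemma cderiveM (f g : R -> C) t a b :
  cderive f t a -> cderive g t b ->
  cderive (fun s => f s * g s) t (a * g t + f t * b).
Proof.
move=> [f1 f2] [g1 g2]; split.
  have := is_derive_fadd (is_derive_fmul f1 g1)
                         (is_derive_fscale (-1) (is_derive_fmul f2 g2)).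
  by move=> h; apply: is_derive_eqf h _ _ => [s|]; rewrite ?ReD !ReM; ring.
have := is_derive_fadd (is_derive_fmul f1 g2) (is_derive_fmul f2 g1).
by move=> h; apply: is_derive_eqf h _ _ => [s|]; rewrite ?ImD !ImM; ring.
Qed.

Lemma cderiveZ (k : C) (f : R -> C) t a :
  cderive f t a -> cderive (fun s => k * f s) t (k * a).
Proof.
by move=> h; have := cderiveM (cderive_cst k t) h; rewrite mul0r add0r.
Qed.

Lemma cderive_sum n (f : 'I_n -> R -> C) t (a : 'I_n -> C) :
  (forall i, cderive (f i) t (a i)) ->
  cderive (fun s => \sum_i f i s) t (\sum_i a i).
Proof.
elim: n f a => [|n IH] f a H.
  have -> : (fun s => \sum_(i < 0) f i s) = fun=> 0.
    by apply/funext => s; rewrite big_ord0.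
  by rewrite big_ord0; exact: cderive_cst.
have -> : (fun s => \sum_i f i s) =
          (fun s => f ord0 s + \sum_i f (lift ord0 i) s).
  by apply/funext => s; rewrite big_ord_recl.
by rewrite big_ord_recl; apply: cderiveD => //; exact: IH.
Qed.

Lemma cderive_uniq (f : R -> C) t a b : cderive f t a -> cderive f t b -> a = b.
Proof.
move=> [f1 f2] [g1 g2].
by apply: complex_eq; [exact: is_derive_uniq f1 g1 | exact: is_derive_uniq f2 g2].
Qed.

Lemma cderive0_cst (f : R -> C) : (forall t, cderive f t 0) -> forall s t, f s = f t.
Proof.
move=> H s t; apply: complex_eq.
  by apply: (is_derive_0_is_cst (f := fun s => complex.Re (f s))) => u; exact: (H u).1.
by apply: (is_derive_0_is_cst (f := fun s => complex.Im (f s))) => u; exact: (H u).2.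
Qed.

Lemma cderive_lamX (n : int) t :
  cderive (fun s => lam (expi s) ^ n) t (Complex 0 n%:~R * lam (expi t) ^ n).
Proof.
have dl : is_derive t 1 (fun s : R => n%:~R * s) n%:~R.
  by apply: is_derive_eqf (is_derive_fscale n%:~R (is_derive_id t 1)) _ _ => //;
     rewrite mulr1.
split.
  apply: is_derive_eqf (is_derive1_comp (is_derive_cos _) dl) _ _ => [s|].
    by rewrite lam_expi_int.
  by rewrite ReM lam_expi_int /=; ring.
apply: is_derive_eqf (is_derive1_comp (is_derive_sin _) dl) _ _ => [s|].
  by rewrite lam_expi_int.
by rewrite ImM lam_expi_int /=; ring.
Qed.

Definition trigpoly (m : nat) (c : int -> C) (t : R) : C :=
  \sum_(i < (2 * m).+1) lam (expi t) ^ (i%:Z - m%:Z) * c (i%:Z - m%:Z).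

Lemma cderive_trigpoly m c t :
  cderive (trigpoly m c) t (trigpoly m (fun j => Complex 0 j%:~R * c j) t).
Proof.
apply: cderive_sum => i.
have := cderiveM (cderive_lamX (i%:Z - m%:Z) t) (cderive_cst (c (i%:Z - m%:Z)) t).
by congr (cderive _ _ _); ring.
Qed.

Lemma trigpoly_primitive m (c : int -> C) t : c 0 = 0 ->
  cderive (trigpoly m (fun j => c j / Complex 0 j%:~R)) t (trigpoly m c t).
Proof.
move=> c0; have := cderive_trigpoly m (fun j => c j / Complex 0 j%:~R) t.
congr (cderive _ _ _); apply: eq_bigr => i _; congr (_ * _).
set j := i%:Z - m%:Z; have [->|j0] := eqVneq j 0; first by rewrite c0 mul0r ?mulr0.
by rewrite mulrC mulfVK // eq_complex /= eqxx intr_eq0.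
Qed.

Lemma trigpoly_period m c : trigpoly m c (2 * pi) = trigpoly m c 0.
Proof.
rewrite /trigpoly; have -> : lam (expi (2 * pi : R)) = lam (expi 0) => //.
by rewrite /lam /= [2 * pi]mulrC mulr_natr cos2pi sin2pi cos0 sin0.
Qed.

(** Subtracting its mean, a trigonometric polynomial has a periodic primitive. *)
Lemma trigpoly_mean m (c : int -> C) : exists F : R -> C,
  (forall t, cderive F t (trigpoly m c t - c 0)) /\ F (2 * pi) = F 0.
Proof.
pose c' j := if j == 0 then 0 else c j.
exists (trigpoly m (fun j => c' j / Complex 0 j%:~R)); split; last first.
  exact: trigpoly_period.
move=> t; have := @trigpoly_primitive m c' t erefl; congr (cderive _ _ _).
rewrite /trigpoly (bigD1 (inord m)) //= [in RHS](bigD1 (inord m)) //=.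
rewrite inordK ?subrr; last by lia.
rewrite expr0z !mul1r /c' eqxx add0r [RHS]addrAC subrr add0r.
apply: eq_bigr => i im; rewrite subr_eq0 ifN //.
apply: contraNneq im => -[e].
by apply/eqP; apply: val_inj; rewrite /= inordK; [exact: e | lia].
Qed.

Lemma finite_fourier_smooth (g : loop R) : finite_fourier g -> smooth g.
Proof.
move=> [m [zeta ->]] i j n t.
pose c k (a : int) := Complex 0 a%:~R ^+ k * zeta a i j.
have e s : laurent m zeta (expi s) i j = trigpoly m (c 0%N) s.
  by rewrite summxE; apply: eq_bigr => k _; rewrite mxE /c expr0 mul1r.
have dn k s : cderive (trigpoly m (c k)) s (trigpoly m (c k.+1) s).
  have := cderive_trigpoly m (c k) s.
  by congr (cderive _ _ _); apply: eq_bigr => l _; rewrite /c exprS mulrA.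
have re k : derive1n k (fun s => complex.Re (laurent m zeta (expi s) i j)) =
            fun s => complex.Re (trigpoly m (c k) s).
  elim: k => [|k IH]; first by apply/funext => s; rewrite /= e.
  rewrite derive1nS IH; apply/funext => s.
  by rewrite derive1E; exact: (@derive_val _ _ _ _ _ _ _ (dn k s).1).
have im k : derive1n k (fun s => complex.Im (laurent m zeta (expi s) i j)) =
            fun s => complex.Im (trigpoly m (c k) s).
  elim: k => [|k IH]; first by apply/funext => s; rewrite /= e.
  rewrite derive1nS IH; apply/funext => s.
  by rewrite derive1E; exact: (@derive_val _ _ _ _ _ _ _ (dn k s).2).
by rewrite re im; split; [exact: (@ex_derive _ _ _ _ _ _ _ (dn n t).1) |
                          exact: (@ex_derive _ _ _ _ _ _ _ (dn n t).2)].
Qed.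

End CircleCalculus.

(** * Difference quotients and primitives on the real line *)

Section DifferenceQuotients.

(** The derivative as best affine approximation; in this form the quotients by
    the increment disappear, and the real and the complex cases look alike. *)
Lemma derive_eps (K : numFieldType) (f : K^o -> K^o) (z : K) :
  derivable f z 1 -> forall e : K, 0 < e -> exists2 d : K, 0 < d &
    forall h : K, `|h| < d -> `|f (z + h) - f z - 'D_1 f z * h| <= e * `|h|.
Proof.
move=> fz e e0.
have : h^-1 *: ((f \o shift z) (h *: (1 : K^o)) - f z) @[h --> 0^'] --> 'D_1 f z by exact: fz.
move=> /cvgrPdist_le /(_ e e0) [d /= d0 Hd].
exists d => // h hd; have [->|h0] := eqVneq h 0.
  by rewrite addr0 subrr sub0r mulr0 oppr0 !normr0 mulr0.
have E : (h^-1 *: ((f \o shift z) (h *: (1 : K^o)) - f z) : K) * h =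
         f (z + h) - f z.
  by rewrite /= [h *: 1]mulr1 [h + z]addrC [_ *: _ * _]mulrAC mulVf // mul1r.
have hn : 0 < `|h| by rewrite normr_gt0.
have := Hd h; rewrite /ball /= sub0r normrN => /(_ hd h0).
by rewrite -(ler_pM2r hn) -normrM mulrBl E distrC.
Qed.

Lemma eps_is_derive (R : realType) (f : R -> R) (t d : R) :
  (forall e : R, 0 < e -> exists2 r : R, 0 < r &
    forall h, `|h| < r -> `|f (t + h) - f t - d * h| <= e * `|h|) ->
  is_derive t 1 f d.
Proof.
move=> H.
suff cv : h^-1 *: ((f \o shift t) (h *: (1 : R^o)) - f t) @[h --> 0^'] --> d.
  by constructor; [apply/cvg_ex; exists d | exact: cvg_lim].
apply/cvgrPdist_le => e e0; have [r r0 Hr] := H e e0.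
exists r => // h /=; rewrite /ball /= sub0r normrN => hr h0.
have hn : 0 < `|h| by rewrite normr_gt0.
have E : (h^-1 *: ((f \o shift t) (h *: (1 : R^o)) - f t) : R) * h =
         f (t + h) - f t.
  by rewrite /= [h *: 1]mulr1 [h + t]addrC [_ *: _ * _]mulrAC mulVf // mul1r.
by rewrite -(ler_pM2r hn) -normrM mulrBl E distrC Hr.
Qed.

Lemma is_derive_eps (R : realType) (f : R -> R) (t d : R) :
  is_derive t 1 f d -> forall e : R, 0 < e -> exists2 r : R, 0 < r &
    forall h, `|h| < r -> `|f (t + h) - f t - d * h| <= e * `|h|.
Proof.
move=> fd e e0; have := @derive_eps R f t (@ex_derive _ _ _ _ _ _ _ fd) e e0.
by rewrite (@derive_val _ _ _ _ _ _ _ fd).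
Qed.

Lemma le_norm_eq (R : numDomainType) (a b c : R) : `|a| <= c -> a = b -> `|b| <= c.
Proof. by move=> h <-. Qed.

Lemma le_norm_eqN (R : numDomainType) (a b c : R) : `|a| <= c -> - a = b -> `|b| <= c.
Proof. by move=> h <-; rewrite normrN. Qed.

(** The integral from a base point is a primitive only to the right of that
    point; such primitives of f (x) and of f (- x) are glued at 0. *)
Lemma exists_antiderivative (R : realType) (f : R -> R) : continuous f ->
  exists F : R -> R, forall x : R, is_derive x 1 F (f x).
Proof.
move=> fc.
have half (g : R -> R) : continuous g -> exists G : R -> R, forall x : R, 0 <= x ->
    is_derive x 1 G (g x).
  move=> gc; exists (fun x => \int[lebesgue_measure]_(t in `[(-1), x]) g t)%R => x x0.
  have xx : x < x + 1 by rewrite ltrDl.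
  have [|||d1 d2] := @continuous_FTC1_closed R g (-1) x (x + 1) xx.
  - by apply: continuous_compact_integrable; [exact: segment_compact|exact: continuous_subspaceT].
  - by rewrite (lt_le_trans _ x0) // ltrN10.
  - exact: gc.
  - by constructor; [exact: d1 | rewrite -d2 derive1E].
have [G hG] := half f fc.
have [|G' hG'] := half (fun x => f (- x)).
  by move=> x; apply: (@continuous_comp _ _ _ (fun x => - x) f); [exact: opp_continuous|exact: fc].
pose F x := if 0 <= x then G x - G 0 else - (G' (- x) - G' 0).
exists F => x; apply: eps_is_derive => e e0.
have {}hG y : 0 <= y -> _ := fun y0 => is_derive_eps (hG y y0) e0.
have {}hG' y : 0 <= y -> _ := fun y0 => is_derive_eps (hG' y y0) e0.
have [x0|x0|x0] := ltgtP x 0.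
- have [|r r0 Hr] := hG' (- x); first by rewrite oppr_ge0 ltW.
  exists (Num.min r (- x)); first by rewrite lt_min r0 oppr_gt0.
  move=> h; rewrite lt_min => /andP[hr hx].
  have xh : x + h < 0 by move: hx; rewrite ltr_norml => /andP[_]; lra.
  rewrite /F (lt_geF x0) (lt_geF xh).
  have := Hr (- h); rewrite normrN => /(_ hr); rewrite opprK.
  by move=> /le_norm_eqN; apply; rewrite [- (x + h)]opprD; ring.
- have [|r r0 Hr] := hG x; first exact: ltW.
  exists (Num.min r x); first by rewrite lt_min r0.
  move=> h; rewrite lt_min => /andP[hr hx].
  have xh : 0 <= x + h by move: hx; rewrite ltr_norml => /andP[]; lra.
  rewrite /F xh (ltW x0); have := Hr h hr.
  by move=> /le_norm_eq; apply; ring.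
- subst x; have [|r r0 Hr] := hG 0 => //; have [|r' r'0 Hr'] := hG' 0 => //.
  exists (Num.min r r'); first by rewrite lt_min r0.
  move=> h; rewrite lt_min => /andP[hr hr'].
  rewrite /F lexx add0r; have [h0|h0] := leP 0 h.
    by have := Hr h hr; rewrite add0r => /le_norm_eq; apply; ring.
  have := Hr' (- h); rewrite normrN => /(_ hr'); rewrite add0r oppr0.
  by move=> /le_norm_eqN; apply; ring.
Qed.

Lemma derive_bound (R : realType) (f d : R -> R) (M a b : R) :
  (forall x : R, is_derive x 1 f (d x)) ->
  (forall x, `|x - a| <= `|b - a| -> `|d x| <= M) ->
  `|f b - f a| <= M * `|b - a|.
Proof.
move=> fd dM.
have cf x : {for x, continuous f}.
  by apply: differentiable_continuous; apply/derivable1_diffP; exact: (@ex_derive _ _ _ _ _ _ _ (fd x)).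
have main (x y : R) : x < y -> (forall z, x <= z <= y -> `|d z| <= M) ->
    `|f y - f x| <= M * `|y - x|.
  move=> xy H.
  have [c cI ->] := MVT xy (fun z _ => fd z) (continuous_subspaceT (fun x => cf x)).
  rewrite normrM ler_wpM2r // H //.
  by move: cI; rewrite in_itv /= => /andP[/ltW -> /ltW ->].
have [ab|ba|->] := ltgtP a b.
- apply: main => // z /andP[az zb]; apply: dM.
  by rewrite !ger0_norm ?subr_ge0 ?lerB // (le_trans az).
- rewrite distrC [`|b - a|]distrC; apply: main => // z /andP[bz za]; apply: dM.
  by rewrite distrC [`|b - a|]distrC !ger0_norm ?subr_ge0 ?lerB // (le_trans bz).
- by rewrite !subrr normr0 mulr0.
Qed.

End DifferenceQuotients.

(** * Complex differentiability *)

Section ComplexDifferentiability.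
Variable R : realType.
Local Notation C := R[i].
Local Notation nrm := (@ComplexField.Normc.normc R).

Lemma nrm_normE (x : C) : `|x| = real_complex R (nrm x).
Proof. by case: x. Qed.

Lemma nrmD (x y : C) : nrm (x + y) <= nrm x + nrm y.
Proof. exact: (@le_normcD R). Qed.

Lemma nrmM (x y : C) : nrm (x * y) = nrm x * nrm y.
Proof. exact: (@ComplexField.Normc.normcM R). Qed.

Lemma nrmN (x : C) : nrm (- x) = nrm x.
Proof. exact: (@normcN R). Qed.

Lemma nrm_ge0 (x : C) : 0 <= nrm x.
Proof. by case: x => a b; exact: sqrtr_ge0. Qed.

Lemma nrm0 : nrm 0 = 0.
Proof. by rewrite /= expr0n /= addr0 sqrtr0. Qed.

Lemma nrm_Re (x : C) : `|complex.Re x| <= nrm x.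
Proof. by rewrite -lecR -nrm_normE normc_ge_Re. Qed.

Lemma nrm_Im (x : C) : `|complex.Im x| <= nrm x.
Proof.
case: x => a b /=; rewrite -sqrtr_sqr ler_wsqrtr // lerDr; exact: sqr_ge0.
Qed.

Lemma nrm_real (a : R) : nrm (real_complex R a) = `|a|.
Proof. by rewrite /= expr0n /= addr0 sqrtr_sqr. Qed.

Lemma nrm_imag (a : R) : nrm (Complex 0 a) = `|a|.
Proof. by rewrite /= expr0n /= add0r sqrtr_sqr. Qed.

Lemma nrm_le_ReIm (x : C) : nrm x <= `|complex.Re x| + `|complex.Im x|.
Proof.
case: x => a b; have -> : Complex a b = real_complex R a + Complex 0 b.
  by apply: complex_eq; rewrite /= ?addr0 ?add0r.
by apply: le_trans (nrmD _ _) _; rewrite nrm_real nrm_imag /= addr0 add0r.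
Qed.

Definition cdiff (f : C -> C) (z d : C) : Prop :=
  forall e : R, 0 < e -> exists2 r : R, 0 < r &
    forall h, nrm h < r -> nrm (f (z + h) - f z - d * h) <= e * nrm h.

Lemma derivable_cdiff (f : C -> C) (z : C) :
  derivable (f : C^o -> C^o) z 1 -> exists d, cdiff f z d.
Proof.
move=> fz; exists ('D_1 (f : C^o -> C^o) z) => e e0.
have eC : 0 < real_complex R e by rewrite ltcR.
have [r r0 Hr] := derive_eps fz eC.
have rE : r = real_complex R (complex.Re r).
  by rewrite RRe_real // gtr0_real.
exists (complex.Re r); first by rewrite -ltcR -rE.
move=> h hr; have := Hr h; rewrite !nrm_normE rE ltcR => /(_ hr).
by rewrite -rmorphM lecR.
Qed.

Lemma cderive_epsP (c : R -> C) t d : cderive c t d <->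
  forall e : R, 0 < e -> exists2 r : R, 0 < r &
    forall h, `|h| < r ->
      nrm (c (t + h) - c t - d * real_complex R h) <= e * `|h|.
Proof.
have ReE (x y : C) (h : R) (w : C) : complex.Re (x - y - w * real_complex R h) =
    complex.Re x - complex.Re y - complex.Re w * h.
  by case: x y w => x1 x2 [y1 y2] [w1 w2] /=; ring.
have ImE (x y : C) (h : R) (w : C) : complex.Im (x - y - w * real_complex R h) =
    complex.Im x - complex.Im y - complex.Im w * h.
  by case: x y w => x1 x2 [y1 y2] [w1 w2] /=; ring.
split=> [[d1 d2] e e0|H].
  have e2 : 0 < e / 2 by rewrite divr_gt0.
  have [r1 r10 H1] := is_derive_eps d1 e2.
  have [r2 r20 H2] := is_derive_eps d2 e2.
  exists (Num.min r1 r2); first by rewrite lt_min r10.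
  move=> h; rewrite lt_min => /andP[h1 h2].
  apply: le_trans (nrm_le_ReIm _) _; rewrite ReE ImE.
  by apply: le_trans (lerD (H1 h h1) (H2 h h2)) _; rewrite -mulrDl -splitr.
split; apply: eps_is_derive => e e0; have [r r0 Hr] := H e e0; exists r => // h hr.
  by apply: le_trans (Hr h hr); rewrite -ReE nrm_Re.
by apply: le_trans (Hr h hr); rewrite -ImE nrm_Im.
Qed.

Lemma cdiff_cderive (f : C -> C) (c : R -> C) t d c' :
  cdiff f (c t) d -> cderive c t c' -> cderive (fun s => f (c s)) t (d * c').
Proof.
move=> fd /cderive_epsP cd; apply/cderive_epsP => e e0.
pose A := nrm c' + 1; pose B := nrm d + 1.
have A0 : 0 < A by rewrite ltr_wpDl ?nrm_ge0.
have B0 : 0 < B by rewrite ltr_wpDl ?nrm_ge0.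
have eA : 0 < e / 2 / A by rewrite !divr_gt0.
have eB : 0 < Num.min 1 (e / 2 / B) by rewrite lt_min ltr01 !divr_gt0.
have [r1 r10 H1] := fd _ eA; have [r2 r20 H2] := cd _ eB.
exists (Num.min r2 (r1 / A)); first by rewrite lt_min r20 divr_gt0.
move=> h; rewrite lt_min => /andP[hr2 hr1].
have {H2} := H2 h hr2; set rho := (c _ - _ - _) => Hrho.
have cE : c (t + h) = c t + (c' * real_complex R h + rho) by rewrite /rho; ring.
set k := c' * real_complex R h + rho.
have rho1 : nrm rho <= `|h|.
  by apply: le_trans Hrho _; rewrite -{2}[`|h|]mul1r ler_wpM2r // ge_min lexx.
have rho2 : nrm rho <= e / 2 / B * `|h|.
  by apply: le_trans Hrho _; rewrite ler_wpM2r // ge_min lexx orbT.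
have kA : nrm k <= A * `|h|.
  apply: le_trans (nrmD _ _) _; rewrite nrmM nrm_real /A mulrDl mul1r.
  by rewrite lerD2l.
have kr : nrm k < r1.
  by apply: le_lt_trans kA _; rewrite mulrC -ltr_pdivlMr.
have E : f (c (t + h)) - f (c t) - d * c' * real_complex R h =
    (f (c t + k) - f (c t) - d * k) + d * rho.
  by rewrite cE -/k {3}/k; ring.
rewrite E; apply: le_trans (nrmD _ _) _.
rewrite [e]splitr mulrDl; apply: lerD.
  apply: le_trans (H1 k kr) _.
  have -> : e / 2 * `|h| = e / 2 / A * (A * `|h|).
    by rewrite mulrA divfK // gt_eqF.
  by rewrite ler_wpM2l // ltW.
rewrite nrmM; apply: (@le_trans _ _ (B * (e / 2 / B * `|h|))).
  by apply: ler_pM => //; rewrite ?nrm_ge0 // /B lerDl.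
by rewrite mulrA [B * _]mulrC divfK // gt_eqF.
Qed.

Lemma cdiff_horizontal (f : C -> C) x y d : cdiff f (Complex x y) d ->
  cderive (fun s => f (Complex s y)) x d.
Proof.
move=> fd; rewrite -[d]mulr1; apply: (@cdiff_cderive f (fun s => Complex s y) x d 1 fd).
by split; [apply: is_derive_eqf (is_derive_id x 1) _ _ |
  apply: is_derive_eqf (is_derive_cst y x 1) _ _].
Qed.

Lemma cdiff_vertical (f : C -> C) x y d : cdiff f (Complex x y) d ->
  cderive (fun s => f (Complex x s)) y (d * Complex 0 1).
Proof.
move=> fd; apply: (@cdiff_cderive f (fun s => Complex x s) y d _ fd).
by split; [apply: is_derive_eqf (is_derive_cst x y 1) _ _ |
  apply: is_derive_eqf (is_derive_id y 1) _ _].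
Qed.

Lemma exists_cprimitive (f d : R -> C) : (forall t, cderive f t (d t)) ->
  exists F, forall t, cderive F t (f t).
Proof.
move=> fd.
have cont (g g' : R -> R) : (forall t : R, is_derive t 1 g (g' t)) -> continuous g.
  move=> gd x; apply: differentiable_continuous; apply/derivable1_diffP.
  exact: (@ex_derive _ _ _ _ _ _ _ (gd x)).
have [F1 H1] := exists_antiderivative (cont _ _ (fun t => (fd t).1)).
have [F2 H2] := exists_antiderivative (cont _ _ (fun t => (fd t).2)).
exists (fun t => Complex (F1 t) (F2 t)) => t.
by split; [apply: is_derive_eqf (H1 t) _ _ | apply: is_derive_eqf (H2 t) _ _].
Qed.

Lemma cderive_bound (f d : R -> C) (M a b : R) :
  (forall t, cderive f t (d t)) ->
  (forall t, `|t - a| <= `|b - a| -> nrm (d t) <= M) ->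
  nrm (f b - f a) <= 2 * M * `|b - a|.
Proof.
move=> fd dM; apply: le_trans (nrm_le_ReIm _) _.
rewrite -mulrA mulr_natl mulr2n; apply: lerD.
  have -> : complex.Re (f b - f a) = complex.Re (f b) - complex.Re (f a).
    by case: (f b) (f a) => ? ? [].
  apply: derive_bound (fun t => (fd t).1) _ => t ht.
  exact: le_trans (nrm_Re _) (dM t ht).
have -> : complex.Im (f b - f a) = complex.Im (f b) - complex.Im (f a).
  by case: (f b) (f a) => ? ? [].
apply: derive_bound (fun t => (fd t).2) _ => t ht.
exact: le_trans (nrm_Im _) (dM t ht).
Qed.

End ComplexDifferentiability.

(** * Goursat's lemma *)

Section Goursat.
Variable R : realType.
Local Notation C := R[i].
Local Notation nrm := (@ComplexField.Normc.normc R).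

Lemma bisection_limit (a : nat -> R) (M : R) :
  (forall n, `|a n.+1 - a n| <= M / 2 ^+ n.+1) ->
  exists x, forall n, `|a n - x| <= M / 2 ^+ n.
Proof.
move=> H.
have half n : M / 2 ^+ n = M / 2 ^+ n.+1 + M / 2 ^+ n.+1.
  by rewrite exprS invfM [_^-1 * _]mulrC mulrA -splitr.
have M0 n : 0 <= M / 2 ^+ n by rewrite half; apply: addr_ge0; apply: le_trans (H n).
pose lo n := a n - M / 2 ^+ n; pose hi n := a n + M / 2 ^+ n.
have lo_inc n m : (n <= m)%N -> lo n <= lo m.
  elim: m => [|m IH]; first by rewrite leqn0 => /eqP ->.
  rewrite leq_eqVlt => /predU1P[-> //|/IH /le_trans]; apply.
  by have := H m; rewrite ler_norml /lo (half m) => /andP[]; lra.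
have hi_dec n m : (n <= m)%N -> hi m <= hi n.
  elim: m => [|m IH]; first by rewrite leqn0 => /eqP ->.
  rewrite leq_eqVlt => /predU1P[-> //|/IH]; apply: le_trans.
  by have := H m; rewrite ler_norml /hi (half m) => /andP[]; lra.
have lohi n m : lo n <= hi m.
  apply: (@le_trans _ _ (lo (maxn n m))); first by rewrite lo_inc // leq_maxl.
  apply: (@le_trans _ _ (hi (maxn n m))); last by rewrite hi_dec // leq_maxr.
  by rewrite /lo /hi; have := M0 (maxn n m); lra.
exists (sup (range lo)) => n.
have hs : has_sup (range lo).
  split; first by exists (lo 0%N), 0%N.
  by exists (hi 0%N) => _ [m _ <-]; exact: lohi.
have h1 : lo n <= sup (range lo) by apply: ub_le_sup; [exact: hs.2 | exists n].
have h2 : sup (range lo) <= hi n.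
  by apply: ge_sup; [exact: hs.1 | move=> _ [m _ <-]; exact: lohi].
by rewrite ler_norml; move: h1 h2; rewrite /lo /hi; lra.
Qed.

Variable f : C -> C.
Hypothesis f_diff : forall z, exists d, cdiff f z d.
Variables U V : R -> R -> C.
Hypothesis HU : forall y t, cderive (U y) t (f (Complex t y)).
Hypothesis HV : forall x t, cderive (V x) t (f (Complex x t)).

(** The integral of f along the boundary of the rectangle with opposite corners
    (x, y) and (x + p, y + q), through primitives of f on the sides; p and q may
    be negative. *)
Definition rect_int (x y p q : R) : C :=
  (U y (x + p) - U y x) - (U (y + q) (x + p) - U (y + q) x)
  + imi R * (V (x + p) (y + q) - V (x + p) y)
  - imi R * (V x (y + q) - V x y).

Lemma rect_int_split x y p q : rect_int x y (p + p) (q + q) =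
  rect_int x y p q + rect_int (x + p) y p q +
  (rect_int x (y + q) p q + rect_int (x + p) (y + q) p q).
Proof. by rewrite /rect_int !addrA; ring. Qed.

(** Up to a small error f is affine near a point, and an affine function has a
    primitive, so that its integral along a closed path vanishes. *)
Lemma rect_int_local (w : C) (e : R) : 0 < e -> exists2 r : R, 0 < r &
  forall x y p q, `|x - complex.Re w| <= `|p| -> `|y - complex.Im w| <= `|q| ->
    `|p| + `|q| < r -> nrm (rect_int x y p q) <= 8 * e * (`|p| + `|q|) ^+ 2.
Proof.
move=> e0; have [d fd] := f_diff w; have [r r0 Hr] := fd e e0.
exists (r / 2); first by rewrite divr_gt0.
move=> x y p q hx hy; set D := `|p| + `|q| => hD.
pose l z := f w + d * (z - w).
pose P z := (f w - d * w) * z + d / 2 * (z * z).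
have dP (c : R -> C) t c' : cderive c t c' ->
    cderive (fun s => P (c s)) t (c' * l (c t)).
  move=> cc; have := cderiveD (cderiveZ (f w - d * w) cc)
                              (cderiveZ (d / 2) (cderiveM cc cc)).
  by congr (cderive _ _ _); rewrite /l; field.
have dh (y' t : R) : cderive (fun s => Complex s y') t 1.
  by split; [apply: is_derive_eqf (is_derive_id t 1) _ _ |
    apply: is_derive_eqf (is_derive_cst y' t 1) _ _].
have dv (x' t : R) : cderive (fun s => Complex x' s) t (imi R).
  by split; [apply: is_derive_eqf (is_derive_cst x' t 1) _ _ |
    apply: is_derive_eqf (is_derive_id t 1) _ _].
pose G y' s := U y' s + -1 * P (Complex s y').
pose K x' s := imi R * V x' s + -1 * P (Complex x' s).
have dG y' t : cderive (G y') t (f (Complex t y') - l (Complex t y')).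
  have := cderiveD (HU y' t) (cderiveZ (-1) (dP _ _ _ (dh y' t))).
  by rewrite mul1r mulN1r.
have dK x' t : cderive (K x') t (imi R * (f (Complex x' t) - l (Complex x' t))).
  have := cderiveD (cderiveZ (imi R) (HV x' t)) (cderiveZ (-1) (dP _ _ _ (dv x' t))).
  by congr (cderive _ _ _); ring.
have small (x' y' : R) : `|x' - complex.Re w| <= 2 * `|p| ->
    `|y' - complex.Im w| <= 2 * `|q| ->
    nrm (f (Complex x' y') - l (Complex x' y')) <= e * (2 * D).
  move=> h1 h2; pose h := Complex x' y' - w.
  have hE : Complex x' y' = w + h by rewrite /h addrC subrK.
  have nh : nrm h <= 2 * D.
    apply: le_trans (nrm_le_ReIm _) _; rewrite /D mulrDr.
    by apply: lerD; move: h1 h2; rewrite /h; case: (w) => w1 w2.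
  have -> : f (Complex x' y') - l (Complex x' y') = f (w + h) - f w - d * h.
    by rewrite /l -/h hE; ring.
  apply: le_trans (Hr h _) _; last by rewrite ler_wpM2l // ltW.
  by apply: le_lt_trans nh _; rewrite mulrC -ltr_pdivlMr.
have bnd (a b t : R) (c : R) : `|a - c| <= `|b| -> `|t - a| <= `|b| ->
    `|t - c| <= 2 * `|b|.
  move=> h1 h2; have -> : t - c = (t - a) + (a - c) by ring.
  by apply: le_trans (ler_normD _ _) _; rewrite mulr_natl mulr2n lerD.
have bnd0 (a b : R) (c : R) : `|a - c| <= `|b| -> `|a - c| <= 2 * `|b|.
  by move=> h; apply: (bnd a) => //; rewrite subrr normr0.
have bnd1 (a b : R) (c : R) : `|a - c| <= `|b| -> `|a + b - c| <= 2 * `|b|.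
  by move=> h; apply: (bnd a) => //; rewrite addrC addKr.
have addK (a b : R) : a + b - a = b by rewrite addrC addKr.
have hG y' : `|y' - complex.Im w| <= 2 * `|q| ->
    nrm (G y' (x + p) - G y' x) <= 2 * (e * (2 * D)) * `|p|.
  move=> hy'; rewrite -{2}(addK x p); apply: cderive_bound (dG y') _ => t.
  by rewrite addK => ht; apply: small => //; exact: (bnd x).
have nrmi : nrm (imi R) = 1 by rewrite /= expr0n /= add0r expr1n sqrtr1.
have hK x' : `|x' - complex.Re w| <= 2 * `|p| ->
    nrm (K x' (y + q) - K x' y) <= 2 * (e * (2 * D)) * `|q|.
  move=> hx'; rewrite -{2}(addK y q); apply: cderive_bound (dK x') _ => t.
  rewrite addK => ht; rewrite nrmM nrmi mul1r.
  by apply: small => //; exact: (bnd y).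
have -> : rect_int x y p q = (G y (x + p) - G y x) - (G (y + q) (x + p) - G (y + q) x)
    + (K (x + p) (y + q) - K (x + p) y) - (K x (y + q) - K x y).
  by rewrite /rect_int /G /K; ring.
apply: le_trans (nrmD _ _) _; rewrite nrmN.
apply: le_trans (lerD (nrmD _ _) (hK x (bnd0 _ _ _ hx))) _.
apply: le_trans (lerD (lerD (nrmD _ _) (hK _ (bnd1 _ _ _ hx))) (lexx _)) _.
rewrite nrmN.
apply: le_trans (lerD (lerD (lerD (hG y (bnd0 _ _ _ hy)) (hG _ (bnd1 _ _ _ hy)))
  (lexx _)) (lexx _)) _.
by rewrite le_eqVlt; apply/orP; left; apply/eqP; rewrite /D; ring.
Qed.

(** The integral over a rectangle is the sum of those over its four quarters,
    so that one of these is at least a fourth of it in modulus. *)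
Lemma rect_int_quarter x y p q : exists x' y',
  [/\ x' = x \/ x' = x + p, y' = y \/ y' = y + q &
      nrm (rect_int x y (p + p) (q + q)) <= 4 * nrm (rect_int x' y' p q)].
Proof.
apply: contrapT => H.
have {}H x' y' : x' = x \/ x' = x + p -> y' = y \/ y' = y + q ->
    4 * nrm (rect_int x' y' p q) < nrm (rect_int x y (p + p) (q + q)).
  by move=> h1 h2; rewrite ltNge; apply/negP => h; apply: H; exists x', y'.
have h1 := H x y (or_introl erefl) (or_introl erefl).
have h2 := H (x + p) y (or_intror erefl) (or_introl erefl).
have h3 := H x (y + q) (or_introl erefl) (or_intror erefl).
have h4 := H (x + p) (y + q) (or_intror erefl) (or_intror erefl).
have := nrmD (rect_int x y p q + rect_int (x + p) y p q)
             (rect_int x (y + q) p q + rect_int (x + p) (y + q) p q).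
rewrite -rect_int_split.
have := nrmD (rect_int x y p q) (rect_int (x + p) y p q).
have := nrmD (rect_int x (y + q) p q) (rect_int (x + p) (y + q) p q).
by move: h1 h2 h3 h4; lra.
Qed.

(** Goursat: successive quartering leads to a point near which the integral
    over a rectangle of half-perimeter D / 2^n is at least c / 4^n, whereas the
    local estimate makes it at most any given multiple of (D / 2^n)^2. *)
Lemma rect_int0 x y p q : rect_int x y p q = 0.
Proof.
pose pn (p : R) n := p / 2 ^+ n.
have half p' n : pn p' n = pn p' n.+1 + pn p' n.+1.
  by rewrite /pn exprS invfM [_^-1 * _]mulrC mulrA -splitr.
have pn_norm p' n : `|pn p' n| = `|p'| / 2 ^+ n.
  by rewrite /pn normrM normfV normrX normr_nat.
have step (a : nat * (R * R)) : exists b : R * R,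
    [/\ `|b.1 - a.2.1| <= `|p| / 2 ^+ a.1.+1, `|b.2 - a.2.2| <= `|q| / 2 ^+ a.1.+1 &
        nrm (rect_int a.2.1 a.2.2 (pn p a.1) (pn q a.1)) <=
        4 * nrm (rect_int b.1 b.2 (pn p a.1.+1) (pn q a.1.+1))].
  case: a => n [x1 y1] /=.
  have [x' [y' [hx hy H]]] := rect_int_quarter x1 y1 (pn p n.+1) (pn q n.+1).
  exists (x', y'); rewrite -!half in H; split=> //=; rewrite -pn_norm.
    by case: hx => ->; rewrite ?subrr ?normr0 // addrC addKr.
  by case: hy => ->; rewrite ?subrr ?normr0 // addrC addKr.
have [g Hg] := choice step.
pose s := fix s n := if n is n'.+1 then g (n', s n') else (x, y).
have Hs n := Hg (n, s n).
have [x0 Hx] : exists x0, forall n, `|(s n).1 - x0| <= `|p| / 2 ^+ n.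
  by apply: bisection_limit => n; have [] := Hs n.
have [y0 Hy] : exists y0, forall n, `|(s n).2 - y0| <= `|q| / 2 ^+ n.
  by apply: bisection_limit => n; have [] := Hs n.
pose c := nrm (rect_int x y p q).
have cn n : c <= 4 ^+ n * nrm (rect_int (s n).1 (s n).2 (pn p n) (pn q n)).
  elim: n => [|n IH]; first by rewrite /pn expr0 !divr1 mul1r.
  apply: le_trans IH _; rewrite exprSr -mulrA ler_wpM2l ?exprn_ge0 //.
  by have [] := Hs n.
pose D := `|p| + `|q|.
have D0 : 0 <= D by rewrite addr_ge0.
have ce e : 0 < e -> c <= 8 * e * D ^+ 2.
  move=> e0; have [r r0 Hr] := rect_int_local (Complex x0 y0) e0.
  have [n Hn] : exists n, D / 2 ^+ n < r.
    exists (Num.bound (D / r)).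
    rewrite ltr_pdivrMr ?exprn_gt0 // mulrC -ltr_pdivrMr //.
    apply: lt_le_trans (archi_boundP _) _; first by rewrite divr_ge0 // ltW.
    by rewrite -natrX ler_nat ltnW // ltn_expl.
  have := Hr (s n).1 (s n).2 (pn p n) (pn q n).
  rewrite !pn_norm => /(_ (Hx n) (Hy n)); rewrite -mulrDl -/D => /(_ Hn) H.
  apply: le_trans (cn n) _.
  apply: le_trans (ler_wpM2l _ H) _; first by rewrite exprn_ge0.
  have -> : (D / 2 ^+ n) ^+ 2 = D ^+ 2 / 4 ^+ n.
    have -> : (4 : R) = 2 ^+ 2 by rewrite -natrX.
    by rewrite exprMn exprVn -!exprM mulnC.
  by rewrite le_eqVlt; apply/orP; left; apply/eqP; field; rewrite expf_neq0.
apply: (@ComplexField.Normc.eq0_normc R); rewrite -/c.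
apply/eqP; rewrite eq_le (nrm_ge0 _) andbT leNgt; apply/negP => c0.
have D1 : 0 < D ^+ 2 + 1 by rewrite ltr_wpDl // sqr_ge0.
have := ce (c / (16 * (D ^+ 2 + 1))).
rewrite divr_gt0 ?mulr_gt0 // => /(_ isT).
have -> : 8 * (c / (16 * (D ^+ 2 + 1))) * D ^+ 2 =
          c / 2 * (D ^+ 2 / (D ^+ 2 + 1)).
  by field; rewrite gt_eqF.
move=> H; have : c / 2 * (D ^+ 2 / (D ^+ 2 + 1)) <= c / 2 * 1.
  rewrite ler_wpM2l ?divr_ge0 ?(ltW c0) // ler_pdivrMr // mul1r lerDl //.
by move: H; lra.
Qed.

End Goursat.

(** * Cauchy's theorem for the unit circle *)

Section MeanOfHolomorphic.
Variable R : realType.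
Local Notation C := R[i].
Local Notation nrm := (@ComplexField.Normc.normc R).

Lemma cdiff_continuous (f : C -> C) z d : cdiff f z d ->
  forall e : R, 0 < e -> exists2 r : R, 0 < r &
    forall h, nrm h < r -> nrm (f (z + h) - f z) <= e.
Proof.
move=> fd e e0; have [r r0 Hr] := fd 1 ltr01.
pose A := nrm d + 1; have A0 : 0 < A by rewrite ltr_wpDl ?nrm_ge0.
exists (Num.min r (e / A)); first by rewrite lt_min r0 divr_gt0.
move=> h; rewrite lt_min => /andP[/Hr hr /ltW he].
have -> : f (z + h) - f z = (f (z + h) - f z - d * h) + d * h by rewrite subrK.
apply: le_trans (nrmD _ _) _; rewrite nrmM.
apply: (@le_trans _ _ (A * nrm h)); last by rewrite mulrC -ler_pdivlMr.
by rewrite /A mulrDl addrC lerD2l.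
Qed.

Lemma cdiff_cst (k z : C) : cdiff (fun=> k) z 0.
Proof. by move=> e e0; exists 1 => // h _; rewrite mul0r !subrr nrm0 mulr_ge0 ?nrm_ge0 // ltW. Qed.

Lemma cdiff_id (z : C) : cdiff id z 1.
Proof.
move=> e e0; exists 1 => // h _.
have -> : id (z + h) - id z - 1 * h = 0 by rewrite /=; ring.
by rewrite nrm0 mulr_ge0 ?nrm_ge0 // ltW.
Qed.

Lemma cdiffD (f g : C -> C) z a b :
  cdiff f z a -> cdiff g z b -> cdiff (fun w => f w + g w) z (a + b).
Proof.
move=> fa gb e e0; have e2 : 0 < e / 2 by rewrite divr_gt0.
have [r r0 Hr] := fa _ e2; have [s s0 Hs] := gb _ e2.
exists (Num.min r s); first by rewrite lt_min r0.
move=> h; rewrite lt_min => /andP[/Hr h1 /Hs h2].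
have -> : f (z + h) + g (z + h) - (f z + g z) - (a + b) * h =
  (f (z + h) - f z - a * h) + (g (z + h) - g z - b * h) by ring.
by apply: le_trans (nrmD _ _) _; rewrite [e]splitr mulrDl lerD.
Qed.

Lemma cdiffM (f g : C -> C) z a b :
  cdiff f z a -> cdiff g z b -> cdiff (fun w => f w * g w) z (a * g z + f z * b).
Proof.
move=> fa gb e e0.
pose A := nrm a + 1; pose B := nrm (g z) + 1; pose F := nrm (f z) + 1.
have pos (x : C) : 0 < nrm x + 1 by rewrite ltr_wpDl ?nrm_ge0.
have A0 : 0 < A := pos a; have B0 : 0 < B := pos (g z).
have F0 : 0 < F := pos (f z).
have e3 : 0 < e / 3 by rewrite divr_gt0.
have e1 : 0 < e / 3 / B by rewrite divr_gt0.
have e2 : 0 < Num.min 1 (e / 3 / A) by rewrite lt_min ltr01 divr_gt0.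
have e4 : 0 < e / 3 / F by rewrite divr_gt0.
have [r1 r10 H1] := fa _ e1; have [r2 r20 H2] := cdiff_continuous gb e2.
have [r3 r30 H3] := gb _ e4.
exists (Num.min r1 (Num.min r2 r3)); first by rewrite !lt_min r10 r20.
move=> h; rewrite !lt_min => /and3P[/H1 h1 /H2 h2 /H3 h3].
have -> : f (z + h) * g (z + h) - f z * g z - (a * g z + f z * b) * h =
  (f (z + h) - f z - a * h) * g (z + h) + a * h * (g (z + h) - g z)
  + f z * (g (z + h) - g z - b * h) by ring.
have h21 : nrm (g (z + h) - g z) <= 1 by apply: le_trans h2 _; rewrite ge_min lexx.
have h22 : nrm (g (z + h) - g z) <= e / 3 / A.
  by apply: le_trans h2 _; rewrite ge_min lexx orbT.
have gB : nrm (g (z + h)) <= B.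
  by rewrite -[g (z + h)](subrK (g z)) (le_trans (nrmD _ _)) // /B addrC lerD2l.
apply: le_trans (nrmD _ _) _; rewrite nrmM.
apply: le_trans (lerD (nrmD _ _) (lexx _)) _; rewrite !nrmM.
have t1 : nrm (f (z + h) - f z - a * h) * nrm (g (z + h)) <= e / 3 * nrm h.
  have -> : e / 3 * nrm h = e / 3 / B * nrm h * B by field; rewrite gt_eqF.
  by apply: ler_pM; rewrite ?nrm_ge0.
have t2 : nrm a * nrm h * nrm (g (z + h) - g z) <= e / 3 * nrm h.
  have -> : e / 3 * nrm h = A * nrm h * (e / 3 / A) by field; rewrite gt_eqF.
  by apply: ler_pM; rewrite ?mulr_ge0 ?nrm_ge0 // ler_wpM2r ?nrm_ge0 // /A lerDl.
have t3 : nrm (f z) * nrm (g (z + h) - g z - b * h) <= e / 3 * nrm h.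
  have -> : e / 3 * nrm h = F * (e / 3 / F * nrm h) by field; rewrite gt_eqF.
  by apply: ler_pM; rewrite ?nrm_ge0 // /F lerDl.
apply: le_trans (lerD (lerD t1 t2) t3) _.
by rewrite le_eqVlt; apply/orP; left; apply/eqP; field.
Qed.

Lemma cdiff_inv (z : C) : z != 0 -> cdiff (fun w => w^-1) z (- z^-1 ^+ 2).
Proof.
move=> z0 e e0; have n0 : 0 < nrm z.
  by rewrite -ltcR -nrm_normE normr_gt0.
exists (Num.min (nrm z / 2) (e * nrm z ^+ 3 / 2)).
  by rewrite lt_min !divr_gt0 // mulr_gt0 // exprn_gt0.
move=> h; rewrite lt_min => /andP[h1 /ltW h2].
have zh : nrm z / 2 <= nrm (z + h).
  by have := nrmD (z + h) (- h); rewrite addrK nrmN; lra.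
have zh0 : z + h != 0.
  apply: contraTneq zh => ->; rewrite nrm0 -ltNge; exact: divr_gt0.
have -> : (z + h)^-1 - z^-1 - - z^-1 ^+ 2 * h = h * h / (z * z * (z + h)).
  by field; rewrite z0 zh0.
have nz2 : nrm (z * z * (z + h)) >= nrm z ^+ 3 / 2.
  rewrite !nrmM exprSr expr2 -mulrA; apply: ler_pM => //.
    by rewrite mulr_ge0 ?nrm_ge0.
  by rewrite divr_ge0 ?nrm_ge0.
rewrite nrmM nrmM (@ComplexField.Normc.normcV R) -mulrA mulrCA [leRHS]mulrC.
rewrite ler_wpM2l ?nrm_ge0 // ler_pdivrMr.
  apply: le_trans h2 _; rewrite -mulrA ler_wpM2l // ltW //.
by apply: lt_le_trans nz2; rewrite divr_gt0 // exprn_gt0.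
Qed.

Lemma cdiff_exprE (f : C -> C) z n : (exists d, cdiff f z d) ->
  exists d, cdiff (fun w => f w ^+ n) z d.
Proof.
move=> [d fd]; elim: n => [|n [d' IH]].
  by exists 0; exact: (cdiff_cst 1 z).
eexists; have := cdiffM fd IH.
have -> // : (fun w => f w * f w ^+ n) = (fun w => f w ^+ n.+1).
  by apply/funext => w; rewrite exprS.
exact.
Qed.

Lemma cdiff_sumE n (f : 'I_n -> C -> C) z : (forall i, exists d, cdiff (f i) z d) ->
  exists d, cdiff (fun w => \sum_i f i w) z d.
Proof.
elim: n f => [|n IH] f H.
  exists 0; have -> : (fun w => \sum_(i < 0) f i w) = (fun=> 0); last exact: cdiff_cst.
  by apply/funext => w; rewrite big_ord0.
have [d Hd] := IH (fun i => f (lift ord0 i)) (fun i => H _).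
have [d' Hd'] := H ord0; exists (d' + d).
have -> : (fun w => \sum_i f i w) = (fun w => f ord0 w + \sum_i f (lift ord0 i) w).
  by apply/funext => w; rewrite big_ord_recl.
exact: cdiffD.
Qed.

(** The primitive is the integral along a vertical and then a horizontal
    segment; by Goursat's lemma the other path around the rectangle gives the
    same increments. *)
Lemma cdiff_primitive (f : C -> C) : (forall z, exists d, cdiff f z d) ->
  exists H, forall z, cdiff H z (f z).
Proof.
move=> fd; have [g Hg] := choice fd.
have /choice [U HU] : forall y, exists F, forall t, cderive F t (f (Complex t y)).
  by move=> y; apply: exists_cprimitive (fun t => cdiff_horizontal (Hg _)).
have /choice [V HV] : forall x, exists F, forall t, cderive F t (f (Complex x t)).
  by move=> x; apply: exists_cprimitive (fun t => cdiff_vertical (Hg _)).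
pose H z := U (complex.Im z) (complex.Re z) - U (complex.Im z) 0
            + imi R * (V 0 (complex.Im z) - V 0 0).
exists H => -[x y] e e0.
have e4 : 0 < e / 4 by rewrite divr_gt0.
have [r r0 Hr] := cdiff_continuous (Hg (Complex x y)) e4.
exists (r / 2); first by rewrite divr_gt0.
move=> [a b] hr.
have ha : `|a| <= nrm (Complex a b) := nrm_Re (Complex a b).
have hb : `|b| <= nrm (Complex a b) := nrm_Im (Complex a b).
pose w := f (Complex x y).
have near (a' b' : R) : `|a'| <= `|a| -> `|b'| <= `|b| ->
    nrm (f (Complex (x + a') (y + b')) - w) <= e / 4.
  move=> h1 h2; apply: Hr (Complex a' b') _.
  apply: le_lt_trans (nrm_le_ReIm _) _ => /=.
  have := le_lt_trans ha hr; have := le_lt_trans hb hr.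
  by move: h1 h2; lra.
pose G s := U (y + b) s + (- w) * real_complex R s.
pose K s := imi R * V x s + (- (imi R * w)) * real_complex R s.
have dr t : cderive (real_complex R) t 1.
  by split; [apply: is_derive_eqf (is_derive_id t 1) _ _ |
    apply: is_derive_eqf (is_derive_cst 0 t 1) _ _].
have dG t : cderive G t (f (Complex t (y + b)) - w).
  by have := cderiveD (HU (y + b) t) (cderiveZ (- w) (dr t)); rewrite mulr1.
have dK t : cderive K t (imi R * (f (Complex x t) - w)).
  have := cderiveD (cderiveZ (imi R) (HV x t)) (cderiveZ (- (imi R * w)) (dr t)).
  by congr (cderive _ _ _); ring.
have addK (u v : R) : u + v - u = v by rewrite addrC addKr.
have hG : nrm (G (x + a) - G x) <= 2 * (e / 4) * `|a|.
  rewrite -{2}(addK x a); apply: cderive_bound dG _ => t; rewrite addK => ht.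
  by have := near (t - x) b ht (lexx _); rewrite [x + _]addrC subrK.
have nrmi : nrm (imi R) = 1 by rewrite /= expr0n /= add0r expr1n sqrtr1.
have hK : nrm (K (y + b) - K y) <= 2 * (e / 4) * `|b|.
  rewrite -{2}(addK y b); apply: cderive_bound dK _ => t; rewrite addK => ht.
  rewrite nrmM nrmi mul1r.
  have := near 0 (t - y); rewrite normr0 addr0 [y + _]addrC subrK.
  exact.
have E : H (Complex x y + Complex a b) - H (Complex x y) - w * Complex a b =
         (G (x + a) - G x) + (K (y + b) - K y).
  have := rect_int0 fd HU HV 0 y x b; rewrite /rect_int !add0r => E0.
  rewrite -[LHS]addr0 -E0 /H /G /K /=.
  have -> : Complex a b = real_complex R a + imi R * real_complex R b.
    by apply: complex_eq => /=; ring.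
  by rewrite !rmorphD /=; ring.
rewrite -/w E; apply: le_trans (nrmD _ _) _.
apply: le_trans (lerD hG hK) _.
rewrite -mulrDr; apply: (@le_trans _ _ (2 * (e / 4) * (nrm (Complex a b) + nrm (Complex a b)))).
  by rewrite ler_wpM2l ?lerD // mulr_ge0 // ltW.
by rewrite le_eqVlt; apply/orP; left; apply/eqP; field.
Qed.

(** Gluing along the unit circle: two functions that agree there have the same
    tangential, hence the same complex derivative. *)
Lemma cdiff_glue (f g : C -> C) :
  (forall z, nrm z <= 1 -> exists d, cdiff f z d) ->
  (forall z, 1 <= nrm z -> exists d, cdiff g z d) ->
  (forall t : R, f (lam (expi t)) = g (lam (expi t))) ->
  forall z, exists d, cdiff (fun z => if nrm z <= 1 then f z else g z) z d.
Proof.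
move=> fd gd fg z.
have far (w h : C) : nrm h < `|nrm w - 1| -> (nrm (w + h) <= 1) = (nrm w <= 1).
  move=> hh; have h1 := nrmD w h.
  have h2 : nrm w <= nrm (w + h) + nrm h.
    by have := nrmD (w + h) (- h); rewrite addrK nrmN.
  move: hh; have [w1|w1] := leP (nrm w) 1.
    by rewrite ler0_norm ?subr_le0 // => hh; apply/idP; lra.
  by rewrite gtr0_norm ?subr_gt0 // => hh; apply/negbTE; rewrite -ltNge; lra.
have [z1|z1|z1] := ltgtP (nrm z) 1.
- have [d Hd] := fd z (ltW z1); exists d => e e0; have [r r0 Hr] := Hd e e0.
  exists (Num.min r `|nrm z - 1|); first by rewrite lt_min r0 normr_gt0 subr_eq0 lt_eqF.
  move=> h; rewrite lt_min => /andP[hr hf]; rewrite (far _ _ hf) (ltW z1).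
  exact: Hr.
- have [d Hd] := gd z (ltW z1); exists d => e e0; have [r r0 Hr] := Hd e e0.
  exists (Num.min r `|nrm z - 1|); first by rewrite lt_min r0 normr_gt0 subr_eq0 gt_eqF.
  move=> h; rewrite lt_min => /andP[hr hf]; rewrite (far _ _ hf) (lt_geF z1).
  exact: Hr.
have [d Hd] : exists d, cdiff f z d by apply: fd; rewrite z1.
have [d' Hd'] : exists d, cdiff g z d by apply: gd; rewrite z1.
have [t zE] : exists t : R, z = lam (expi t).
  have zn : `|z| == 1 by rewrite nrm_normE z1.
  by exists (arg (exist _ z zn)); rewrite expi_arg.
have dl : cderive (fun s => lam (expi s)) t (imi R * lam (expi t)).
  by have := cderive_lamX 1 t; rewrite expr1z; congr (cderive _ _ _).
have dd : d = d'.
  have df : cderive (fun s => f (lam (expi s))) t (d * (imi R * lam (expi t))).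
    by apply: (@cdiff_cderive R f (fun s => lam (expi s)) t d _ _ dl); rewrite -zE.
  have dg : cderive (fun s => g (lam (expi s))) t (d' * (imi R * lam (expi t))).
    by apply: (@cdiff_cderive R g (fun s => lam (expi s)) t d' _ _ dl); rewrite -zE.
  have fgE : (fun s => f (lam (expi s))) = (fun s => g (lam (expi s))).
    by apply/funext => s; exact: fg.
  rewrite fgE in df; have := cderive_uniq df dg; apply: mulIf.
  by rewrite mulf_neq0 ?lam_neq0 // eq_complex /= oner_eq0 andbF.
exists d => e e0; have [r r0 Hr] := Hd e e0; have [r' r'0 Hr'] := Hd' e e0.
exists (Num.min r r'); first by rewrite lt_min r0.
move=> h; rewrite lt_min => /andP[hr hr']; rewrite z1 lexx.
case: (nrm (z + h) <= 1); first exact: Hr.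
by rewrite zE fg -zE dd; exact: Hr'.
Qed.

(** Cauchy: the mean of z f(z) over the unit circle vanishes.  On the circle f
    coincides with a Laurent polynomial, which is holomorphic outside the disc,
    so that f extends to an entire function; this has a primitive, whose
    restriction to the circle is periodic and has derivative i z f(z).  A
    nonzero mean would make the restriction grow linearly. *)
Lemma holomorphic_mean0 (f : C -> C) (m : nat) (c : int -> C) :
  (forall z, nrm z <= 1 -> exists d, cdiff f z d) ->
  (forall t, lam (expi t) * f (lam (expi t)) = trigpoly m c t) -> c 0 = 0.
Proof.
move=> fd fE.
pose q (z : C) := \sum_(i < (2 * m).+1) c (i%:Z - m%:Z) * z ^+ i.
pose g (z : C) := (z^-1) ^+ m.+1 * q z.
have gd z : 1 <= nrm z -> exists d, cdiff g z d.
  move=> z1; have z0 : z != 0.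
    by apply: contraTneq z1 => ->; rewrite nrm0 -ltNge ltr01.
  have [d Hd] : exists d, cdiff (fun w => w^-1 ^+ m.+1) z d.
    by apply: cdiff_exprE; eexists; exact: cdiff_inv.
  have [d' Hd'] : exists d, cdiff q z d.
    apply: cdiff_sumE => i; have [d' Hd'] : exists d, cdiff (fun w : C => w ^+ i) z d.
      by apply: cdiff_exprE; eexists; exact: cdiff_id.
    by eexists; exact: (cdiffM (cdiff_cst _ z) Hd').
  by eexists; exact: (cdiffM Hd Hd').
have fg t : f (lam (expi t)) = g (lam (expi t)).
  apply: (mulfI (lam_neq0 (expi t))); rewrite fE /g /q exprS.
  rewrite !mulrA divff ?lam_neq0 // mul1r mulr_sumr; apply: eq_bigr => i _.
  rewrite expfzDr ?lam_neq0 // -exprnP -exprnN exprVn; ring.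
have [H HH] := cdiff_primitive (cdiff_glue fd gd fg).
pose phi t := H (lam (expi t)).
have dphi t : cderive phi t (imi R * trigpoly m c t).
  have dl : cderive (fun s => lam (expi s)) t (imi R * lam (expi t)).
    by have := cderive_lamX 1 t; rewrite expr1z; congr (cderive _ _ _).
  have := @cdiff_cderive R H (fun s => lam (expi s)) t _ _ (HH _) dl.
  have -> : nrm (lam (expi t)) <= 1.
    by rewrite -lecR -nrm_normE lam_norm; exact: lexx.
  by rewrite -fE; congr (cderive _ _ _); ring.
have [F [dF F2]] := trigpoly_mean m c.
have dr t : cderive (real_complex R) t 1.
  by split; [apply: is_derive_eqf (is_derive_id t 1) _ _ |
    apply: is_derive_eqf (is_derive_cst 0 t 1) _ _].
pose psi t := phi t + - imi R * (F t + c 0 * real_complex R t).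
have dpsi t : cderive psi t 0.
  have := cderiveD (dphi t) (cderiveZ (- imi R) (cderiveD
     (dF t) (cderiveZ (c 0) (dr t)))).
  by congr (cderive _ _ _); ring.
have := cderive0_cst dpsi (2 * pi) 0.
rewrite /psi /phi F2.
have -> : lam (expi (2 * pi : R)) = lam (expi 0).
  by rewrite /lam /= [2 * pi]mulrC mulr_natr cos2pi sin2pi cos0 sin0.
move=> /addrI /mulfI; rewrite oppr_eq0 => /(_ _)/addrI.
rewrite rmorph0 mulr0 => /(_ _)/eqP; rewrite mulf_eq0 => E.
have : (c 0 == 0) || (real_complex R (2 * pi) == 0).
  by apply: E; rewrite eq_complex /= oner_eq0 andbF.
case/orP => [/eqP //|]; rewrite fmorph_eq0 mulf_eq0 pnatr_eq0 /=.
by rewrite gt_eqF // pi_gt0.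
Qed.

End MeanOfHolomorphic.

(** * Holomorphic algebraic loops are polynomial *)

Section HolomorphicLoops.
Variable R : realType.
Local Notation C := R[i].
Local Notation nrm := (@ComplexField.Normc.normc R).

Lemma poly_low_coef0 (K : nzRingType) (p : {poly K}) n :
  (forall k, (k < n)%N -> p`_k = 0) -> p = drop_poly n p * 'X^n.
Proof.
move=> H; rewrite -[LHS](poly_take_drop n p).
rewrite (_ : take_poly n p = 0) ?add0r //.
by apply/polyP => k; rewrite coef_take_poly coef0; case: ltnP => // /H.
Qed.

Lemma trigpoly_horner (p : {poly C}) m (t : R) : (size p <= (2 * m).+1)%N ->
  lam (expi t) ^- m * p.[lam (expi t)] =
    trigpoly m (fun j => p`_(absz (j + m%:Z))) t.
Proof.
move=> sp; rewrite (horner_coef_wide _ sp) mulr_sumr; apply: eq_bigr => i _.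
by rewrite subrK absz_nat expfzDr ?lam_neq0 // -exprnP -exprnN; ring.
Qed.

(** A Laurent polynomial that extends holomorphically to the disc has no
    negative powers: their coefficients are means over the circle of lam times
    a holomorphic function. *)
Lemma holomorphic_low_coef0 (f : C -> C) n (p : {poly C}) :
  holomorphic_on_disc f -> (forall z, f (lam z) = lam z ^- n * p.[lam z]) ->
  forall k, (k < n)%N -> p`_k = 0.
Proof.
move=> [r r1 fr] fp k kn.
pose m := (k + size p)%N; pose q := 'X^(m - k) * p.
have qm : q`_m = p`_k.
  rewrite coefXnM ltnNge leq_subr /=; congr (_`_ _); rewrite /m; lia.
have sq : (size q <= (2 * m).+1)%N.
  apply: leq_trans (size_polyMleq _ _) _; rewrite size_polyXn /m; lia.
pose c j := q`_(absz (j + m%:Z)).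
rewrite -qm -[q`_m]/(c 0).
apply: (@holomorphic_mean0 R (fun z => z ^+ (n - k.+1) * f z) m c).
  move=> z z1; have [d Hd] : exists d, cdiff f z d.
    apply: derivable_cdiff; apply: fr.
    by rewrite nrm_normE ltcR (le_lt_trans z1).
  have [d' Hd'] : exists d, cdiff (fun w : C => w ^+ (n - k.+1)) z d.
    by apply: cdiff_exprE; eexists; exact: cdiff_id.
  by eexists; exact: (cdiffM Hd' Hd).
move=> t; rewrite -trigpoly_horner // fp /q hornerM hornerXn.
set w := lam (expi t); have w0 : w != 0 := lam_neq0 _.
have -> : w ^- n = w ^- (n - k) * w ^- k.
  by rewrite -invfM -exprD subnK // ltnW.
have -> : w ^- m = w ^- (m - k) * w ^- k.
  by rewrite -invfM -exprD subnK // leq_addr.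
have -> : (n - k = (n - k.+1).+1)%N by lia.
rewrite exprS.
have w_neq0 j : w ^+ j != 0 by rewrite expf_neq0.
move: (w ^+ (n - k.+1)) (w ^+ (m - k)) (w ^+ k) (p.[w]) (w_neq0 (n - k.+1)%N)
  (w_neq0 (m - k)%N) (w_neq0 k) => a b d x a0 b0 d0.
by field; rewrite w0 a0 b0 d0.
Qed.

(** A holomorphic loop in the group is polynomial.  That it is orthogonal for
    the bilinear form makes its transpose a polynomial inverse. *)
Lemma LambdaPlus_poly (Psi : loop R) : LambdaPlusAlg Psi ->
  exists P : 'M[{poly C}]_7, [/\ forall z, Psi z = mxev P z,
    forall z, G2mat (mxev P z) & P^T *m P = 1%:M].
Proof.
move=> [gPsi [F [FE _ Fh]] /finite_fourierP [n [P HP]] _].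
pose Q : 'M[{poly C}]_7 := map_mx (drop_poly n) P.
have PE : P = 'X^n *: Q.
  apply/matrixP => i j; rewrite !mxE mulrC; apply: poly_low_coef0 => k kn.
  apply: (holomorphic_low_coef0 (Fh i j) _ kn) => z.
  by rewrite FE HP !mxE.
have PsiE z : Psi z = mxev Q z.
  rewrite HP PE mxev_scale hornerXn scalerA mulVf ?scale1r //.
  by rewrite expf_neq0 // lam_neq0.
have gQ z : G2mat (mxev Q z) by rewrite -PsiE; apply/AutOP; exact: gPsi.
exists Q; split=> //; apply: mxev_inj => z.
by rewrite mxev_mul mxev_tr (gQ z).1 mxev1.
Qed.

End HolomorphicLoops.

(** * The square norm on the circle *)

Section SquareNorm.
Variable R : realType.
Local Notation C := R[i].
Implicit Types (f g : cfun R) (u v : 'cV[C]_7).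

Definition vnorm2 v : R :=
  \sum_(j < 7) (complex.Re (v j ord0) ^+ 2 + complex.Im (v j ord0) ^+ 2).

Lemma sqnormL2E f :
  sqnormL2 f = (\int[lebesgue_measure]_(t in @angles R) (vnorm2 (f (expi t)))%:E)%E.
Proof. by []. Qed.

Lemma vnorm2_ge0 v : 0 <= vnorm2 v.
Proof. by apply: sumr_ge0 => j _; rewrite addr_ge0 ?sqr_ge0. Qed.

Lemma vnorm2_comp v j :
  complex.Re (v j ord0) ^+ 2 + complex.Im (v j ord0) ^+ 2 <= vnorm2 v.
Proof.
rewrite /vnorm2 (bigD1 j) //= lerDl; apply: sumr_ge0 => i _.
by rewrite addr_ge0 ?sqr_ge0.
Qed.

Lemma vnorm2D u v : vnorm2 (u + v) <= 2 * vnorm2 u + 2 * vnorm2 v.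
Proof.
rewrite /vnorm2 !mulr_sumr -big_split; apply: ler_sum => j _ /=.
rewrite mxE ReD ImD.
move: (complex.Re _) (complex.Re _) (complex.Im _) (complex.Im _) => a b c d.
rewrite -subr_ge0 (_ : _ - _ = (a - b) ^+ 2 + (c - d) ^+ 2); last ring.
by rewrite addr_ge0 ?sqr_ge0.
Qed.

Lemma normc2E (x : C) : complex.Re x ^+ 2 + complex.Im x ^+ 2 =
  ComplexField.Normc.normc x ^+ 2.
Proof. by case: x => a b /=; rewrite sqr_sqrtr // addr_ge0 ?sqr_ge0. Qed.

Lemma vnorm2_mul (A : 'M[C]_7) : exists2 K : R, 0 <= K &
  forall v, vnorm2 (A *m v) <= K * vnorm2 v.
Proof.
pose M := \sum_i \sum_k ComplexField.Normc.normc (A i k).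
have M0 : 0 <= M by apply: sumr_ge0 => i _; apply: sumr_ge0 => k _; exact: nrm_ge0.
exists (\sum_(j < 7) (M * M * 7 * 7)).
  by apply: sumr_ge0 => j _; rewrite !mulr_ge0.
move=> v; rewrite mulr_suml; apply: ler_sum => j _; rewrite normc2E.
have sv k : ComplexField.Normc.normc (v k ord0) <= Num.sqrt (vnorm2 v).
  rewrite -(@ler_pXn2r _ 2) ?nnegrE ?nrm_ge0 ?sqrtr_ge0 //.
  by rewrite sqr_sqrtr ?vnorm2_ge0 // -normc2E vnorm2_comp.
have Aik i k : ComplexField.Normc.normc (A i k) <= M.
  rewrite /M (bigD1 i) //= (bigD1 k) //= -addrA lerDl addr_ge0 //.
    by apply: sumr_ge0 => l _; exact: nrm_ge0.
  by apply: sumr_ge0 => l _; apply: sumr_ge0 => m _; exact: nrm_ge0.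
have nsum (I : finType) (F : I -> C) :
    ComplexField.Normc.normc (\sum_i F i) <= \sum_i ComplexField.Normc.normc (F i).
  elim/big_rec2: _ => [|i x y _ IH]; first by rewrite nrm0.
  by apply: le_trans (nrmD _ _) _; rewrite lerD2l.
have -> : M * M * 7 * 7 * vnorm2 v = (M * 7 * Num.sqrt (vnorm2 v)) ^+ 2.
  by rewrite [RHS]exprMn sqr_sqrtr ?vnorm2_ge0 //; ring.
rewrite ler_pXn2r ?nnegrE ?nrm_ge0 ?mulr_ge0 ?sqrtr_ge0 //.
rewrite mxE; apply: le_trans (nsum _ _) _.
apply: (@le_trans _ _ (\sum_(k < 7) M * Num.sqrt (vnorm2 v))).
  by apply: ler_sum => k _; rewrite nrmM; apply: ler_pM; rewrite ?nrm_ge0.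
by rewrite big_const_ord iter_addr_0 [M * 7 * _]mulrAC mulr_natr lexx.
Qed.

Lemma vnorm2_lam (z : circle R) k v : vnorm2 (lam z ^+ k *: v) = vnorm2 v.
Proof.
apply: eq_bigr => j _; rewrite !normc2E mxE nrmM.
have -> : ComplexField.Normc.normc (lam z ^+ k) = 1; last by rewrite mul1r.
by apply: (@complexI R); rewrite -nrm_normE normrX lam_norm expr1n.
Qed.

Definition cmeas (g : R -> C) :=
  measurable_fun (@angles R) (fun t => complex.Re (g t)) /\
  measurable_fun (@angles R) (fun t => complex.Im (g t)).

Definition vmeas f := forall j : 'I_7, cmeas (fun t => f (expi t) j ord0).

Lemma anglesE : @angles R = `[0, 2 * pi]%classic.
Proof. by apply/seteqP; split => t /=; rewrite in_itv. Qed.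

Lemma measurable_angles : measurable (@angles R).
Proof. by rewrite anglesE; exact: measurable_itv. Qed.

Lemma cmeas_add (g h : R -> C) : cmeas g -> cmeas h -> cmeas (fun t => g t + h t).
Proof.
move=> [g1 g2] [h1 h2]; split.
  rewrite (_ : (fun t => _) = (fun t => complex.Re (g t)) \+ (fun t => complex.Re (h t))).
    exact: measurable_funD.
  by apply/funext => t; rewrite ReD.
rewrite (_ : (fun t => _) = (fun t => complex.Im (g t)) \+ (fun t => complex.Im (h t))).
  exact: measurable_funD.
by apply/funext => t; rewrite ImD.
Qed.

Lemma cmeas_mul (g h : R -> C) : cmeas g -> cmeas h -> cmeas (fun t => g t * h t).
Proof.
move=> [g1 g2] [h1 h2]; split.
  rewrite (_ : (fun t => _) = ((fun t => complex.Re (g t)) \* (fun t => complex.Re (h t)))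
     \- ((fun t => complex.Im (g t)) \* (fun t => complex.Im (h t)))).
    by apply: measurable_funB; exact: measurable_funM.
  by apply/funext => t; rewrite ReM.
rewrite (_ : (fun t => _) = ((fun t => complex.Re (g t)) \* (fun t => complex.Im (h t)))
   \+ ((fun t => complex.Im (g t)) \* (fun t => complex.Re (h t)))).
  by apply: measurable_funD; exact: measurable_funM.
by apply/funext => t; rewrite ImM.
Qed.

Lemma cmeas_cst (c : C) : cmeas (fun=> c).
Proof. by split; exact: measurable_cst. Qed.

Lemma cmeas_sum n (h : 'I_n -> R -> C) : (forall i, cmeas (h i)) ->
  cmeas (fun t => \sum_i h i t).
Proof.
elim: n h => [|n IH] h H.
  have -> : (fun t => \sum_(i < 0) h i t) = fun=> 0.
    by apply/funext => s; rewrite big_ord0.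
  exact: cmeas_cst.
have -> : (fun t => \sum_i h i t) = (fun t => h ord0 t + \sum_i h (lift ord0 i) t).
  by apply/funext => s; rewrite big_ord_recl.
by apply: cmeas_add => //; exact: IH.
Qed.

Lemma cderive_continuous (g : R -> C) : (forall t, exists d, cderive g t d) ->
  continuous (fun t => complex.Re (g t)) /\ continuous (fun t => complex.Im (g t)).
Proof.
by move=> H; split=> t; have [d [d1 d2]] := H t;
  apply: differentiable_continuous; apply/derivable1_diffP;
  [exact: (@ex_derive _ _ _ _ _ _ _ d1) | exact: (@ex_derive _ _ _ _ _ _ _ d2)].
Qed.

Lemma cmeas_cderive (g : R -> C) : (forall t, exists d, cderive g t d) -> cmeas g.
Proof.
move=> /cderive_continuous [c1 c2].
by split; apply: measurable_funTS; exact: continuous_measurable_fun.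
Qed.

Lemma cmeas_lam k : cmeas (fun t => lam (expi t) ^+ k).
Proof. by apply: cmeas_cderive => t; eexists; exact: (cderive_lamX k t). Qed.

Lemma vmeas_add f g : vmeas f -> vmeas g -> vmeas (fun z => f z + g z).
Proof.
move=> mf mg j; have := cmeas_add (mf j) (mg j).
by congr (cmeas _); apply/funext => t; rewrite mxE.
Qed.

Lemma vmeas_mul k (A : 'M[C]_7) f : vmeas f ->
  vmeas (fun z => lam z ^+ k *: (A *m f z)).
Proof.
move=> mf j.
have := cmeas_mul (cmeas_lam k) (cmeas_sum (fun i : 'I_7 => cmeas_mul (cmeas_cst (A j i)) (mf i))).
by congr (cmeas _); apply/funext => t; rewrite !mxE.
Qed.

Lemma vmeas_vnorm2 f : vmeas f ->
  measurable_fun (@angles R) (fun t => (vnorm2 (f (expi t)))%:E).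
Proof.
move=> mf.
rewrite (_ : (fun t => _) = (fun t => \sum_(j < 7)
   (complex.Re (f (expi t) j ord0) ^+ 2 + complex.Im (f (expi t) j ord0) ^+ 2)%:E)%E).
  apply: emeasurable_sum => j; apply/measurable_EFinP.
  by apply: measurable_funD; apply: measurable_funX; [exact: (mf j).1|exact: (mf j).2].
by apply/funext => t; rewrite sumEFin.
Qed.

Lemma L2P f : L2 f <-> vmeas f /\ (sqnormL2 f < +oo)%E.
Proof. by []. Qed.

Lemma sqnormL2_le f g (K : R) : vmeas f -> vmeas g -> 0 <= K ->
  (forall z, vnorm2 (g z) <= K * vnorm2 (f z)) ->
  (sqnormL2 g <= K%:E * sqnormL2 f)%E.
Proof.
move=> mf mg K0 H; rewrite !sqnormL2E -ge0_integralZl_EFin //.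
- apply: ge0_le_integral => //.
  + exact: measurable_angles.
  + by move=> t _; rewrite lee_fin vnorm2_ge0.
  + exact: vmeas_vnorm2.
  + by apply: measurable_funeM; exact: vmeas_vnorm2.
  + by move=> t _; rewrite -EFinM lee_fin.
- exact: measurable_angles.
- by move=> t _; rewrite lee_fin vnorm2_ge0.
- exact: vmeas_vnorm2.
Qed.

Lemma sqnormL2_add f g : vmeas f -> vmeas g ->
  (sqnormL2 (fun z => (f z + g z)%R) <= 2%:E * sqnormL2 f + 2%:E * sqnormL2 g)%E.
Proof.
move=> mf mg; rewrite !sqnormL2E -!ge0_integralZl_EFin //;
  try exact: measurable_angles; try exact: vmeas_vnorm2;
  try by move=> t _; rewrite lee_fin vnorm2_ge0.
rewrite -ge0_integralD //; try exact: measurable_angles;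
  try (by apply: measurable_funeM; exact: vmeas_vnorm2);
  try by move=> t _; rewrite -EFinM lee_fin mulr_ge0 ?vnorm2_ge0.
apply: ge0_le_integral => //.
- exact: measurable_angles.
- by move=> t _; rewrite lee_fin vnorm2_ge0.
- exact: (vmeas_vnorm2 (vmeas_add mf mg)).
- apply: (@emeasurable_funD _ _ _ _ (fun t => 2%:E * (vnorm2 (f (expi t)))%:E)%E
                              (fun t => 2%:E * (vnorm2 (g (expi t)))%:E)%E);
    by apply: measurable_funeM; exact: vmeas_vnorm2.
- by move=> t _; rewrite -!EFinM -EFinD lee_fin vnorm2D.
Qed.

End SquareNorm.

(** * The Hardy space H_+ *)

Section HardySpace.
Variable R : realType.
Local Notation C := R[i].
Implicit Types (f g p : cfun R) (e : R).

Lemma span_nonnegP p :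
  span_nonneg p <-> exists P : 'cV[{poly C}]_7, p = fun z => mxev P z.
Proof.
have colE (n : nat) (c : nat -> 'I_7 -> C) (z : circle R) :
    \sum_(i < n) \sum_(j < 7) (c i j * lam z ^+ i) *: (delta_mx j ord0 : 'cV[C]_7) =
    \col_j \sum_(i < n) c i j * lam z ^+ i.
  rewrite exchange_big [RHS]colE_sum; apply: eq_bigr => j _.
  by rewrite mxE scaler_suml.
split=> [[n [c ->]]|[P ->]].
  exists (\col_j \poly_(i < n) c i j); apply/funext => z; rewrite colE.
  by apply/colP => j; rewrite !mxE /horner_eval horner_poly.
have [n sP] := size_bound P; exists n, (fun i j => (P j ord0)`_i).
apply/funext => z; rewrite (colE n (fun i j => (P j ord0)`_i)); apply/colP => j.
by rewrite !mxE /horner_eval (horner_coef_wide _ (sP j ord0)).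
Qed.

Lemma vnorm2_0 : vnorm2 (0 : 'cV[C]_7) = 0.
Proof. by rewrite /vnorm2 big1 // => j _; rewrite mxE /= expr0n addr0. Qed.

Lemma sqnormL2_0 : sqnormL2 (fun=> 0 : 'cV[C]_7) = 0%E.
Proof. by rewrite sqnormL2E; under eq_integral do rewrite vnorm2_0; rewrite integral0. Qed.

Lemma L2_add f g : L2 f -> L2 g -> L2 (fun z => f z + g z).
Proof.
move=> /L2P [mf sf] /L2P [mg sg]; apply/L2P; split; first exact: vmeas_add.
apply: le_lt_trans (sqnormL2_add mf mg) _.
by apply: lte_add_pinfty; rewrite lte_mul_pinfty.
Qed.

Lemma L2_mul k (A : 'M[C]_7) f : L2 f -> L2 (fun z => lam z ^+ k *: (A *m f z)).
Proof.
move=> /L2P [mf sf]; apply/L2P; split; first exact: vmeas_mul.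
have [K K0 HK] := vnorm2_mul A.
apply: (@le_lt_trans _ _ (K%:E * sqnormL2 f)%E).
  apply: sqnormL2_le => //; first exact: vmeas_mul.
  by move=> z; rewrite vnorm2_lam.
by rewrite lte_mul_pinfty // lee_fin.
Qed.

Lemma L2_cst (v : 'cV[C]_7) : L2 (fun=> v).
Proof.
apply/L2P; split; first by move=> j; exact: cmeas_cst.
rewrite sqnormL2E integral_cst; last exact: measurable_angles.
rewrite anglesE [X in (_ * X)%E]lebesgue_measure_itv /=.
by case: ifP => _; rewrite ?mule0 // -EFinB -EFinM ltry.
Qed.

Lemma fun_sum_ind (P : cfun R -> Prop) n (h : 'I_n -> cfun R) :
  P (fun=> 0) -> (forall f g, P f -> P g -> P (fun z => f z + g z)) ->
  (forall i, P (h i)) -> P (fun z => \sum_i h i z).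
Proof.
move=> P0 PD; elim: n h => [|n IH] h H.
  by have -> : (fun z => \sum_(i < 0) h i z) = (fun=> 0);
    first by apply/funext => z; rewrite big_ord0.
have -> : (fun z => \sum_i h i z) = (fun z => h ord0 z + \sum_i h (lift ord0 i) z).
  by apply/funext => z; rewrite big_ord_recl.
by apply: PD => //; exact: IH.
Qed.

Lemma L2_mxev (P : 'cV[{poly C}]_7) : L2 (fun z => mxev P z).
Proof.
have [n sP] := size_bound P.
have -> : (fun z => mxev P z) =
    (fun z : circle R => \sum_(k < n) lam z ^+ k *: (1%:M *m coefmx P k)).
  by apply/funext => z; rewrite (mxevE _ sP); apply: eq_bigr => k _; rewrite mul1mx.
apply: fun_sum_ind; [exact: L2_cst | exact: L2_add |] => k.
exact: (@L2_mul k 1%:M (fun=> coefmx P k) (L2_cst _)).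
Qed.

Lemma Hplus_mxev_cV (P : 'cV[{poly C}]_7) : Hplus (fun z => mxev P z).
Proof.
split; first exact: L2_mxev.
move=> e e0; exists (fun z => mxev P z); first by apply/span_nonnegP; exists P.
have -> : (fun z : circle R => mxev P z - mxev P z) = (fun=> 0).
  by apply/funext => z; rewrite subrr.
by rewrite sqnormL2_0 lte_fin.
Qed.

Lemma Hplus0 : Hplus (fun=> 0 : 'cV[C]_7).
Proof.
have := Hplus_mxev_cV 0; congr Hplus; apply/funext => z.
by rewrite /mxev map_mx0.
Qed.

Lemma vmeas_sub f g : vmeas f -> vmeas g -> vmeas (fun z => f z - g z).
Proof.
move=> mf mg; have := vmeas_add mf (vmeas_mul 0 (- 1%:M) mg).
by congr vmeas; apply/funext => z; rewrite expr0 scale1r mulNmx mul1mx.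
Qed.

Lemma Hplus_add f g : Hplus f -> Hplus g -> Hplus (fun z => f z + g z).
Proof.
move=> [Lf Hf] [Lg Hg]; split; first exact: L2_add.
move=> e e0; have e4 : 0 < e / 4 by rewrite divr_gt0.
have [p sp Hp] := Hf _ e4; have [q sq Hq] := Hg _ e4.
have /span_nonnegP [P pE] := sp; have /span_nonnegP [Q qE] := sq.
exists (fun z => p z + q z).
  apply/span_nonnegP; exists (P + Q); apply/funext => z.
  by rewrite pE qE /mxev map_mxD.
have mp : vmeas p by rewrite pE; exact: (L2_mxev P).1.
have mq : vmeas q by rewrite qE; exact: (L2_mxev Q).1.
have -> : (fun z => f z + g z - (p z + q z)) =
          (fun z => (f z - p z) + (g z - q z)).
  by apply/funext => z; rewrite opprD addrACA.
apply: le_lt_trans (sqnormL2_add (vmeas_sub Lf.1 mp) (vmeas_sub Lg.1 mq)) _.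
have -> : e%:E = (2%:E * (e / 4)%:E + 2%:E * (e / 4)%:E)%E.
  by rewrite -!EFinM -EFinD; congr (_%:E); field.
by apply: lteD; rewrite lte_pmul2l.
Qed.

(** A shift by a nonnegative power is an isometry and a constant matrix is
    bounded, so that both preserve the closure of the polynomials. *)
Lemma Hplus_mul k (A : 'M[C]_7) f : Hplus f ->
  Hplus (fun z => lam z ^+ k *: (A *m f z)).
Proof.
move=> [Lf Hf]; split; first exact: L2_mul.
have [K K0 HK] := vnorm2_mul A; have K1 : 0 < K + 1 by rewrite ltr_wpDl.
move=> e e0; have eK : 0 < e / (K + 1) by rewrite divr_gt0.
have [p sp Hp] := Hf _ eK; have /span_nonnegP [P pE] := sp.
exists (fun z => lam z ^+ k *: (A *m p z)).
  apply/span_nonnegP; exists ('X^k *: (map_mx polyC A *m P)); apply/funext => z.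
  by rewrite pE mxev_scale hornerXn mxev_mul mxev_cst.
have mp : vmeas p by rewrite pE; exact: (L2_mxev P).1.
have md := vmeas_sub Lf.1 mp.
have -> : (fun z => lam z ^+ k *: (A *m f z) - lam z ^+ k *: (A *m p z)) =
          (fun z => lam z ^+ k *: (A *m (f z - p z))).
  by apply/funext => z; rewrite mulmxBr scalerBr.
apply: (@le_lt_trans _ _ ((K + 1)%:E * sqnormL2 (fun z => (f z - p z)%R))%E).
  apply: sqnormL2_le => //; [exact: vmeas_mul | exact: ltW |].
  move=> z; rewrite vnorm2_lam; apply: le_trans (HK _) _.
  by rewrite ler_wpM2r ?vnorm2_ge0 // lerDl.
have -> : e%:E = ((K + 1)%:E * (e / (K + 1))%:E)%E.
  by rewrite -EFinM mulrC divfK // gt_eqF.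
by rewrite lte_pmul2l // lte_fin.
Qed.

Lemma Hplus_mxev (P : 'M[{poly C}]_7) f : Hplus f ->
  Hplus (fun z => mxev P z *m f z).
Proof.
move=> Hf; have [n sP] := size_bound P.
have -> : (fun z => mxev P z *m f z) =
    (fun z => \sum_(k < n) lam z ^+ k *: (coefmx P k *m f z)).
  apply/funext => z; rewrite (mxevE _ sP) mulmx_suml; apply: eq_bigr => k _.
  by rewrite scalemxAl.
apply: fun_sum_ind; [exact: Hplus0 | exact: Hplus_add |] => k.
exact: Hplus_mul.
Qed.

Lemma cderive_horner (q : {poly C}) (t : R) :
  exists d, cderive (fun s => q.[lam (expi s)]) t d.
Proof.
have -> : (fun s : R => q.[lam (expi s)]) =
          (fun s => \sum_(k < size q) q`_k * lam (expi s) ^+ k).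
  by apply/funext => s; rewrite horner_coef.
eexists; apply: cderive_sum => k; apply: cderiveZ.
exact: (cderive_lamX k t).
Qed.

(** Bessel's inequality for one Fourier coefficient, from
    |x|^2 >= 2 Re (conj b x) - |b|^2. *)
Lemma coef_sqnormL2 n (S : 'cV[{poly C}]_7) j k :
  ((2 * pi * ComplexField.Normc.normc ((S j ord0)`_k) ^+ 2)%:E <=
   sqnormL2 (fun z => lam z ^- n *: mxev S z))%E.
Proof.
set a := (S j ord0)`_k; set A2 := ComplexField.Normc.normc a ^+ 2.
pose m := (k + size (S j ord0))%N.
pose q := (conjc a)%:P * ('X^(m - k) * S j ord0).
have sq : (size q <= (2 * m).+1)%N.
  rewrite /q mul_polyC; apply: leq_trans (size_scale_leq _ _) _.
  apply: leq_trans (size_polyMleq _ _) _; rewrite size_polyXn.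
  by rewrite /m; move: (size (S j ord0)) => s; lia.
have qm : q`_m = real_complex R A2.
  rewrite /q coefCM coefXnM ltnNge leq_subr /=.
  have -> : (m - (m - k) = k)%N by rewrite subKn // leq_addr.
  rewrite -/a mulrC -sqr_normc nrm_normE -rmorphXn //.
pose c i := q`_(absz (i + m%:Z)).
have c0 : c 0 = real_complex R A2 by rewrite -qm.
have [F [dF F2]] := trigpoly_mean m c.
pose T (t : R) : R := 2 * complex.Re (trigpoly m c t) - A2.
pose G (t : R) : R := 2 * complex.Re (F t) + A2 * t.
have dG (t : R) : is_derive t 1 G (T t).
  have [dR _] := dF t.
  have := is_derive_fadd (is_derive_fscale 2 dR) (is_derive_fscale A2 (is_derive_id t 1)).
  move=> h; apply: is_derive_eqf h _ _ => //.
  rewrite /T c0; case: (trigpoly m c t) => x y /=; ring.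
have pi2 : 0 < 2 * pi :> R by rewrite mulr_gt0 ?pi_gt0.
have cont_der (f d : R -> R) : (forall t : R, is_derive t 1 f (d t)) -> continuous f.
  move=> fd x; apply: differentiable_continuous; apply/derivable1_diffP.
  exact: (@ex_derive _ _ _ _ _ _ _ (fd x)).
have cT : continuous T.
  have dT (t : R) : is_derive t 1 T _ := is_derive_fadd
    (is_derive_fscale 2 (cderive_trigpoly m c t).1) (is_derive_cst (- A2) t 1).
  exact: cont_der dT.
have intT : (\int[lebesgue_measure]_(t in angles (R:=R)) (T t)%:E)%E =
            (2 * pi * A2)%:E.
  rewrite anglesE (@continuous_FTC2 R T G) //.
  - rewrite -EFinB /G F2; congr (_%:E); ring.
  - exact: continuous_subspaceT.
  - have cG := cont_der _ _ dG.
    split; first by move=> t _; exact: (@ex_derive _ _ _ _ _ _ _ (dG t)).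
      by apply: cvg_at_right_filter; exact: cG.
    by apply: cvg_at_left_filter; exact: cG.
  - by move=> t _; rewrite derive1E; exact: (@derive_val _ _ _ _ _ _ _ (dG t)).
rewrite mulrAC -mulrA in intT *; rewrite -intT sqnormL2E.
pose re (t : R) : R := complex.Re (S j ord0).[lam (expi t)].
pose im (t : R) : R := complex.Im (S j ord0).[lam (expi t)].
pose N (t : R) : R := re t * re t + im t * im t.
have cN : continuous N.
  have [c1 c2] := cderive_continuous (cderive_horner (S j ord0)).
  by move=> t; apply: cvgD; apply: cvgM; first [exact: c1 | exact: c2].
have cint (f : R -> R) : continuous f ->
    lebesgue_measure.-integrable (angles (R:=R)) (EFin \o f).
  move=> fc; rewrite anglesE; apply: continuous_compact_integrable.
    exact: segment_compact.
  exact: continuous_subspaceT.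
apply: (@le_trans _ _ (\int[lebesgue_measure]_(t in angles (R:=R)) (N t)%:E)%E).
  apply: le_integral; [exact: measurable_angles|exact: cint|exact: cint|].
  move=> t _; rewrite lee_fin /T /N /re /im -!expr2 -trigpoly_horner // /q.
  rewrite hornerM hornerC hornerM hornerXn.
  set w := lam (expi t); set x := (S j ord0).[w].
  have w0 : w != 0 := lam_neq0 _.
  have -> : w ^- m * (conjc a * (w ^+ (m - k) * x)) = (conjc a * w ^- k) * x.
    have -> : w ^- m = w ^- (m - k) * w ^- k.
      by rewrite -invfM -exprD subnK // /m leq_addr.
    by field; rewrite !expf_neq0.
  have bE : complex.Re (conjc a * w ^- k) ^+ 2 + complex.Im (conjc a * w ^- k) ^+ 2 = A2.
    rewrite normc2E nrmM /A2; congr (_ ^+ 2).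
    have -> : ComplexField.Normc.normc (w ^- k) = 1.
      by apply: (@complexI R); rewrite -nrm_normE normfV normrX lam_norm expr1n invr1.
    by rewrite mulr1; case: (a) => a1 a2 /=; rewrite sqrrN.
  rewrite -bE; move: (conjc a * w ^- k) x => [b1 b2] [x1 x2] /=.
  rewrite -subr_ge0 (_ : _ - _ = (x1 - b1) ^+ 2 + (x2 + b2) ^+ 2); last ring.
  by rewrite addr_ge0 ?sqr_ge0.
apply: ge0_le_integral => //.
- exact: measurable_angles.
- by move=> t _; rewrite lee_fin /N -!expr2 addr_ge0 ?sqr_ge0.
- by have /integrableP [] := cint _ cN.
- apply: (@vmeas_vnorm2 R (fun z => lam z ^- n *: mxev S z)) => i; apply: cmeas_cderive => t.
  have [d Hd] := cderive_horner (S i ord0) t.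
  have h := cderiveM (cderive_lamX (- n%:Z) t) Hd.
  have e : (fun s => lam (expi s) ^ (- n%:Z) * (S i ord0).[lam (expi s)]) =
           (fun s => (lam (expi s) ^- n *: mxev S (expi s)) i ord0).
    by apply/funext => s; rewrite !mxE exprnN.
  by rewrite e in h; eexists; exact: h.
- move=> t _; rewrite lee_fin; apply: le_trans (vnorm2_comp _ j).
  rewrite /N /re /im -!expr2 !normc2E !mxE nrmM.
  have -> : ComplexField.Normc.normc (lam (expi t) ^- n) = 1.
    by apply: (@complexI R); rewrite -nrm_normE normfV normrX lam_norm expr1n invr1.
  by rewrite mul1r.
Qed.

(** A Laurent polynomial in the Hardy space has no negative powers: by
    Bessel's inequality such a coefficient keeps it away from the polynomials. *)
Lemma Hplus_low_coef0 n (S : 'cV[{poly C}]_7) :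
  Hplus (fun z => lam z ^- n *: mxev S z) ->
  forall j k, (k < n)%N -> (S j ord0)`_k = 0.
Proof.
move=> [_ HS] j k kn; apply/eqP/negPn/negP => a0.
set a := (S j ord0)`_k in a0.
have na : 0 < ComplexField.Normc.normc a.
  by rewrite -ltcR -nrm_normE normr_gt0.
pose e := 2 * pi * ComplexField.Normc.normc a ^+ 2 : R.
have e0 : 0 < e by rewrite !mulr_gt0 ?exprn_gt0 ?pi_gt0.
have [p /span_nonnegP [P ->]] := HS e e0.
have -> : (fun z => (lam z ^- n *: mxev S z - mxev P z)%R) =
          (fun z => lam z ^- n *: mxev (S - 'X^n *: P) z).
  apply/funext => z; rewrite mxevB mxev_scale.
  by rewrite hornerXn scalerBr scalerA mulVf ?scale1r // expf_neq0 ?lam_neq0.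
have := coef_sqnormL2 n (S - 'X^n *: P) j k.
rewrite !mxE coefB coefXnM kn subr0 -/a -/e => h1 h2.
by have := le_lt_trans h1 h2; rewrite ltxx.
Qed.

End HardySpace.

(** * Unitary factorization of polynomial loops *)

Section Iwasawa.
Variable R : realType.
Local Notation C := R[i].
Implicit Types (z : circle R).

Definition adj m n (A : 'M[C]_(m, n)) : 'M[C]_(n, m) := (conjm A)^T.

Lemma conjm_mul m n p (A : 'M[C]_(m, n)) (B : 'M[C]_(n, p)) :
  conjm (A *m B) = conjm A *m conjm B.
Proof. exact: (map_mxM (@conjc R)). Qed.

Lemma conjmK m n (A : 'M[C]_(m, n)) : conjm (conjm A) = A.
Proof. by apply/matrixP => i j; rewrite !mxE conjcK. Qed.

Lemma conjm_tr m n (A : 'M[C]_(m, n)) : conjm A^T = (conjm A)^T.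
Proof. by apply/matrixP => i j; rewrite !mxE. Qed.

Lemma adj_mul m n p (A : 'M[C]_(m, n)) (B : 'M[C]_(n, p)) :
  adj (A *m B) = adj B *m adj A.
Proof. by rewrite /adj conjm_mul trmx_mul. Qed.

Lemma adjZ m n (a : C) (A : 'M[C]_(m, n)) : adj (a *: A) = conjc a *: adj A.
Proof. by apply/matrixP => i j; rewrite !mxE rmorphM. Qed.

(** If P is singular at lam = 0, let E be the orthogonal projection onto a line
    orthogonal to the image of P(0).  Then E P is divisible by lam, so that the
    unitary loop U = (1 - E) + lam E splits off from P. *)
Lemma uniton_factor (P : 'M[{poly C}]_7) : \det (coefmx P 0) = 0 ->
  exists U P' : 'M[{poly C}]_7, [/\ P = U *m P',
    forall z, adj (mxev U z) *m mxev U z = 1%:M, mxev U (expi 0) = 1%:M &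
    root (\det U) 0].
Proof.
move=> /eqP /det0P [w w0 wP].
pose s := (w *m adj w) ord0 ord0.
have sE : s = \sum_i `|w ord0 i| ^+ 2.
  by rewrite /s mxE; apply: eq_bigr => i _; rewrite !mxE sqr_normc.
have s0 : s != 0.
  rewrite sE psumr_eq0; last by move=> i _; rewrite exprn_ge0.
  apply: contra w0 => /allP H; apply/eqP/rowP => i; rewrite mxE.
  have := H i (mem_index_enum _).
  by rewrite /= expf_eq0 normr_eq0 /= => /eqP.
have sJ : conjc s = s.
  rewrite sE rmorph_sum; apply: eq_bigr => i _.
  by rewrite nrm_normE rmorphXn /= oppr0.
have wwE : w *m adj w = s%:M by rewrite [LHS]mx11_scalar.
pose E : 'M[C]_7 := s^-1 *: (adj w *m w).
have wE : w *m E = w.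
  by rewrite /E -scalemxAr mulmxA wwE mul_scalar_mx scalerA mulVf ?scale1r.
have EE : E *m E = E by rewrite {1}/E -scalemxAl -mulmxA wE.
have adjK : adj (adj w) = w by rewrite /adj conjm_tr trmxK conjmK.
have adjE : adj E = E.
  by rewrite /E adjZ adj_mul adjK conjc_inv sJ.
have EP : E *m coefmx P 0 = 0 by rewrite /E -scalemxAl -mulmxA wP mulmx0 scaler0.
clearbody E; pose F : 'M[{poly C}]_7 := map_mx polyC E.
have FF : F *m F = F by rewrite /F -map_mxM EE.
pose Q : 'M[{poly C}]_7 := map_mx (drop_poly 1) (F *m P).
have QE : F *m P = 'X *: Q.
  apply/matrixP => i j; rewrite !mxE mulrC -['X]expr1; apply: poly_low_coef0.
  move=> [|//] _; have /matrixP/(_ i j) := EP; rewrite !mxE => e0.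
  by rewrite coef_sum -[RHS]e0; apply: eq_bigr => k _; rewrite !mxE coefCM.
have FQ : F *m Q = Q.
  have : 'X *: (F *m Q) = 'X *: Q by rewrite scalemxAr -QE mulmxA FF.
  move=> /matrixP H; apply/matrixP => i j; have := H i j; rewrite !mxE.
  by apply: mulfI; rewrite polyX_eq0.
pose U : 'M[{poly C}]_7 := 1%:M + ('X - 1) *: F.
have UE z : mxev U z = 1%:M + (lam z - 1) *: E.
  apply/matrixP => i j; rewrite !mxE /horner_eval hornerD hornerM !hornerE.
  by rewrite -polyCMn hornerC.
exists U, (P - F *m P + Q); split.
- rewrite /U mulmxDl mul1mx -scalemxAl mulmxDr mulmxBr mulmxA FF subrr add0r FQ.
  by rewrite scalerBl scale1r -QE -addrA [Q + _]addrC subrK subrK.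
- move=> z; rewrite UE /adj.
  have -> : (conjm (1%:M + (lam z - 1) *: E))^T = 1%:M + (conjc (lam z) - 1) *: E.
    rewrite -[in RHS]adjE; apply/matrixP => i j; rewrite !mxE rmorphD rmorph_nat.
    by rewrite rmorphM rmorphB rmorph1 eq_sym.
  rewrite mulmxDl mul1mx mulmxDr mulmx1 -scalemxAl -scalemxAr EE scalerA.
  rewrite -addrA -!scalerDl -[RHS]addr0; congr (_ + _).
  have -> : lam z - 1 + (conjc (lam z) - 1 + (conjc (lam z) - 1) * (lam z - 1)) =
            lam z * conjc (lam z) - 1 by ring.
  by rewrite lam_mulJ subrr scale0r.
- by rewrite UE lam_expi0 subrr scale0r addr0.
- rewrite /root -[_.[0]]/(horner_eval 0 (\det U)) -det_map_mx; apply/det0P.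
  exists w => //.
  have -> : map_mx (horner_eval 0) U = 1%:M - E.
    apply/matrixP => i j; rewrite !mxE /horner_eval hornerD hornerM !hornerE.
    by rewrite -polyCMn hornerC mulN1r.
  by rewrite mulmxBr mulmx1 wE subrr.
Qed.

Lemma unitmx_det_dvdXn M (P : 'M[{poly C}]_7) :
  \det P %| 'X^M -> ~~ root (\det P) 0 -> P \in unitmx.
Proof.
move=> dP r0; rewrite unitmxE poly_unitE.
have cp : coprimep (\det P) 'X^M by rewrite coprimep_expr // coprimepX.
have := coprimep_dvdr (dvdpp _) cp; rewrite /=.
move=> /coprimepP /(_ (\det P) (dvdpp _) dP); rewrite -size_poly_eq1 => sz.
rewrite sz /=; move/size_poly1P: sz => [c c0 ->].
by rewrite coefC /= unitfE.
Qed.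

(** Birkhoff-type factorization of a polynomial loop that is invertible away from
    the origin, by induction on the order of vanishing of its determinant. *)
Lemma unitary_factorization M (P : 'M[{poly C}]_7) : \det P %| 'X^M ->
  exists U V : 'M[{poly C}]_7, [/\ P = U *m V,
    forall z, adj (mxev U z) *m mxev U z = 1%:M, mxev U (expi 0) = 1%:M &
    V \in unitmx].
Proof.
elim: M P => [|M IH] P dP.
  exists 1%:M, P; split; first by rewrite mul1mx.
  - by move=> z; rewrite !mxev1 /adj /conjm map_mx1 trmx1 mul1mx.
  - exact: mxev1.
  apply: (unitmx_det_dvdXn dP); apply/negP => /factor_theorem [q E].
  move: dP; rewrite E expr0 => /(dvdp_trans (dvdp_mulIr _ _)).
  by rewrite dvdp1 size_XsubC.
have [r0|r0] := boolP (root (\det P) 0); last first.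
  exists 1%:M, P; split; first by rewrite mul1mx.
  - by move=> z; rewrite !mxev1 /adj /conjm map_mx1 trmx1 mul1mx.
  - exact: mxev1.
  exact: (unitmx_det_dvdXn dP).
have d0 : \det (coefmx P 0) = 0.
  have -> : coefmx P 0 = map_mx (horner_eval 0) P.
    by apply/matrixP => i j; rewrite !mxE /horner_eval horner_coef0.
  by rewrite det_map_mx; apply/eqP.
have [U [P' [PE Uu U1 rU]]] := uniton_factor d0.
have dP' : \det P' %| 'X^M.
  have /factor_theorem [q qE] := rU.
  have : 'X * \det P' %| 'X * 'X^M.
    rewrite -exprS; apply: dvdp_trans dP.
    by rewrite PE det_mulmx qE subr0 -mulrA dvdp_mull.
  by rewrite dvdp_mul2l // polyX_eq0.
have [U' [V [PE' Uu' U1' Vu]]] := IH _ dP'.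
exists (U *m U'), V; split=> //; first by rewrite -mulmxA -PE'.
- move=> z; rewrite mxev_mul adj_mul mulmxA -(mulmxA (adj _)) Uu mulmx1.
  exact: Uu'.
- by rewrite mxev_mul U1 U1' mulmx1.
Qed.

Lemma mxev_conj_const m n (P Q : 'M[{poly C}]_(m, n)) :
  (forall z, conjm (mxev P z) = mxev Q z) -> forall z z', mxev P z = mxev P z'.
Proof.
move=> H z z'; apply/matrixP => i j; rewrite !mxE /horner_eval.
have [|c ->] := @poly_circle_conj_const R (P i j) (Q i j); last by rewrite !hornerC.
by move=> w; have /matrixP/(_ i j) := H w; rewrite !mxE.
Qed.

Lemma mxev_cross (u v : 'cV[{poly C}]_7) z :
  mxev (cross u v) z = cross (mxev u z) (mxev v z).
Proof. exact: (map_cross (horner_eval (lam z))). Qed.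

(** A unitary loop in G_2^C up to a holomorphic factor takes values in G_2: the
    loops that measure the failure of its being real and of preserving the
    product are at the same time holomorphic and antiholomorphic, hence equal to
    their value at 1. *)
Lemma unitary_factor_G2 (g u : loop R) (V : 'M[{poly C}]_7) :
  (forall z, G2mat (g z)) -> (forall z, g z = u z *m mxev V z) ->
  (forall z, adj (u z) *m u z = 1%:M) -> u (expi 0) = 1%:M -> V \in unitmx ->
  forall z, G2mat (u z) /\ conjm (u z) = u z.
Proof.
move=> gG gE uu u1 Vu.
pose W := invmx V.
have VW z : mxev V z *m mxev W z = 1%:M by rewrite -mxev_mul mulmxV // mxev1.
have uE z : u z = g z *m mxev W z by rewrite gE -mulmxA VW mulmx1.
have uu' z : u z *m adj (u z) = 1%:M := mulmx1C (uu z).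
have ME z : (u z)^T *m u z = mxev (W^T *m W) z.
  rewrite mxev_mul mxev_tr uE trmx_mul mulmxA -(mulmxA _ (g z)^T).
  by rewrite (gG z).1 mulmx1.
have MJ z : conjm (mxev (W^T *m W) z) = mxev (V *m V^T) z.
  rewrite -ME conjm_mul.
  have MI : mxev (W^T *m W) z *m mxev (V *m V^T) z = 1%:M.
    rewrite -mxev_mul !mulmxA -(mulmxA W^T) mulVmx // mulmx1 -trmx_mul mulmxV //.
    by rewrite trmx1 mxev1.
  have MI' : mxev (W^T *m W) z *m (conjm (u z)^T *m conjm (u z)) = 1%:M.
    have cu : conjm (u z) = (adj (u z))^T by rewrite /adj trmxK.
    rewrite -ME conjm_tr cu trmxK mulmxA -(mulmxA _ (u z)) uu' mulmx1 -trmx_mul uu trmx1 //.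
  by rewrite -[RHS]mul1mx -(mulmx1C MI') -mulmxA MI mulmx1.
have utu z : (u z)^T *m u z = 1%:M.
  by rewrite ME (mxev_conj_const MJ z (expi 0)) -ME u1 trmx1 mul1mx.
have adjT z : adj (u z) = (u z)^T.
  by rewrite -[LHS]mul1mx -(utu z) -mulmxA uu' mulmx1.
have ureal z : conjm (u z) = u z.
  by rewrite -[RHS]trmxK -adjT /adj trmxK.
move=> z; split=> //; split=> //.
apply: cross_basis => i j.
pose e k : 'cV[{poly C}]_7 := delta_mx k ord0.
have eE k w : mxev (e k) w = delta_mx k ord0.
  exact: (map_delta (horner_eval (lam w))).
pose p := V *m cross (W *m e i) (W *m e j).
have pE w : mxev p w =
    (u w)^T *m cross (u w *m delta_mx i ord0) (u w *m delta_mx j ord0).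
  rewrite !uE -!mulmxA -(gG w).2 -(eE i w) -(eE j w) -!mxev_mul -mxev_cross.
  have -> : (g w *m mxev W w)^T = mxev V w *m (g w)^T.
    rewrite -uE -adjT; have := congr1 (mulmx (adj (u w))) (gE w).
    rewrite mulmxA uu mul1mx => <-; rewrite -mulmxA.
    by rewrite (mulmx1C (gG w).1) mulmx1.
  by rewrite -mulmxA (mulmxA (g w)^T) (gG w).1 mul1mx /p mxev_mul.
have pJ w : conjm (mxev p w) = mxev p w.
  rewrite pE conjm_mul conjm_tr ureal; congr (_ *m _).
  rewrite /conjm (map_cross (@conjc R)) -/(conjm _) -/(conjm _) !conjm_mul ureal.
  by rewrite /conjm !(map_delta (@conjc R)).
have p1 : mxev p z = cross (delta_mx i ord0) (delta_mx j ord0).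
  by rewrite (mxev_conj_const pJ z (expi 0)) pE u1 trmx1 !mul1mx.
by rewrite -p1 pE mulmxA (mulmx1C (utu z)) mul1mx.
Qed.

End Iwasawa.

(** * Algebraic loops in G_2 *)

Section AlgebraicLoops.
Variable R : realType.
Local Notation C := R[i].
Implicit Types (z : circle R) (g h b : loop R) (f : cfun R).

Lemma G2mat_inv (A : 'M[C]_7) : G2mat A -> A^-1 = A^T.
Proof.
move=> [A1 _]; have [_ uA] := mulmx1_unit A1.
rewrite -[LHS]mul1r -[1]/(1%:M : 'M[C]_7) -A1 -[_ *m _]/(A^T * A).
by rewrite mulrK.
Qed.

Lemma OmegaAlgP g : OmegaAlg g <->
  [/\ forall z, G2mat (g z) /\ conjm (g z) = g z, finite_fourier g &
      g (expi 0) = 1%:M].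
Proof.
split=> [[[gG _ g1] gf _]|[gG gf g1]].
  by split=> // z; apply/toC_G2P.
split=> //; first split=> //.
- by move=> z; apply/toC_G2P.
- exact: finite_fourier_smooth.
have /finite_fourierP [n [P HP]] := gf.
apply/finite_fourierP; exists n, P^T => z.
rewrite /loop_inv G2mat_inv; last by case: (gG z).
by rewrite HP mxev_tr linearZ.
Qed.

Lemma OmegaAlg_quot g h : OmegaAlg g -> OmegaAlg h ->
  OmegaAlg (fun z => (g z)^-1 * h z).
Proof.
move=> Og /OmegaAlgP [hG hf h1]; have [_ _ gif] := Og.
have /OmegaAlgP [gG _ g1] := Og; apply/OmegaAlgP; split.
- move=> z; have [g2 gr] := gG z; have [h2 hr] := hG z.
  rewrite G2mat_inv // -[_ * _]/(_ *m _); split; first exact: G2matM (G2matT g2) h2.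
  by rewrite conjm_mul conjm_tr gr hr.
- exact: finite_fourier_mul gif hf.
- by rewrite g1 h1 mulr1 invr1.
Qed.

(** Iwasawa decomposition.  After multiplication by a power of lam the loop is
    polynomial and its determinant divides a power of lam; the unitary
    factorization of this polynomial loop gives both factors. *)
Lemma iwasawa g : (forall z, G2mat (g z)) -> finite_fourier g ->
  exists u (V : 'M[{poly C}]_7), [/\ OmegaAlg u, V \in unitmx &
    forall z, g z = u z *m mxev V z].
Proof.
move=> gG /finite_fourierP [n [P HP]].
have PP : P^T *m P = ('X^(n + n))%:M.
  apply: mxev_inj => z; rewrite mxev_mul mxev_tr.
  have PE : mxev P z = lam z ^+ n *: g z.
    by rewrite HP scalerA divff ?scale1r // expf_neq0 // lam_neq0.
  rewrite PE [(_ *: _)^T]linearZ /= -scalemxAl -scalemxAr (gG z).1 scalerA -exprD.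
  apply/matrixP => i j; rewrite !mxE /horner_eval.
  by case: (i == j); rewrite ?mulr1n ?mulr0n ?hornerXn ?horner0 ?mulr1 ?mulr0.
have dP : \det P %| 'X^((n + n) * 7).
  have := congr1 determinant PP; rewrite det_mulmx det_tr det_scalar -exprM => <-.
  exact: dvdp_mulr.
have [U [V [PE Uu U1 Vu]]] := unitary_factorization dP.
pose u : loop R := fun z => lam z ^- n *: mxev U z.
have gE z : g z = u z *m mxev V z by rewrite HP PE mxev_mul -scalemxAl.
have uu z : adj (u z) *m u z = 1%:M.
  rewrite /u adjZ -scalemxAl -scalemxAr Uu scalerA.
  rewrite fmorphV rmorphXn /= conj_lam exprVn invrK divff ?scale1r //.
  by rewrite expf_neq0 // lam_neq0.
have u1 : u (expi 0) = 1%:M.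
  by rewrite /u U1 lam_expi0 expr1n invr1 scale1r.
exists u, V; split=> //; apply/OmegaAlgP; split=> //.
- exact: unitary_factor_G2 gG gE uu u1 Vu.
- exact: finite_fourier_ev.
Qed.

Lemma mulWE g (W : set (cfun R)) f : W f -> mulW g W (fun z => g z *m f z).
Proof. by move=> Wf; exists f. Qed.

Lemma mulW_comp g h (W : set (cfun R)) :
  mulW g (mulW h W) = mulW (fun z => g z *m h z) W.
Proof.
apply/seteqP; split=> [_ [_ [f Wf <-] <-]|_ [f Wf <-]].
  by exists f => //; apply/funext => z; rewrite mulmxA.
by exists (fun z => h z *m f z); [exists f | apply/funext => z; rewrite mulmxA].
Qed.

Lemma mulW_mxev (V : 'M[{poly C}]_7) : V \in unitmx ->
  mulW (mxev V) (@Hplus R) = @Hplus R.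
Proof.
move=> Vu; apply/seteqP; split=> [_ [f Hf <-]|f Hf]; first exact: Hplus_mxev.
exists (fun z => mxev (invmx V) z *m f z); first exact: Hplus_mxev.
by apply/funext => z; rewrite mulmxA -mxev_mul mulmxV // mxev1 mul1mx.
Qed.

Lemma mulW_quot g h (W W' : set (cfun R)) : (forall z, G2mat (g z)) ->
  mulW h W `<=` mulW g W' -> mulW (fun z => (g z)^-1 * h z) W `<=` W'.
Proof.
move=> gG H _ [f Wf <-].
have [f' Wf' E] := H _ (mulWE h Wf).
have -> // : (fun z => ((g z)^-1 * h z) *m f z) = f'.
apply/funext => z; have := congr1 (fun k => (g z)^T *m k z) E.
rewrite mulmxA (gG z).1 mul1mx => ->.
by rewrite G2mat_inv // -[_ * h z]/(_ *m h z) mulmxA.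
Qed.

(** The Fourier coefficients of a real loop are symmetric, so that a bound from
    below on the powers of lam is also a bound from above. *)
Lemma real_loop_laurent b m : OmegaAlg b ->
  mulW b (@Hplus R) `<=` shiftW (- m%:Z) (@Hplus R) ->
  exists Q : 'M[{poly C}]_7, poly_over_lam b m Q /\
    forall i j k, (Q i j)`_k =
      if (k <= 2 * m)%N then conjc (Q i j)`_(2 * m - k) else 0.
Proof.
move=> /OmegaAlgP [bG /finite_fourierP [n [P HP]] b1] bH.
pose Q : 'M[{poly C}]_7 := map_mx (drop_poly n) ('X^m *: P).
have PQ : 'X^m *: P = 'X^n *: Q.
  apply/matrixP => i j; rewrite [RHS]mxE [in RHS]mxE mulrC.
  apply: poly_low_coef0 => k kn.
  have H1 : Hplus (fun z : circle R => delta_mx j ord0 : 'cV[C]_7).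
    have := Hplus_mxev_cV (delta_mx j ord0 : 'cV[{poly C}]_7).
    by congr Hplus; apply/funext => z; exact: (map_delta (horner_eval (lam z))).
  have [f Hf fE] := bH _ (mulWE b H1).
  have := @Hplus_low_coef0 R n (('X^m *: P) *m delta_mx j ord0).
  have -> : (fun z => lam z ^- n *: mxev (('X^m *: P) *m delta_mx j ord0) z) = f.
    apply/funext => z; have := congr1 (fun k => lam z ^+ m *: k z) fE.
    rewrite scalerA -exprnN mulfV ?expf_neq0 ?lam_neq0 // scale1r => ->.
    rewrite mxev_mul mxev_scale hornerXn HP -!scalemxAl !scalerA mulrC.
    by congr (_ *: (_ *m _)); exact: (map_delta (horner_eval (lam z))).
  move=> /(_ Hf i k kn).
  by rewrite -colE [in X in X -> _]mxE.
have bE : poly_over_lam b m Q.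
  move=> z; rewrite HP; have := congr1 (fun X => mxev X z) PQ.
  rewrite !mxev_scale !hornerXn => E.
  have l0 k : lam z ^+ k != 0 by rewrite expf_neq0 // lam_neq0.
  have -> : mxev P z = lam z ^- m *: (lam z ^+ n *: mxev Q z).
    by rewrite -E scalerA mulVf // scale1r.
  by rewrite !scalerA mulrAC mulVf // mul1r.
clear PQ; clearbody Q; exists Q; split=> // i j k.
pose d := size (Q i j).
have H z : lam z ^+ (2 * m + d) * conjc (Q i j).[lam z] = ('X^d * Q i j).[lam z].
  have [_ /matrixP/(_ i j)] := bG z; rewrite bE !mxE /horner_eval => E.
  have l0 p : lam z ^+ p != 0 by rewrite expf_neq0 // lam_neq0.
  move: E; rewrite rmorphM fmorphV rmorphXn /= conj_lam exprVn invrK => E.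
  rewrite hornerM hornerXn; set q := (Q i j).[lam z] in E *.
  transitivity (lam z ^+ d * (lam z ^+ m * (lam z ^+ m * conjc q))).
    rewrite exprD mul2n -addnn exprD; move: (conjc q) => q'.
    by rewrite [_ * lam z ^+ d]mulrC -!mulrA.
  by rewrite E mulVKf.
have sQ : (size (Q i j) <= (2 * m + d).+1)%N by rewrite /d; lia.
have := poly_circle_conj sQ H => /(congr1 (fun p : {poly C} => p`_(d + k))).
rewrite coefXnM ltnNge leq_addr /= addKn coef_poly => ->.
rewrite ltnS [(2 * m + d)%N]addnC leq_add2l subnDl.
by case: ifP.
Qed.

End AlgebraicLoops.

(** * Degrees of loops and sums of shifts of H_+ *)

Section LoopsInOmegaM.
Variable R : realType.
Local Notation C := R[i].
Implicit Types (z : circle R) (g h b : loop R) (f : cfun R).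

Lemma shiftW0 (W : set (cfun R)) : shiftW 0 W = W.
Proof.
apply/seteqP; split=> [_ [f Wf <-]|f Wf].
  have -> // : (fun z => lam z ^ 0 *: f z) = f.
  by apply/funext => z; rewrite expr0z scale1r.
by exists f => //; apply/funext => z; rewrite expr0z scale1r.
Qed.

(** The loop has no negative powers of lam, and by reality no positive ones. *)
Lemma OmegaAlg_Hplus_const b : OmegaAlg b ->
  mulW b (@Hplus R) `<=` @Hplus R -> forall z, b z = 1%:M.
Proof.
move=> Ob; rewrite -{2}(shiftW0 (@Hplus R)) => bH.
have [Q [bE Qc]] := real_loop_laurent (m := 0) Ob bH.
have /OmegaAlgP [_ _ b1] := Ob.
have sQ i j : (size (Q i j) <= 1)%N.
  by apply/leq_sizeP => k k0; rewrite Qc leqNgt k0.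
move=> z; rewrite -b1 !bE; apply/matrixP => i j; rewrite !mxE !expr0 !invr1 !mul1r.
by rewrite (size1_polyC (sQ i j)) /horner_eval !hornerC.
Qed.

(** The quotient of the two loops preserves H_+, hence is constant. *)
Lemma OmegaAlg_inj g h : OmegaAlg g -> OmegaAlg h ->
  mulW h (@Hplus R) `<=` mulW g (@Hplus R) -> h = g.
Proof.
move=> Og Oh H; have /OmegaAlgP [gG _ _] := Og.
have gG' z : G2mat (g z) by case: (gG z).
have Hb := mulW_quot gG' H.
have b1 := OmegaAlg_Hplus_const (OmegaAlg_quot Og Oh) Hb.
apply/funext => z; have := congr1 (mulmx (g z)) (b1 z).
have ug : g z \is a GRing.unit by case: (mulmx1_unit (gG' z).1).
by rewrite mulmx1 -[_ *m _]/(g z * ((g z)^-1 * h z)) mulVKr.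
Qed.

(** Reality makes the loop a Laurent polynomial of degree at most m.+1; if the
    top coefficient were zero, so would be the bottom one, and the loop would
    map H_+ into lam^(-m) H_+. *)
Lemma OmegaM_intro b m : OmegaAlg b ->
  mulW b (@Hplus R) `<=` shiftW (- m.+1%:Z) (@Hplus R) ->
  ~ (mulW b (@Hplus R) `<=` shiftW (- m%:Z) (@Hplus R)) ->
  OmegaM m.+1 b.
Proof.
move=> Ob bH nbH; have [Q [bE Qc]] := real_loop_laurent Ob bH.
split=> //; exists (fun j => coefmx Q (absz (j + m.+1%:Z))); split.
  rewrite -laurent_coefmx; first by apply/funext => z; exact: bE.
  by move=> i j; apply/leq_sizeP => k k0; rewrite Qc leqNgt k0.
apply/eqP => top0; apply: nbH => _ [f Hf <-].
have low0 i j : (Q i j)`_0 = 0.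
  rewrite Qc /= subn0 mul2n -addnn.
  have /matrixP/(_ i j) := top0; rewrite !mxE => ->.
  by rewrite rmorph0.
pose Q' : 'M[{poly C}]_7 := map_mx (drop_poly 1) Q.
have QE : Q = 'X *: Q'.
  apply/matrixP => i j; rewrite !mxE mulrC -['X]expr1; apply: poly_low_coef0.
  by move=> [|//] _; exact: low0.
exists (fun z => mxev Q' z *m f z); first exact: Hplus_mxev.
apply/funext => z; rewrite bE QE mxev_scale hornerX !scalemxAl scalerA.
by rewrite -exprnN exprS invfM mulrAC mulVf ?mul1r // lam_neq0.
Qed.

End LoopsInOmegaM.

Section WeightedSpaces.
Variable R : realType.
Local Notation C := R[i].
Implicit Types (z : circle R) (f : cfun R) (c d : 'I_7 -> int).

Definition comp_at f a (n : int) : cfun R :=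
  fun z => (lam z ^ n * f z a ord0) *: delta_mx a ord0.

(** The direct sum of the lam^(c a) H_+ e_a. *)
Definition weightW c : set (cfun R) :=
  [set f | forall a, Hplus (comp_at f a (- c a))].

Lemma comp_at_mono f a (n m : int) : n <= m ->
  Hplus (comp_at f a n) -> Hplus (comp_at f a m).
Proof.
move=> nm Hn; pose k := absz (m - n).
have kE : m = k%:Z + n by rewrite /k gez0_abs ?subr_ge0 // subrK.
have := Hplus_mul k 1%:M Hn; congr Hplus; apply/funext => z.
by rewrite /comp_at mul1mx scalerA kE expfzDr ?lam_neq0 // mulrA.
Qed.

Lemma weightW_mono c d : (forall a, d a <= c a) -> weightW c `<=` weightW d.
Proof. by move=> H f Hf a; apply: comp_at_mono (Hf a); rewrite lerN2. Qed.

(** On direct sums of shifts of H_+ in a common basis, intersections, shifts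
    and sums act on the exponents as maxima, translations and minima. *)
Lemma weightW_cap c (n : int) :
  weightW c `&` weightW (fun=> n) = weightW (fun a => Num.max (c a) n).
Proof.
apply/seteqP; split=> [f [fc fn] a|f Hf].
  by case: (leP (c a) n) => _; [exact: fn | exact: fc].
by split; apply: weightW_mono Hf => a; rewrite le_max lexx ?orbT.
Qed.

Lemma weightW_shift n c : shiftW n (weightW c) = weightW (fun a => c a + n).
Proof.
have l0 z k : lam z ^ k != 0 by rewrite expfz_neq0 // lam_neq0.
apply/seteqP; split=> [_ [f Hf <-] a|f Hf].
  have := Hf a; congr Hplus; apply/funext => z; rewrite /comp_at mxE mulrA.
  by rewrite -expfzDr ?lam_neq0 // opprD subrK.
exists (fun z => lam z ^ (- n) *: f z).
  move=> a; have := Hf a; congr Hplus; apply/funext => z; rewrite /comp_at mxE mulrA.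
  by rewrite -expfzDr ?lam_neq0 // opprD.
apply/funext => z; rewrite scalerA -expfzDr ?lam_neq0 // subrr expr0z scale1r //.
Qed.

Lemma comp_at_sum f z : f z = \sum_a comp_at f a 0 z.
Proof. by rewrite [LHS]colE_sum; apply: eq_bigr => a _; rewrite /comp_at expr0z mul1r. Qed.

Lemma weightW_Hplus : weightW (fun=> 0) = @Hplus R.
Proof.
apply/seteqP; split=> f Hf.
  have -> : f = fun z => \sum_a comp_at f a 0 z by apply/funext => z; exact: comp_at_sum.
  apply: fun_sum_ind; [exact: Hplus0|exact: Hplus_add|] => a.
  by have := Hf a; rewrite oppr0.
move=> a; have := Hplus_mul 0 (delta_mx a a) Hf; congr Hplus; apply/funext => z.
rewrite /comp_at oppr0 expr0z mul1r expr0 scale1r.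
apply/colP => i; rewrite !mxE (bigD1 a) //= big1 => [|j ja].
  by rewrite !mxE !eqxx !andbT addr0 mulrC.
by rewrite mxE (negbTE ja) andbF mul0r.
Qed.

Lemma weightW_add c d :
  addW (weightW c) (weightW d) = weightW (fun a => Num.min (c a) (d a)).
Proof.
apply/seteqP; split=> [_ [f [g [Hf Hg ->]]] a|f Hf].
  have Hf' : weightW (fun a => Num.min (c a) (d a)) f.
    by apply: weightW_mono Hf => b; rewrite ge_min lexx.
  have Hg' : weightW (fun a => Num.min (c a) (d a)) g.
    by apply: weightW_mono Hg => b; rewrite ge_min lexx orbT.
  have := Hplus_add (Hf' a) (Hg' a); congr Hplus; apply/funext => z.
  by rewrite /comp_at mxE mulrDr scalerDl.
pose sel (P : pred 'I_7) : cfun R := fun z => \col_a (if P a then f z a ord0 else 0).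
have selH (P : pred 'I_7) e : (forall a, P a -> Num.min (c a) (d a) = e a) ->
    weightW e (sel P).
  move=> H a; case: (boolP (P a)) => Pa.
    have := Hf a; rewrite (H a Pa); congr Hplus; apply/funext => z.
    by rewrite /comp_at mxE Pa.
  have := Hplus0 R; congr Hplus; apply/funext => z.
  by rewrite /comp_at mxE (negbTE Pa) mulr0 scale0r.
exists (sel (fun a => c a <= d a)), (sel (fun a => ~~ (c a <= d a))); split.
- by apply: selH => a; rewrite minEle => ->.
- by apply: selH => a; rewrite minEle => /negbTE ->.
apply/funext => z; apply/colP => a; rewrite !mxE.
by case: (c a <= d a); rewrite ?addr0 ?add0r.
Qed.

Definition diagloop c : loop R := fun z => diag_mx (\row_a lam z ^ c a).

Lemma diagloop_Hplus c : mulW (diagloop c) (@Hplus R) = weightW c.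
Proof.
have dE (e : 'I_7 -> int) z (v : 'cV[C]_7) a :
    (diagloop e z *m v) a ord0 = lam z ^ e a * v a ord0.
  by rewrite mul_diag_mx !mxE.
apply/seteqP; split=> [_ [f Hf <-] a|f Hf].
  have Hf' : weightW (fun=> 0) f by rewrite weightW_Hplus.
  have := Hf' a; congr Hplus; apply/funext => z.
  by rewrite /comp_at dE mulrA -expfzDr ?lam_neq0 // addNr oppr0.
exists (fun z => diagloop (fun a => - c a) z *m f z).
  rewrite -weightW_Hplus => a; have := Hf a; congr Hplus; apply/funext => z.
  by rewrite /comp_at dE oppr0 expr0z mul1r.
apply/funext => z; apply/colP => a; rewrite !dE mulrA -expfzDr ?lam_neq0 //.
by rewrite subrr expr0z mul1r.
Qed.

Lemma weightW_le c d : weightW c `<=` weightW d -> forall a, d a <= c a.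
Proof.
move=> H a; rewrite leNgt; apply/negP => cd.
pose f : cfun R := fun z => lam z ^ c a *: delta_mx a ord0.
have Hf : weightW c f.
  move=> b; have [->|ba] := eqVneq b a.
    have := Hplus_mxev_cV (delta_mx a ord0 : 'cV[{poly C}]_7).
    congr Hplus; apply/funext => z; rewrite /comp_at mxE mxE !eqxx mulr1.
    rewrite -expfzDr ?lam_neq0 // addNr expr0z scale1r.
    exact: (map_delta (horner_eval (lam z))).
  have := Hplus0 R; congr Hplus; apply/funext => z.
  by rewrite /comp_at mxE mxE (negbTE ba) !mulr0 scale0r.
have := H f Hf a; pose n := absz (d a - c a).
have nE : c a - d a = - n%:Z by rewrite /n gtz0_abs ?subr_gt0 // opprB.
have n0 : (0 < n)%N by rewrite absz_gt0 subr_eq0 gt_eqF.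
move=> Hc; have := @Hplus_low_coef0 R n (delta_mx a ord0) _ a 0%N n0.
rewrite !mxE !eqxx coef1 /= => /(_ _)/eqP; rewrite oner_eq0 => F.
suff : false by []; apply: F; move: Hc; congr Hplus; apply/funext => z.
rewrite /comp_at mxE mxE !eqxx mulr1 -expfzDr ?lam_neq0 // addrC nE exprnN.
by congr (_ *: _); apply/esym; exact: (map_delta (horner_eval (lam z))).
Qed.

End WeightedSpaces.

(** * Frames and the maps between the sets U_xi *)

Section Frames.
Variable R : realType.
Local Notation C := R[i].
Local Notation Hp := (@Hplus R).
Implicit Types (z : circle R) (M g h : loop R) (c d : 'I_7 -> int).

(** An invertible loop that preserves H_+, such as a holomorphic loop in the
    group followed by a constant change of basis. *)
Definition hardy_frame M : Prop :=
  (forall z, M z \in unitmx) /\ mulW M Hp = Hp.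

(** The subspaces that are direct sums of the lam^(c a) H_+ v_a, where the v_a
    are the columns of the frame M. *)
Definition frameW M c : set (cfun R) := mulW M (weightW c).

Lemma mulW_shift M n (W : set (cfun R)) :
  mulW M (shiftW n W) = shiftW n (mulW M W).
Proof.
apply/seteqP; split=> [_ [_ [f Wf <-] <-]|_ [_ [f Wf <-] <-]].
  by exists (fun z => M z *m f z); [exists f | apply/funext => z; rewrite scalemxAr].
by exists (fun z => lam z ^ n *: f z); [exists f | apply/funext => z; rewrite scalemxAr].
Qed.

Lemma mulW_mono M (V W : set (cfun R)) : V `<=` W -> mulW M V `<=` mulW M W.
Proof. by move=> VW _ [f Vf <-]; exists f => //; exact: VW. Qed.

Lemma mulW_add M (V W : set (cfun R)) :
  mulW M (addW V W) = addW (mulW M V) (mulW M W).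
Proof.
apply/seteqP; split=> [_ [_ [f [g [Vf Wg ->]]] <-]|].
  exists (fun z => M z *m f z), (fun z => M z *m g z).
  by split; [exists f | exists g | apply/funext => z; rewrite mulmxDr].
move=> _ [_ [_ [[f Vf <-] [g Wg <-] ->]]].
exists (fun z => f z + g z); last by apply/funext => z; rewrite mulmxDr.
by exists f, g.
Qed.

Variable M : loop R.
Hypothesis HM : hardy_frame M.

Lemma mulW_cancel (V W : set (cfun R)) : mulW M V `<=` mulW M W -> V `<=` W.
Proof.
move=> H f Vf; have [f' Wf' E] := H _ (mulWE M Vf).
have <- // : f' = f; apply/funext => z.
have := congr1 (fun k => invmx (M z) *m k z) E.
by rewrite !mulmxA mulVmx ?HM.1 // !mul1mx.
Qed.

Lemma mulW_cap (V W : set (cfun R)) :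
  mulW M (V `&` W) = mulW M V `&` mulW M W.
Proof.
apply/seteqP; split=> [_ [f [Vf Wf] <-]|_ [[f Vf <-] [f' Wf' E]]].
  by split; exists f.
exists f => //; split=> //.
have <- // : f' = f; apply/funext => z.
have := congr1 (fun k => invmx (M z) *m k z) E.
by rewrite !mulmxA mulVmx ?HM.1 // !mul1mx.
Qed.

Lemma frameW_Hplus n : shiftW n Hp = frameW M (fun=> n).
Proof.
rewrite -{1}HM.2 -mulW_shift -weightW_Hplus weightW_shift /frameW.
by congr (mulW _ (weightW _)); apply/funext => a; rewrite add0r.
Qed.

Lemma frameW_Hplus0 : Hp = frameW M (fun=> 0).
Proof. by rewrite -frameW_Hplus shiftW0. Qed.

Lemma frameW_cap c n :
  frameW M c `&` shiftW n Hp = frameW M (fun a => Num.max (c a) n).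
Proof. by rewrite frameW_Hplus -mulW_cap weightW_cap. Qed.

Lemma frameW_shift n c : shiftW n (frameW M c) = frameW M (fun a => c a + n).
Proof. by rewrite -mulW_shift weightW_shift. Qed.

Lemma frameW_add c d :
  addW (frameW M c) (frameW M d) = frameW M (fun a => Num.min (c a) (d a)).
Proof. by rewrite -mulW_add weightW_add. Qed.

Lemma frameW_mono c d : (forall a, d a <= c a) -> frameW M c `<=` frameW M d.
Proof. by move=> H; apply/mulW_mono/weightW_mono. Qed.

Lemma frameW_le c d : frameW M c `<=` frameW M d -> forall a, d a <= c a.
Proof. by move=> /mulW_cancel; exact: weightW_le. Qed.

(** A quotient of two loops that share a frame maps H_+ into lam^n H_+ exactly
    when the exponents of the second exceed those of the first by n at least. *)
Lemma frame_quot g h c d (n : int) : (forall z, G2mat (g z)) ->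
  mulW g Hp = frameW M c -> mulW h Hp = frameW M d ->
  mulW (fun z => (g z)^-1 * h z) Hp `<=` shiftW n Hp <-> forall a, c a + n <= d a.
Proof.
move=> gG gE hE.
have gsh : mulW g (shiftW n Hp) = frameW M (fun a => c a + n).
  rewrite (mulW_shift g n Hp) gE; exact: frameW_shift.
split=> [H|H].
  apply: frameW_le; rewrite -gsh -hE.
  have := mulW_mono (M := g) H; rewrite mulW_comp.
  congr (_ `<=` _); congr (mulW _ _); apply/funext => z.
  have ug : g z \is a GRing.unit by case: (mulmx1_unit (gG z).1).
  by rewrite -[_ *m _]/(g z * ((g z)^-1 * h z)) mulVKr.
apply: mulW_quot => //; rewrite gsh hE; exact: frameW_mono.
Qed.

End Frames.

Section Chain.
Variable R : realType.
Local Notation C := R[i].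
Local Notation Hp := (@Hplus R).
Implicit Types (z : circle R) (g h : loop R) (c d : 'I_7 -> int).

Lemma hardy_frame_LambdaPlus (Psi : loop R) (Q : 'M[C]_7) :
  LambdaPlusAlg Psi -> Q \in unitmx -> hardy_frame (fun z => Psi z *m Q).
Proof.
move=> /LambdaPlus_poly [P [PE PG PP]] Qu.
have Pu : P \in unitmx by case: (mulmx1_unit PP).
pose V := P *m map_mx polyC Q.
have Qu' : map_mx polyC Q \in unitmx.
  have : map_mx polyC (invmx Q) *m map_mx polyC Q = 1%:M.
    by rewrite -map_mxM mulVmx // map_mx1.
  by case/mulmx1_unit.
have VE : (fun z => Psi z *m Q) = mxev V.
  by apply/funext => z; rewrite mxev_mul mxev_cst PE.
have Vu : V \in unitmx by rewrite unitmx_mul Pu Qu'.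
split=> [z|]; last by rewrite VE; exact: mulW_mxev.
by rewrite unitmx_mul Qu PE andbT; case: (mulmx1_unit (PG z).1).
Qed.

(** The loop generated by X is diagonal in the basis of the columns of Q, with
    the integral weights c. *)
Definition loop_weights (Q : 'M[C]_7) (X : 'M[R]_7) c : Prop :=
  forall z, gammaL X z = Q *m diagloop c z *m invmx Q.

(** The constant matrix Q^-1 preserves H_+, so that only Psi, Q and the diagonal
    part of the loop remain. *)
Lemma gammaL_frameW Q X c (Psi : loop R) : Q \in unitmx -> loop_weights Q X c ->
  mulW Psi (mulW (gammaL X) Hp) = frameW (fun z => Psi z *m Q) c.
Proof.
move=> Qu wX; have Qi : mulW (fun=> invmx Q) Hp = Hp.
  have uP : map_mx polyC (invmx Q) \in unitmx.
    have : map_mx polyC Q *m map_mx polyC (invmx Q) = 1%:M.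
      by rewrite -map_mxM mulmxV // map_mx1.
    by case/mulmx1_unit.
  rewrite -{2}(mulW_mxev uP); congr (mulW _ _); apply/funext => z.
  by rewrite mxev_cst.
rewrite /frameW -diagloop_Hplus -{2}Qi !mulW_comp; congr (mulW _ _).
by apply/funext => z; rewrite wX !mulmxA.
Qed.

Lemma finite_fourier_diagloop c : @finite_fourier R (diagloop c).
Proof.
apply/finite_fourierP; pose n := (\max_a absz (c a))%N.
have cn a : 0 <= c a + n%:Z.
  have : (absz (c a) <= n)%N by exact: leq_bigmax.
  lia.
exists n, (diag_mx (\row_a 'X^(absz (c a + n%:Z)))) => z.
apply/matrixP => i j; rewrite !mxE /horner_eval hornerMn hornerXn mulrnAr.
congr (_ *+ _); have e : c i = - n%:Z + (absz (c i + n%:Z))%:Z.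
  by rewrite gez0_abs // addrC addrK.
by rewrite {1}e expfzDr ?lam_neq0 // -exprnN -exprnP.
Qed.

Lemma finite_fourier_weights Q X c : loop_weights Q X c -> finite_fourier (gammaL X).
Proof.
move=> wX; have -> : gammaL X = fun z => (Q * diagloop c z) * invmx Q.
  by apply/funext => z; rewrite wX.
have fc (A : 'M[C]_7) : @finite_fourier R (fun=> A).
  apply/finite_fourierP; exists 0%N, (map_mx polyC A) => z.
  by rewrite expr0 invr1 scale1r mxev_cst.
by do 2!apply: finite_fourier_mul => //; exact: finite_fourier_diagloop.
Qed.

Variables (Q : 'M[C]_7) (xi : 'M[R]_7) (c : 'I_7 -> int) (gamma : loop R).
Hypothesis Q_unit : Q \in unitmx.
Hypothesis xi_wt : loop_weights Q xi c.
Hypothesis gamma_U : Uset xi gamma.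
Local Notation W := (mulW gamma Hp).

(** The target loop exists: the Iwasawa decomposition of Psi gamma_xi' gives a
    based loop that generates the same subspace.  Whichever loop is chosen comes
    with a factor Psi for which both subspaces have the frame Psi Q. *)
Lemma Umap_spec (xi' : 'M[R]_7) c' :
  loop_weights Q xi' c' -> (forall z, G2mat (gammaL xi' z)) ->
  OmegaAlg (Umap xi xi' gamma) /\ exists M, [/\ hardy_frame M, W = frameW M c &
    mulW (Umap xi xi' gamma) Hp = frameW M c'].
Proof.
move=> w' G'; rewrite /Umap; case: xgetP => [g _ [[Og _] [Psi [LP WE gE]]]|noloop].
  split=> //; exists (fun z => Psi z *m Q).
  split; first exact: (hardy_frame_LambdaPlus LP Q_unit).
    by rewrite WE; exact: (gammaL_frameW _ Q_unit xi_wt).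
  by rewrite gE; exact: (gammaL_frameW _ Q_unit w').
exfalso; have [_ [Psi LP WE]] := gamma_U.
have [P [PE PG _]] := LambdaPlus_poly LP.
have [_ _ Pf _] := LP.
have [||u [V [Ou Vu uE]]] := @iwasawa R (fun z => Psi z *m gammaL xi' z).
- by move=> z; apply: G2matM => //; rewrite PE.
- have := finite_fourier_mul Pf (finite_fourier_weights w').
  by congr finite_fourier.
have uW : mulW u Hp = mulW Psi (mulW (gammaL xi') Hp).
  rewrite mulW_comp -{1}(mulW_mxev Vu) mulW_comp; congr (mulW _ _).
  by apply/funext => z; rewrite uE.
apply: (noloop u); split; first by split=> //; exists Psi.
by exists Psi.
Qed.

(** A formula E for the subspace of the target loop in terms of W need only be
    checked on exponents, uniformly in the frame.  In particular this subspace
    depends on W alone and not on the factor Psi. *)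
Lemma Umap_formula (E : set (cfun R) -> set (cfun R)) (xi' : 'M[R]_7) c' :
  loop_weights Q xi' c' -> (forall z, G2mat (gammaL xi' z)) ->
  (forall M, hardy_frame M -> E (frameW M c) = frameW M c') ->
  mulW (Umap xi xi' gamma) Hp = E W.
Proof.
move=> w' G' HE; have [_ [M [HM -> ->]]] := Umap_spec w' G'.
by rewrite HE.
Qed.

(** When the weights decrease by at most m.+1 in each step, and by m.+1
    somewhere, the quotients of successive loops lie in Omega^(m.+1).  The
    product telescopes from the constant loop, which has weights 0, to gamma.
    The formulas E put all the loops into one frame: Umap is specified through a
    factor Psi that may vary with the target. *)
Lemma chain_factorization (N m : nat) (xs : nat -> 'M[R]_7)
    (cs : nat -> 'I_7 -> int) :
  (forall r, (r <= N)%N -> loop_weights Q (xs r) (cs r)) ->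
  (forall r, (r <= N)%N -> forall z, G2mat (gammaL (xs r) z)) ->
  (forall r, (r <= N)%N -> exists E : set (cfun R) -> set (cfun R),
     forall M, hardy_frame M -> E (frameW M c) = frameW M (cs r)) ->
  cs 0%N = (fun=> 0) -> xs N = xi ->
  (forall r a, (r < N)%N -> cs r a - m.+1%:Z <= cs r.+1 a) ->
  (forall r, (r < N)%N -> exists a, cs r.+1 a < cs r a - m%:Z) ->
  factorization gamma (betas (fun r => Umap xi (xs r) gamma) N) (nseq N m.+1).
Proof.
move=> wxs Gxs HE c0 xsN step strict.
pose gs r := Umap xi (xs r) gamma; rewrite -/gs.
have Ogs r : (r <= N)%N -> OmegaAlg (gs r).
  by move=> rN; have [] := Umap_spec (wxs r rN) (Gxs r rN).
have [Ogam [Psi LP WE]] := gamma_U.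
pose M z := Psi z *m Q.
have HM : hardy_frame M := hardy_frame_LambdaPlus LP Q_unit.
have WM : W = frameW M c by rewrite WE (gammaL_frameW _ Q_unit xi_wt).
have Wgs r : (r <= N)%N -> mulW (gs r) Hp = frameW M (cs r).
  move=> rN; have [E EH] := HE r rN.
  by rewrite (Umap_formula (wxs r rN) (Gxs r rN) EH) WM; exact: EH.
have cN : frameW M (cs N) = frameW M c.
  have wN := wxs N (leqnn N); rewrite xsN in wN.
  rewrite -WM WE; apply/esym; exact: (gammaL_frameW _ Q_unit wN).
have gsN : gs N = gamma.
  by apply: (OmegaAlg_inj Ogam (Ogs N (leqnn N))); rewrite (Wgs N (leqnn N)) cN WM.
have gs0 z : gs 0%N z = 1%:M.
  apply: (OmegaAlg_Hplus_const (Ogs 0%N (leq0n N))).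
  rewrite (Wgs 0%N (leq0n N)) c0 -(frameW_Hplus0 HM); exact: subset_refl.
have Ggs r z : (r <= N)%N -> G2mat (gs r z).
  by move=> /Ogs /OmegaAlgP [H _ _]; case: (H z).
have ugs r z : (r <= N)%N -> gs r z \is a GRing.unit.
  by move=> /(Ggs r z) [/mulmx1_unit []].
split.
- by rewrite size_map size_iota size_nseq.
- apply/funext => z; rewrite /betas big_map.
  suff tele n : (n <= N)%N ->
      \prod_(r <- iota 1 n) ((gs r.-1 z)^-1 * gs r z) = (gs 0%N z)^-1 * gs n z.
    by rewrite (tele N (leqnn N)) gsN gs0 -[1%:M]/1 invr1 mul1r.
  elim: n => [|n IH] nN.
    by rewrite big_nil mulVr ?(ugs 0%N z (leq0n N)).
  have -> : iota 1 n.+1 = iota 1 n ++ [:: n.+1] by have := iotaD 1 n 1; rewrite addn1 add1n.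
  rewrite big_cat big_seq1 (IH (ltnW nN)) /=.
  by rewrite mulrA mulrK ?(ugs n z (ltnW nN)).
- move=> i; rewrite size_map size_iota => iN.
  have si : (i < size (iota 1 N))%N by rewrite size_iota.
  rewrite nth_nseq iN /betas (nth_map 0%N _ _ si) (nth_iota _ _ iN) add1n.
  have Ob := OmegaAlg_quot (Ogs i (ltnW iN)) (Ogs i.+1 iN).
  have qE := frame_quot HM (g := gs i) (h := gs i.+1) _
    (fun z => Ggs i z (ltnW iN)) (Wgs i (ltnW iN)) (Wgs i.+1 iN).
  apply: (OmegaM_intro Ob); first by apply/qE => a; exact: step.
  move=> /qE H; have [a Ha] := strict i iN.
  by have := H a; rewrite leNgt Ha.
Qed.

End Chain.

(** * One-parameter groups and parabolic subalgebras *)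

Section DiagonalExponential.
Variable R : realType.
Local Notation C := R[i].
Implicit Types (z : circle R) (X Y : 'M[R]_7) (c d : 'I_7 -> int).

Lemma toCE X i j : toC X i j = real_complex R (X i j).
Proof. by rewrite mxE. Qed.

Lemma toCM X Y : toC (X *m Y) = toC X *m toC Y.
Proof. exact: (map_mxM (real_complex R)). Qed.

Lemma toC1 : toC (1%:M : 'M[R]_7) = 1%:M.
Proof. exact: (map_mx1 (real_complex R)). Qed.

Lemma toCD X Y : toC (X + Y) = toC X + toC Y.
Proof. exact: (map_mxD (real_complex R)). Qed.

Lemma toCZ a X : toC (a *: X) = real_complex R a *: toC X.
Proof. exact: (map_mxZ (real_complex R)). Qed.

Definition idiag c : 'M[C]_7 := diag_mx (\row_a Complex 0 (c a)%:~R).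

(** X acts on the columns of Q by sqrt(-1) times the integers c. *)
Definition has_weights (Q : 'M[C]_7) X c : Prop := toC X *m Q = Q *m idiag c.

(** In the basis Q the entries of exp (s X) solve linear scalar equations, as
    do the powers of lam (expi s). *)
Lemma expm_weights Q X c : Q \in unitmx -> has_weights Q X c ->
  forall s, toC (expm (s *: X)) = Q *m diagloop c (expi s) *m invmx Q.
Proof.
move=> Qu XQ s.
have QX : invmx Q *m toC X = idiag c *m invmx Q.
  rewrite -[LHS]mulmx1 -(mulmxV Qu) !mulmxA -(mulmxA (invmx Q)) XQ.
  by rewrite mulmxA (mulVmx Qu) mul1mx.
pose psi t := invmx Q *m toC (expm (t *: X)) *m Q.
have dE t i j : cderive (fun s => toC (expm (s *: X)) i j) t
    (toC (X *m expm (t *: X)) i j).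
  split; first by apply: is_derive_eqf (expm_mderive X t i j) _ _ => [u|]; rewrite toCE.
  by apply: is_derive_eqf (is_derive_cst 0 t 1) _ _ => [u|]; rewrite toCE.
have dpsi t k l : cderive (fun s => psi s k l) t (Complex 0 (c k)%:~R * psi t k l).
  have := cderive_sum (fun j => cderiveM (cderive_sum (fun i =>
    cderiveZ (invmx Q k i) (dE t i j))) (cderive_cst (Q j l) t)).
  have -> : Complex 0 (c k)%:~R * psi t k l =
            (invmx Q *m toC (X *m expm (t *: X)) *m Q) k l.
    by rewrite toCM mulmxA QX /psi -!mulmxA /idiag mul_diag_mx [RHS]mxE [in RHS]mxE.
  congr (cderive _ _ _).
    apply/funext => u; rewrite /psi mxE; apply: eq_bigr => j _.
    by rewrite mxE.
  rewrite mxE; apply: eq_bigr => j _; rewrite mulr0 addr0.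
  by rewrite mxE.
have psi0 : psi 0 = 1%:M.
  by rewrite /psi scale0r expm0 toC1 mulmx1 (mulVmx Qu).
have psiE : psi s = diagloop c (expi s).
  apply/matrixP => k l.
  have h t : cderive (fun s => lam (expi s) ^ (- c k) * psi s k l) t 0.
    have := cderiveM (cderive_lamX (- c k) t) (dpsi t k l).
    congr (cderive _ _ _).
    have -> : Complex 0 (- c k)%:~R = - Complex 0 (c k)%:~R :> C.
      by rewrite mulrNz; apply: complex_eq; rewrite /= ?oppr0.
    by ring.
  have := cderive0_cst h s 0; rewrite psi0 lam_expi0 exp1rz mul1r => E.
  have l0 : lam (expi s) ^ c k != 0 by rewrite expfz_neq0 // lam_neq0.
  rewrite -[LHS]mul1r -(mulfV l0) invr_expz -mulrA E !mxE.
  by case: (k == l); rewrite ?mulr1 ?mulr0.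
by rewrite -psiE /psi !mulmxA (mulmxV Qu) mul1mx -mulmxA (mulmxV Qu) mulmx1.
Qed.

Lemma diagloop_mul c d z :
  diagloop c z *m diagloop d z = diagloop (fun a => c a + d a) z.
Proof.
rewrite /diagloop mulmx_diag; congr diag_mx; apply/rowP => a.
by rewrite !mxE expfzDr // lam_neq0.
Qed.

Lemma has_weights_loop Q X c : Q \in unitmx -> has_weights Q X c ->
  loop_weights Q X c.
Proof. by move=> Qu XQ z; rewrite /gammaL (expm_weights Qu XQ) expi_arg. Qed.

Lemma has_weights_eq Q X Y c : Q \in unitmx -> has_weights Q X c ->
  has_weights Q Y c -> X = Y.
Proof.
move=> Qu XQ YQ; apply: toC_inj.
by rewrite -[toC X](mulmxK Qu) -[toC Y](mulmxK Qu) XQ YQ.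
Qed.

Lemma lam_expi_2pi : lam (expi (2 * pi : R)) = 1.
Proof. by rewrite /lam /= [2 * pi]mulrC mulr_natr cos2pi sin2pi. Qed.

Lemma expm_2pi Q X c : Q \in unitmx -> has_weights Q X c ->
  expm ((2 * pi) *: X) = 1%:M.
Proof.
move=> Qu XQ; apply: toC_inj; rewrite (expm_weights Qu XQ) toC1.
have -> : diagloop c (expi (2 * pi : R)) = 1%:M.
  apply/matrixP => i j; rewrite !mxE lam_expi_2pi exp1rz.
  by case: (i == j); rewrite ?mulr1n ?mulr0n.
by rewrite mulmx1 (mulmxV Qu).
Qed.

Lemma Lie_scale (T : set 'M[R]_7) a X : Lie T X -> Lie T (a *: X).
Proof. by move=> TX s; rewrite scalerA; exact: TX. Qed.

(** Elements that are diagonal in a common basis have commuting exponentials,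
    so that the exponential of the sum is the product. *)
Lemma Lie_add (T : set 'M[R]_7) Q X Y c d : Q \in unitmx ->
  (forall A B, T A -> T B -> T (A * B)) ->
  has_weights Q X c -> has_weights Q Y d -> Lie T X -> Lie T Y -> Lie T (X + Y).
Proof.
move=> Qu TM XQ YQ TX TY s.
have XYQ : has_weights Q (X + Y) (fun a => c a + d a).
  rewrite /has_weights toCD mulmxDl XQ YQ -mulmxDr; congr (_ *m _).
  apply/matrixP => i j; rewrite !mxE rmorphD -mulrnDl; congr (_ *+ _).
  by apply: complex_eq; rewrite /= ?addr0.
have -> : expm (s *: (X + Y)) = expm (s *: X) *m expm (s *: Y).
  apply: toC_inj; rewrite toCM !(expm_weights Qu XQ, expm_weights Qu YQ, expm_weights Qu XYQ).
  by rewrite !mulmxA (mulmxKV Qu) -(mulmxA Q (diagloop c _)) diagloop_mul.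
exact: TM.
Qed.

End DiagonalExponential.

Section Parabolic.
Variable R : realType.
Local Notation C := R[i].
Implicit Types (z : circle R).

Lemma circle_sum0 m n N (A : nat -> 'M[C]_(m, n)) :
  (forall z : circle R, \sum_(k < N) lam z ^+ k *: A k = 0) ->
  forall k, (k < N)%N -> A k = 0.
Proof.
move=> H k kN; apply/matrixP => i j; rewrite [RHS]mxE.
pose p : {poly C} := \poly_(k < N) A k i j.
have p0 : p = 0.
  apply: poly_circle0 => z; have /matrixP/(_ i j) := H z.
  rewrite summxE mxE => <-; rewrite horner_poly; apply: eq_bigr => l _.
  by rewrite mxE mulrC.
by have := congr1 (fun p : {poly C} => p`_k) p0; rewrite coef_poly kN coef0.
Qed.

(** The conditions that define derivations are linear, so that they pass to the
    Fourier coefficients of a family of derivations. *)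
Lemma G2der_coef N (Z : nat -> 'M[C]_7) :
  (forall z : circle R, G2der (\sum_(k < N) lam z ^+ k *: Z k)) ->
  forall k, (k < N)%N -> G2der (Z k).
Proof.
move=> H k kN; split.
  apply/eqP; rewrite -addr_eq0; apply/eqP.
  apply: (circle_sum0 (A := fun k => (Z k)^T + Z k) _ kN) => z.
  have [/eqP] := H z; rewrite -addr_eq0 => /eqP E _; rewrite -[RHS]E.
  rewrite linear_sum -big_split; apply: eq_bigr => l _.
  by rewrite linearZ scalerDr.
apply: der_basis => i j.
pose l (A : 'M[C]_7) := A *m cross (delta_mx i ord0) (delta_mx j ord0) -
  (cross (A *m delta_mx i ord0) (delta_mx j ord0) +
   cross (delta_mx i ord0) (A *m delta_mx j ord0)).
apply/eqP; rewrite -subr_eq0 -/(l (Z k)); apply/eqP.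
apply: (circle_sum0 (A := fun k => l (Z k)) _ kN) => z.
have [_ E] := H z.
have l0 : l (\sum_(k < N) lam z ^+ k *: Z k) = 0 by rewrite /l E subrr.
rewrite -[RHS]l0; elim/big_rec2: _ => [|n A B _ ->].
  by rewrite /l !mul0mx cross0l cross0r addr0 subr0.
rewrite /l !mulmxDl -!scalemxAl crossDl crossDr crossZl crossZr.
move: (_ *m cross _ _) (_ *m cross _ _) => u1 u2.
move: (cross (_ *m _) _) (cross (_ *m _) _) => u3 u4.
move: (cross _ (_ *m _)) (cross _ (_ *m _)) => u5 u6.
by apply/colP => r; rewrite !mxE; ring.
Qed.

Lemma imi_int (n : int) : imi R * n%:~R = Complex 0 n%:~R.
Proof.
have -> : (n%:~R : C) = real_complex R n%:~R by rewrite rmorph_int.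
by apply: complex_eq => /=; ring.
Qed.

Variables (Q : 'M[C]_7) (xi xi' : 'M[R]_7) (c c' : 'I_7 -> int).
Hypothesis Q_unit : Q \in unitmx.
Hypothesis xi_wt : has_weights Q xi c.
Hypothesis xi'_wt : has_weights Q xi' c'.
Hypothesis xi'_G2 : forall z, G2mat (gammaL xi' z).

(** In the basis Q, ad xi multiplies the entry (a, b) by i (c a - c b). *)
Lemma eigen_entry j (Y : 'M[C]_7) : eigen_ad xi j Y ->
  forall a b, (invmx Q *m Y *m Q) a b != 0 -> c a - c b = j.
Proof.
move=> [_ eY] a b; set B := invmx Q *m Y *m Q => Bab.
have YE : Y = Q *m B *m invmx Q.
  by rewrite /B !mulmxA (mulmxV Q_unit) mul1mx -mulmxA (mulmxV Q_unit) mulmx1.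
have BE : B = invmx Q *m (Y *m Q) by rewrite /B mulmxA.
clearbody B; have E : idiag R c *m B - B *m idiag R c = (imi R * j%:~R) *: B.
  have := congr1 (fun A => invmx Q *m (A *m Q)) eY; rewrite /=.
  rewrite -[toC xi * Y]/(toC xi *m Y) -[Y * toC xi]/(Y *m toC xi).
  rewrite mulmxBl mulmxBr -!mulmxA xi_wt.
  have e1 : invmx Q *m (toC xi *m (Y *m Q)) = idiag R c *m B.
    rewrite YE -!mulmxA (mulVmx Q_unit) mulmx1 (mulmxA (toC xi)) xi_wt.
    by rewrite -(mulmxA Q) (mulmxA (invmx Q)) (mulVmx Q_unit) mul1mx.
  rewrite e1 -scalemxAl -scalemxAr -BE => <-.
  by rewrite BE -!mulmxA.
have /matrixP/(_ a b) := E.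
rewrite /idiag mul_diag_mx mul_mx_diag !mxE imi_int mulrC -mulrBr [RHS]mulrC.
move=> /(mulfI Bab) /(congr1 (@complex.Im R)) /=.
by rewrite -mulrzBr => /eqP; rewrite eqr_int => /eqP.
Qed.

(** An eigenvector Y of ad xi splits into its components under ad xi', whose
    eigenvalues are at most i by the hypothesis on the weights.  These components
    are the Fourier coefficients of the conjugates of Y by the one-parameter
    group of xi', and so lie in the Lie algebra. *)
Lemma eigen_ad_parabolic (i : nat) j (Y : 'M[C]_7) :
  (forall a b, c' a - c' b <= Num.max 0 (c a - c b)) -> j <= i%:Z ->
  eigen_ad xi j Y -> parabolic xi' i%:Z Y.
Proof.
move=> cc ji eY; have [gY _] := eY; have {}gY : G2der Y by apply/g2CP.
pose B := invmx Q *m Y *m Q.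
have YE : Y = Q *m B *m invmx Q.
  by rewrite /B !mulmxA (mulmxV Q_unit) mul1mx -mulmxA (mulmxV Q_unit) mulmx1.
have Bwt a b : B a b != 0 -> c' a - c' b <= i%:Z.
  by move=> /(eigen_entry eY) E; have := cc a b; rewrite E; lia.
clearbody B; pose n := (\max_a \max_b absz (c' a - c' b))%N.
have nP a b : (absz (c' a - c' b)%R <= n)%N.
  by apply: leq_trans (leq_bigmax a); exact: (leq_bigmax b).
pose Bm (m : int) : 'M[C]_7 := \matrix_(a, b) (if c' a - c' b == m then B a b else 0).
pose Ym m := Q *m Bm m *m invmx Q.
have Ysum (z : circle R) : \sum_(k < (n + n).+1) lam z ^+ k *: Ym (k%:Z - n%:Z) =
    lam z ^+ n *: (gammaL xi' z *m Y *m (gammaL xi' z)^T).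
  have wl := has_weights_loop Q_unit xi'_wt.
  have giE : (gammaL xi' z)^T = Q *m diagloop (fun a => - c' a) z *m invmx Q.
    have gg := (xi'_G2 z).1; rewrite -[LHS]mulmx1.
    have -> : 1%:M = gammaL xi' z *m (Q *m diagloop (fun a => - c' a) z *m invmx Q).
      rewrite wl !mulmxA (mulmxKV Q_unit) -(mulmxA Q (diagloop c' z)).
      rewrite diagloop_mul.
      have -> : diagloop (fun a => c' a + - c' a) z = 1%:M.
        apply/matrixP => a b; rewrite !mxE subrr expr0z.
        by case: (a == b); rewrite ?mulr1n ?mulr0n.
      by rewrite mulmx1 (mulmxV Q_unit).
    by rewrite mulmxA gg mul1mx.
  have Bsum : \sum_(k < (n + n).+1) lam z ^+ k *: Bm (k%:Z - n%:Z) =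
      lam z ^+ n *: (diagloop c' z *m B *m diagloop (fun a => - c' a) z).
    apply/matrixP => a b; rewrite summxE /diagloop mul_diag_mx mul_mx_diag.
    pose k0 := absz (c' a - c' b + n%:Z).
    have k0E : k0%:Z = c' a - c' b + n%:Z.
      by rewrite /k0 gez0_abs //; have := nP a b; lia.
    have k0n : (k0 < (n + n).+1)%N by have := nP a b; lia.
    rewrite (bigD1 (inord k0)) //= big1 => [|k kk0]; last first.
      rewrite !mxE ifN ?mulr0 //; apply: contra kk0 => /eqP E.
      by apply/eqP; apply: val_inj; rewrite /= inordK //; lia.
    rewrite addr0 !mxE inordK // k0E addrK eqxx.
    rewrite -[lam z ^+ k0]/(lam z ^ k0%:Z) k0E !expfzDr ?lam_neq0 // -exprnP.
    by ring.
  have -> : \sum_(k < (n + n).+1) lam z ^+ k *: Ym (k%:Z - n%:Z) =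
      Q *m (\sum_(k < (n + n).+1) lam z ^+ k *: Bm (k%:Z - n%:Z)) *m invmx Q.
    rewrite mulmx_sumr mulmx_suml; apply: eq_bigr => k _.
    by rewrite -scalemxAr -scalemxAl.
  rewrite Bsum -scalemxAr -scalemxAl; congr (_ *: _).
  by rewrite giE wl YE !mulmxA !(mulmxKV Q_unit).
have gYm k : (k < (n + n).+1)%N -> G2der (Ym (k%:Z - n%:Z)).
  apply: (G2der_coef (Z := fun k => Ym (k%:Z - n%:Z))) => z.
  rewrite Ysum -[_ *: _]addr0; apply: G2der_lin (G2der0 _).
  exact: G2der_conj.
pose N := (i + n).+1.
exists N, (fun s => Ym (i%:Z - s%:Z)); split=> [s sN|].
  split.
    apply/g2CP; case: (boolP (`|i%:Z - s%:Z|%N <= n)%N) => hn.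
      have -> : i%:Z - s%:Z = (absz (i%:Z - s%:Z + n%:Z))%:Z - n%:Z by lia.
      by apply: gYm; lia.
    suff B0 : Bm (i%:Z - s%:Z) = 0.
      by rewrite /Ym B0 mulmx0 mul0mx; exact: G2der0.
    apply/matrixP => a b; rewrite !mxE ifN //; apply: contra hn => /eqP <-.
    exact: nP.
  rewrite -[toC xi' * _]/(toC xi' *m _) -[_ * toC xi']/(_ *m toC xi').
  set m := i%:Z - s%:Z.
  have e1 : toC xi' *m Ym m = Q *m (idiag R c' *m Bm m) *m invmx Q.
    by rewrite /Ym !mulmxA xi'_wt.
  have e2 : Ym m *m toC xi' = Q *m (Bm m *m idiag R c') *m invmx Q.
    rewrite /Ym -[LHS]mulmx1 -(mulmxV Q_unit) !mulmxA; congr (_ *m _).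
    by rewrite -!mulmxA xi'_wt (mulmxA (invmx Q)) (mulVmx Q_unit) mul1mx.
  rewrite e1 e2 -mulmxBl -mulmxBr /Ym scalemxAl scalemxAr; congr (_ *m _ *m _).
  apply/matrixP => a b; rewrite /idiag mul_diag_mx mul_mx_diag !mxE imi_int.
  case: eqP => [<-|_]; last by rewrite !mulr0 mul0r subr0.
  rewrite mulrC -mulrBr mulrC; congr (_ * _).
  by apply: complex_eq => /=; rewrite ?subr0 // mulrzBr.
have -> : \sum_(s < N) Ym (i%:Z - s%:Z) = Q *m (\sum_(s < N) Bm (i%:Z - s%:Z)) *m invmx Q.
  by rewrite mulmx_sumr mulmx_suml.
rewrite [LHS]YE; congr (_ *m _ *m _); apply/matrixP => a b; rewrite summxE.
have [B0|B0] := eqVneq (B a b) 0.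
  by rewrite B0 big1 // => s _; rewrite mxE B0 if_same.
have := Bwt a b B0; have := nP a b => h1 h2.
pose s0 : nat := absz (i%:Z - (c' a - c' b) : int)%R.
have s0E : s0%:Z = i%:Z - (c' a - c' b) by rewrite /s0 gez0_abs // subr_ge0.
have s0N : (s0 < N)%N by rewrite /N; lia.
rewrite (bigD1 (inord s0)) //= big1 => [|s ss0]; last first.
  rewrite mxE ifN //; apply: contra ss0 => /eqP E.
  have [sE] : s%:Z = s0%:Z by rewrite s0E E; ring.
  by apply/eqP; apply: val_inj; rewrite /= inordK.
by rewrite addr0 mxE inordK // s0E ifT //; apply/eqP; ring.
Qed.

(** The sum of the eigenspaces of ad xi' up to i is closed under addition, so
    that eigenvectors of ad xi suffice. *)
Lemma preceq_weights :
  (forall a b, c' a - c' b <= Num.max 0 (c a - c b)) -> preceq xi xi'.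
Proof.
move=> cc i Z [n [Y [eY ->]]].
have par s : (s < n)%N -> parabolic xi' i%:Z (Y s).
  by move=> sn; apply: eigen_ad_parabolic cc _ (eY s sn); rewrite gerBl.
have eD j (A B : 'M[C]_7) : eigen_ad xi' j A -> eigen_ad xi' j B ->
    eigen_ad xi' j (A + B).
  move=> [/g2CP gA eA] [/g2CP gB eB]; split.
    by apply/g2CP; have := G2der_lin 1 gA gB; rewrite scale1r.
  by rewrite mulrDr mulrDl scalerDr -eA -eB opprD addrACA.
have e0 j : eigen_ad xi' j (0 : 'M[C]_7).
  by split; [apply/g2CP; exact: G2der0 | rewrite mulr0 mul0r subr0 scaler0].
have parD A B : parabolic xi' i%:Z A -> parabolic xi' i%:Z B ->
    parabolic xi' i%:Z (A + B).
  move=> [p [F [eF ->]]] [q [G [eG ->]]].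
  pose F' s := if (s < p)%N then F s else 0.
  pose G' s := if (s < q)%N then G s else 0.
  exists (p + q)%N, (fun s => F' s + G' s); split.
    move=> s _; apply: eD.
      by rewrite /F'; case: ifP => [/eF //|_]; exact: e0.
    by rewrite /G'; case: ifP => [/eG //|_]; exact: e0.
  rewrite big_split /=; congr (_ + _).
    rewrite big_split_ord /= [X in _ = _ + X]big1 ?addr0 => [|k _].
      by apply: eq_bigr => k _; rewrite /F' ltn_ord.
    by rewrite /F' ltnNge leq_addr.
  rewrite addnC big_split_ord /= [X in _ = _ + X]big1 ?addr0 => [|k _].
    by apply: eq_bigr => k _; rewrite /G' ltn_ord.
  by rewrite /G' ltnNge leq_addr.
elim: n Y eY par => [|n IH] Y eY par.
  by rewrite big_ord0; exists 0%N, Y; split; [| rewrite big_ord0].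
rewrite big_ord_recr; apply: parD; last exact: par.
by apply: IH => [s sn|s sn]; [apply: eY | apply: par]; exact: leqW.
Qed.

End Parabolic.

(** * The weight lines and the formulas for the subspaces *)

Section WeightBasis.
Variable R : realType.
Local Notation C := R[i].
Local Notation Hp := (@Hplus R).
Implicit Types (M : loop R) (X Y : 'M[R]_7).

(** The weights of an element that acts by sqrt(-1) times x, y and x - y on the
    lines L_1, L_2 and L_(-3), in the order L_(-3), ..., L_3. *)
Definition wt (x y : int) (a : 'I_7) : int :=
  nth 0 [:: x - y; - y; - x; 0; x; y; y - x] a.

Lemma wt_lin (n m x y x' y' : int) :
  (fun a => n * wt x y a + m * wt x' y' a) =
  wt (n * x + m * x') (n * y + m * y').
Proof. by apply/funext => -[[|[|[|[|[|[|[|//]]]]]]] h]; rewrite /wt /=; ring. Qed.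

(** The right-hand sides of the formulas for the subspaces W^r, as functions of
    an arbitrary subspace W: cap_first, cap_even and cap_odd for 0 < 2 l < k, in
    the ranges r >= 2 l, r even and r odd below it; cap_half for k = 2 l and
    cap_zero for l = 0. *)
Definition cap_first (k l i : nat) (W : set (cfun R)) : set (cfun R) :=
  addW (addW (shiftW i%:Z (W `&` shiftW (- k%:Z) Hp)) (W `&` shiftW (- l%:Z) Hp))
       (shiftW (- i%:Z) (W `&` shiftW (l%:Z + i%:Z) Hp)).

Definition cap_even (k l j : nat) (W : set (cfun R)) : set (cfun R) :=
  addW (addW (addW (addW
    (shiftW (k%:Z - 2 * l%:Z + j%:Z) (W `&` shiftW (- k%:Z + j%:Z) Hp))
    (shiftW j%:Z (W `&` shiftW (- l%:Z) Hp)))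
    (shiftW (- j%:Z) (W `&` shiftW j%:Z Hp)))
    (shiftW (- k%:Z + 2 * l%:Z - j%:Z) (W `&` shiftW (k%:Z - l%:Z) Hp)))
    (shiftW (2 * (l%:Z - j%:Z)) Hp).

Definition cap_odd (k l j : nat) (W : set (cfun R)) : set (cfun R) :=
  addW (addW (addW (addW
    (shiftW (k%:Z - 2 * l%:Z + j%:Z) (W `&` shiftW (- k%:Z + j%:Z + 1) Hp))
    (shiftW (j%:Z + 1) (W `&` shiftW (- l%:Z) Hp)))
    (shiftW (- j%:Z - 1) (W `&` shiftW (j%:Z + 1) Hp)))
    (shiftW (- k%:Z + 2 * l%:Z - j%:Z) (W `&` shiftW (k%:Z - l%:Z - 1) Hp)))
    (shiftW (2 * (l%:Z - j%:Z) - 1) Hp).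

Definition cap_half (l i : nat) (W : set (cfun R)) : set (cfun R) :=
  addW (addW (shiftW i%:Z (W `&` shiftW (- (2 * l%:Z) + i%:Z) Hp))
             (shiftW (- i%:Z) (W `&` shiftW i%:Z Hp)))
       (shiftW (2 * (l%:Z - i%:Z)) Hp).

Definition cap_zero (k i : nat) (W : set (cfun R)) : set (cfun R) :=
  addW (addW (shiftW i%:Z (W `&` shiftW (- k%:Z) Hp)) (W `&` shiftW 0 Hp))
       (shiftW (- i%:Z) (W `&` shiftW i%:Z Hp)).

(** The formulas for the subspaces become identities between maxima and minima
    of integers, one for each of the seven weight lines. *)
Lemma cap_first_frame (k l i : nat) M : hardy_frame M -> (2 * l <= k)%N -> (i <= k - 2 * l)%N ->
  cap_first k l i (frameW M (wt k%:Z l%:Z)) = frameW M (wt (k - i)%N%:Z l%:Z).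
Proof.
move=> HM lk ik; rewrite /cap_first !(frameW_cap HM) !frameW_shift !frameW_add.
congr (frameW M _); apply/funext => -[[|[|[|[|[|[|[|//]]]]]]] h];
by rewrite /wt /=; lia.
Qed.

Lemma cap_even_frame (k l j : nat) M : hardy_frame M -> (2 * l <= k)%N -> (j <= l)%N ->
  cap_even k l j (frameW M (wt k%:Z l%:Z)) = frameW M (wt (2 * (l - j))%N%:Z (l - j)%N%:Z).
Proof.
move=> HM lk ik; rewrite /cap_even !(frameW_cap HM) (frameW_Hplus HM) !frameW_shift !frameW_add.
congr (frameW M _); apply/funext => -[[|[|[|[|[|[|[|//]]]]]]] h];
by rewrite /wt /=; lia.
Qed.

Lemma cap_odd_frame (k l j : nat) M : hardy_frame M -> (2 * l < k)%N -> (j < l)%N ->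
  cap_odd k l j (frameW M (wt k%:Z l%:Z)) = frameW M (wt (2 * (l - j) - 1)%N%:Z (l - j - 1)%N%:Z).
Proof.
move=> HM lk ik; rewrite /cap_odd !(frameW_cap HM) (frameW_Hplus HM) !frameW_shift !frameW_add.
congr (frameW M _); apply/funext => -[[|[|[|[|[|[|[|//]]]]]]] h];
by rewrite /wt /=; lia.
Qed.

Lemma cap_half_frame (l i : nat) M : hardy_frame M -> (i <= l)%N ->
  cap_half l i (frameW M (wt (2 * l)%N%:Z l%:Z)) = frameW M (wt (2 * (l - i))%N%:Z (l - i)%N%:Z).
Proof.
move=> HM il; rewrite /cap_half !(frameW_cap HM) (frameW_Hplus HM) !frameW_shift !frameW_add.
congr (frameW M _); apply/funext => -[[|[|[|[|[|[|[|//]]]]]]] h];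
by rewrite /wt /=; lia.
Qed.

Lemma cap_zero_frame (k i : nat) M : hardy_frame M -> (i <= k)%N ->
  cap_zero k i (frameW M (wt k%:Z 0)) = frameW M (wt (k - i)%N%:Z 0).
Proof.
move=> HM ik; rewrite /cap_zero !(frameW_cap HM) !frameW_shift !frameW_add.
congr (frameW M _); apply/funext => -[[|[|[|[|[|[|[|//]]]]]]] h];
by rewrite /wt /=; lia.
Qed.

(** The differences of the weights are, up to sign, combinations with
    nonnegative coefficients of the simple roots, whose values are l and k - 2 l
    on one side and y and x - 2 y on the other. *)
Lemma wt_dominated (k l x y : int) : 0 <= l -> 2 * l <= k ->
  0 <= y -> y <= l -> 2 * y <= x -> x - 2 * y <= k - 2 * l ->
  forall a b, wt x y a - wt x y b <= Num.max 0 (wt k l a - wt k l b).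
Proof.
move=> l0 lk y0 yl yx xyl.
move=> [[|[|[|[|[|[|[|//]]]]]]] h] [[|[|[|[|[|[|[|//]]]]]]] h'];
by rewrite /wt /=; lia.
Qed.

Lemma has_weights_lin (Q : 'M[C]_7) X Y c d (n m : int) :
  has_weights Q X c -> has_weights Q Y d ->
  has_weights Q (n%:~R *: X + m%:~R *: Y) (fun a => n * c a + m * d a).
Proof.
move=> XQ YQ; rewrite /has_weights toCD !toCZ mulmxDl -!scalemxAl XQ YQ.
rewrite !scalemxAr -mulmxDr; congr (_ *m _).
apply/matrixP => i j; rewrite !mxE.
case: (i == j); rewrite ?mulr1n ?mulr0n ?mulr0 ?addr0 //.
by apply: complex_eq; rewrite /= ?rmorphD ?rmorphM /=; ring.
Qed.

Lemma has_weights_scale (Q : 'M[C]_7) X c (n : int) :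
  has_weights Q X c -> has_weights Q (n%:~R *: X) (fun a => n * c a).
Proof.
move=> XQ; have := has_weights_lin n 0 XQ XQ; rewrite scale0r addr0.
by congr has_weights; apply/funext => a; rewrite mul0r addr0.
Qed.

Lemma has_weights_div (Q : 'M[C]_7) X c (n : nat) : (0 < n)%N ->
  has_weights Q X (fun a => n%:Z * c a) -> has_weights Q (n%:R^-1 *: X) c.
Proof.
move=> n0 XQ; rewrite /has_weights toCZ -scalemxAl XQ scalemxAr; congr (_ *m _).
have nR : (n%:R : R) != 0 by rewrite pnatr_eq0 -lt0n.
apply/matrixP => i j; rewrite !mxE; case: (i == j); rewrite ?mulr1n ?mulr0n ?mulr0 //.
apply: complex_eq => /=; first by ring.
by rewrite mul0r addr0 intrM -pmulrn mulrA mulVf // mul1r.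
Qed.

Variables (T Ch : set 'M[R]_7) (a1 a2 : 'M[R]_7 -> R) (L : int -> {vspace 'cV[C]_7}).
Hypothesis setup : G2_setup T Ch a1 a2 L.

(** A basis made of one vector on each weight line diagonalizes all elements
    that act on these lines by scalars. *)
Lemma weight_basis : exists2 Q : 'M[C]_7, Q \in unitmx &
  forall X (x y : int), acts_by L X x%:~R y%:~R (x - y)%:~R -> has_weights Q X (wt x y).
Proof.
have [_ _ [Ldim Lfull _ _] _] := setup.
have Lline (i : 'I_7) : exists v, L (i%:Z - 3) = <[v]>%VS.
  exists (vpick (L (i%:Z - 3))); apply/eqP; rewrite eq_sym eqEdim -memvE memv_pick.
  rewrite dim_vline vpick0 Ldim; case: eqVneq => // L0.
  by have := Ldim i; rewrite L0 dimv0.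
have /choice [v vE] := Lline.
pose Q : 'M[C]_7 := \matrix_(k, i) v i k ord0.
have colQ i : Q *m delta_mx i ord0 = v i.
  by rewrite -colE; apply/colP => k; rewrite !mxE.
have span (u : 'cV[C]_7) : exists a : 'cV[C]_7, Q *m a = u.
  have : u \in (\sum_(i < 7) L (i%:Z - 3))%VS by rewrite Lfull memvf.
  case/memv_sumP => w Hw ->.
  have co (i : 'I_7) : exists b, w i = b *: v i.
    by have := Hw i isT; rewrite vE => /vlineP [b ->]; exists b.
  have /choice [b bE] := co; exists (\col_i b i).
  rewrite [X in Q *m X]colE_sum mulmx_sumr; apply: eq_bigr => i _.
  by rewrite -scalemxAr colQ mxE bE.
have /choice [A AE] := fun j : 'I_7 => span (delta_mx j ord0).
have Qu : Q \in unitmx.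
  have : Q *m (\matrix_(k, j) A j k ord0) = 1%:M.
    apply/matrixP => i j; have := congr1 (fun u : 'cV[C]_7 => u i ord0) (AE j).
    rewrite !mxE andbT => <-; apply: eq_bigr => k _.
    by rewrite !mxE.
  by case/mulmx1_unit.
exists Q => // X x y [[h1 h2 h3] [h4 h5 h6] h0].
have act (i : 'I_7) r : acts_on X (L (i%:Z - 3)) r%:~R ->
    toC X *m v i = Complex 0 r%:~R *: v i.
  move=> H; rewrite H; last by rewrite vE memv_line.
  by congr (_ *: _); apply: complex_eq => /=; ring.
have colX i : toC X *m v i = Complex 0 (wt x y i)%:~R *: v i.
  apply: act; case: i => -[|[|[|[|[|[|[|//]]]]]]] h; rewrite /wt /=.
  - exact: h3.
  - by rewrite mulrNz; exact: h5.
  - by rewrite mulrNz; exact: h4.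
  - by rewrite mulr0z; exact: h0.
  - exact: h1.
  - exact: h2.
  - by rewrite -[y - x]opprB mulrNz; exact: h6.
apply/matrixP => k j; have := congr1 (fun u : 'cV[C]_7 => u k ord0) (colX j).
rewrite /idiag mul_mx_diag !mxE mulrC => <-.
by apply: eq_bigr => i _; rewrite !mxE.
Qed.

Lemma torus_facts : (T `<=` G2 (R:=R)) /\ (forall A B, T A -> T B -> T (A * B)).
Proof. by have [[[[TG [_ TM _] _ _] _] _] _ _ _] := setup. Qed.

Lemma torus_loop_G2 X : Lie T X -> forall z, G2mat (gammaL X z).
Proof.
move=> TX z; apply/G2_toC; apply: torus_facts.1; exact: TX.
Qed.

(** The comparison of the parabolic subalgebras amounts to inequalities between
    the values of the simple roots at X and Y, and integrality makes exp (2 pi Y) trivial. *)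
Lemma lattice_preceq (Q : 'M[C]_7) X Y (x y k l : int) : Q \in unitmx ->
  has_weights Q X (wt k l) -> Lie T Y -> has_weights Q Y (wt x y) ->
  0 <= l -> 2 * l <= k ->
  0 <= y -> y <= l -> 2 * y <= x -> x - 2 * y <= k - 2 * l ->
  lattice (Lie T) Y /\ preceq X Y.
Proof.
move=> Qu XQ TY YQ h1 h2 h3 h4 h5 h6; split.
  by split=> //; exact: (expm_2pi Qu YQ).
apply: (preceq_weights Qu XQ YQ (torus_loop_G2 TY)).
exact: wt_dominated.
Qed.

End WeightBasis.

(** * The factorizations *)

Lemma frameW_wt (R : realType) (M : loop R) (a b a' b' : nat) :
    a = a' -> b = b' ->
  frameW M (wt a%:Z b%:Z) = frameW M (wt a'%:Z b'%:Z).
Proof. by move=> -> ->. Qed.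

Unset Implicit Arguments.

Theorem mainTheorem1 (R : realType) (T Ch : set 'M[R]_7)
    (a1 a2 : 'M[R]_7 -> R) (L : int -> {vspace 'cV[R[i]]_7})
    (eta1 eta2 : 'M[R]_7) (k l : nat) (xi : 'M[R]_7) (gamma : loop R)
    (setup : G2_setup T Ch a1 a2 L)
    (eta1_t : Lie T eta1) (eta1_L : acts_by L eta1 1 0 1)
    (eta2_t : Lie T eta2) (eta2_L : acts_by L eta2 1 1 0)
    (k_ge1 : (1 <= k)%N) (l_le : (2 * l <= k)%N)
    (xi_I : lattice (Lie T) xi)
    (xi_L : acts_by L xi k%:R l%:R (k%:R - l%:R))
    (gamma_U : Uset xi gamma) :
  let W := mulW gamma (@Hplus R) in
  let capW n := W `&` shiftW n (@Hplus R) in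
  (* (a) *)
  ((0 < 2 * l)%N -> (2 * l < k)%N ->
   forall xs : nat -> 'M[R]_7,
     (forall i, (i <= k - 2 * l)%N ->
        xs (k - i)%N = (k - l - i)%N%:R *: eta1 + l%:R *: eta2) ->
     (forall j, (j < l)%N ->
        xs (2 * (l - j))%N = (l - j)%N%:R *: eta1 + (l - j)%N%:R *: eta2 /\
        xs (2 * (l - j) - 1)%N =
          (l - j)%N%:R *: eta1 + (l - j - 1)%N%:R *: eta2) ->
     xs 0%N = 0 ->
   let gs r := Umap xi (xs r) gamma in
   let Ws r := mulW (gs r) (@Hplus R) in
   [/\ xi = xs k,
       forall r, (r <= k)%N -> lattice (Lie T) (xs r) /\ preceq xi (xs r),
       factorization gamma (betas gs k) (nseq k 1%N),
       forall i, (i <= k - 2 * l)%N ->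
         Ws (k - i)%N =
           addW (addW (shiftW i%:Z (capW (- k%:Z)))
                      (capW (- l%:Z)))
                (shiftW (- i%:Z) (capW (l%:Z + i%:Z))) &
       forall j, (j < l)%N ->
         Ws (2 * (l - j))%N =
           addW (addW (addW (addW
             (shiftW (k%:Z - 2 * l%:Z + j%:Z) (capW (- k%:Z + j%:Z)))
             (shiftW j%:Z (capW (- l%:Z))))
             (shiftW (- j%:Z) (capW j%:Z)))
             (shiftW (- k%:Z + 2 * l%:Z - j%:Z) (capW (k%:Z - l%:Z))))
             (shiftW (2 * (l%:Z - j%:Z)) (@Hplus R)) /\
         Ws (2 * (l - j) - 1)%N =
           addW (addW (addW (addW
             (shiftW (k%:Z - 2 * l%:Z + j%:Z) (capW (- k%:Z + j%:Z + 1)))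
             (shiftW (j%:Z + 1) (capW (- l%:Z))))
             (shiftW (- j%:Z - 1) (capW (j%:Z + 1))))
             (shiftW (- k%:Z + 2 * l%:Z - j%:Z) (capW (k%:Z - l%:Z - 1))))
             (shiftW (2 * (l%:Z - j%:Z) - 1) (@Hplus R))]) /\
  (* (b) *)
  ((2 * l)%N = k ->
   let eta := l%:R^-1 *: xi in
   let gs r := Umap xi (r%:R *: eta) gamma in
   [/\ lattice (Lie T) eta,
       forall i, (i <= l)%N -> lattice (Lie T) ((l - i)%N%:R *: eta) /\
                               preceq xi ((l - i)%N%:R *: eta),
       factorization gamma (betas gs l) (nseq l 2%N) &
       forall i, (i <= l)%N ->
         mulW (gs (l - i)%N) (@Hplus R) =
           addW (addW (shiftW i%:Z (capW (- (2 * l%:Z) + i%:Z)))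
                      (shiftW (- i%:Z) (capW i%:Z)))
                (shiftW (2 * (l%:Z - i%:Z)) (@Hplus R))]) /\
  (* (c) *)
  (l = 0%N ->
   let eta := k%:R^-1 *: xi in
   let gs r := Umap xi (r%:R *: eta) gamma in
   [/\ lattice (Lie T) eta,
       forall i, (i <= k)%N -> lattice (Lie T) ((k - i)%N%:R *: eta) /\
                               preceq xi ((k - i)%N%:R *: eta),
       factorization gamma (betas gs k) (nseq k 1%N) &
       forall i, (i <= k)%N ->
         mulW (gs (k - i)%N) (@Hplus R) =
           addW (addW (shiftW i%:Z (capW (- k%:Z)))
                      (capW 0))
                (shiftW (- i%:Z) (capW i%:Z))]).
Proof.
move=> W capW.
have [Q Qu Qw] := weight_basis setup.
have [_ TM] := torus_facts setup.
have LG X (h : Lie T X) : forall z, G2mat (gammaL X z) := torus_loop_G2 setup h.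
have xiQ : has_weights Q xi (wt k%:Z l%:Z).
  by apply: Qw; rewrite mulrzBr.
have e1Q : has_weights Q eta1 (wt 1 0) by apply: Qw; rewrite subr0.
have e2Q : has_weights Q eta2 (wt 1 1) by apply: Qw; rewrite subrr.
have [xi_t _] := xi_I.
have xiW := has_weights_loop Qu xiQ.
have combW (n m : nat) :
    has_weights Q (n%:R *: eta1 + m%:R *: eta2) (wt (n + m)%N%:Z m%:Z).
  have := has_weights_lin n%:Z m%:Z e1Q e2Q; rewrite wt_lin.
  by congr (has_weights _ _ (wt _ _)); lia.
have combT (n m : nat) : Lie T (n%:R *: eta1 + m%:R *: eta2).
  have h1 := has_weights_scale n%:Z e1Q; have h2 := has_weights_scale m%:Z e2Q.
  exact: (Lie_add Qu TM h1 h2 (Lie_scale _ eta1_t) (Lie_scale _ eta2_t)).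
split; [|split].
- move=> l0 lk xs xsA xsB xs0 gs Ws.
  (* The r-th element is (r - y r) eta1 + y r eta2 over the whole range of r, and
     has the weights wt r (y r). *)
  pose y r := minn l r./2.
  have xsE r : (r <= k)%N -> xs r = (r - y r)%N%:R *: eta1 + (y r)%:R *: eta2.
    move=> rk; rewrite /y; have [r2l|r2l] := leqP (2 * l) r.
      have := xsA (k - r)%N; rewrite subKn // => ->; last by lia.
      by congr (_%:R *: _ + _%:R *: _); lia.
    (* Below 2 l, r = 2 (l - j) or r = 2 (l - j) - 1 according to its parity. *)
    case: r rk r2l => [|r] rk r2l.
      by rewrite xs0 minn0 sub0n !scale0r addr0.
    pose p := r.+1./2; have [ro|re] := boolP (odd r.+1).
      have [|_ E] := xsB (l - p.+1)%N; first by rewrite /p; lia.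
      have e : r.+1 = (2 * (l - (l - p.+1)) - 1)%N by rewrite /p; lia.
      by rewrite {1}e E; congr (_%:R *: _ + _%:R *: _); rewrite /p; lia.
    have [|E _] := xsB (l - p)%N; first by rewrite /p; lia.
    have e : r.+1 = (2 * (l - (l - p)))%N by rewrite /p; lia.
    by rewrite {1}e E; congr (_%:R *: _ + _%:R *: _); rewrite /p; lia.
  have yr r : (y r <= r)%N by rewrite /y; lia.
  have xsQ r : (r <= k)%N -> has_weights Q (xs r) (wt r%:Z (y r)%:Z).
    by move=> rk; rewrite xsE //; have := combW (r - y r)%N (y r); rewrite subnK.
  have xsT r : (r <= k)%N -> Lie T (xs r) by move=> rk; rewrite xsE.
  have xsW r (rk : (r <= k)%N) := has_weights_loop Qu (xsQ r rk).
  have yk : y k = l by rewrite /y; lia.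
  have WsE r E : (r <= k)%N ->
      (forall M, hardy_frame M -> E (frameW M (wt k%:Z l%:Z)) =
                                  frameW M (wt r%:Z (y r)%:Z)) -> Ws r = E W.
    by move=> rk; exact: (Umap_formula Qu xiW gamma_U (xsW r rk) (LG _ (xsT r rk))).
  split.
  + apply: (has_weights_eq Qu xiQ); have := xsQ k (leqnn k).
    by rewrite yk.
  + move=> r rk; apply: (lattice_preceq setup Qu xiQ (xsT r rk) (xsQ r rk));
      by rewrite /y; lia.
  + apply: (chain_factorization (c := wt k%:Z l%:Z) (m := 0)
      (cs := fun r => wt r%:Z (y r)%:Z) Qu xiW gamma_U xsW).
    * by move=> r rk; exact: LG (xsT r rk).
    * move=> r rk; rewrite /y; have [r2l|r2l] := leqP (2 * l) r.
        exists (@cap_first R k l (k - r)) => M HM.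
        rewrite (cap_first_frame HM l_le); last by lia.
        by rewrite (subKn rk) (minn_idPl _) //; lia.
      have [ro|re] := boolP (odd r).
        pose j := (l - r./2.+1)%N; exists (@cap_odd R k l j) => M HM.
        rewrite (cap_odd_frame HM lk); last by rewrite /j; lia.
        by apply: frameW_wt; rewrite /j; lia.
      pose j := (l - r./2)%N; exists (@cap_even R k l j) => M HM.
      rewrite (cap_even_frame HM l_le); last by rewrite /j; lia.
      by apply: frameW_wt; rewrite /j; lia.
    * apply/funext => -[[|[|[|[|[|[|[|//]]]]]]] h]; rewrite /wt /y /=; lia.
    * by apply: (has_weights_eq Qu (xsQ k (leqnn k))); rewrite yk.
    * move=> r [[|[|[|[|[|[|[|//]]]]]]] h] rk; rewrite /wt /y /=; lia.
    * by move=> r rk; exists (Ordinal (isT : (2 < 7)%N)); rewrite /wt /=; lia.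
  + move=> i ik; apply: (WsE (k - i)%N (@cap_first R k l i) (leq_subr _ _)) => M HM.
    rewrite (cap_first_frame HM l_le ik).
    by apply: frameW_wt; rewrite /y; lia.
  + move=> j jl; split.
      have r_le : (2 * (l - j) <= k)%N by lia.
      apply: (WsE _ (@cap_even R k l j) r_le) => M HM.
      rewrite (cap_even_frame HM l_le (ltnW jl)).
      by apply: frameW_wt; rewrite /y; lia.
    have r_le : (2 * (l - j) - 1 <= k)%N by lia.
    apply: (WsE _ (@cap_odd R k l j) r_le) => M HM.
    rewrite (cap_odd_frame HM lk jl).
    by apply: frameW_wt; rewrite /y; lia.
- move=> lk eta gs; have l0 : (0 < l)%N by lia.
  have lR : (l%:R : R) != 0 by rewrite pnatr_eq0 -lt0n.
  have kE : wt k%:Z l%:Z = fun a => l%:Z * wt 2 1 a.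
    by apply/funext => -[[|[|[|[|[|[|[|//]]]]]]] h]; rewrite /wt /=; lia.
  have etaQ : has_weights Q eta (wt 2 1).
    by apply: has_weights_div l0 _; rewrite -kE.
  have etaT : Lie T eta by exact: Lie_scale.
  have rQ (r : nat) : has_weights Q (r%:R *: eta) (wt (2 * r)%N%:Z r%:Z).
    have := has_weights_scale r%:Z etaQ; congr has_weights.
    by apply/funext => -[[|[|[|[|[|[|[|//]]]]]]] h]; rewrite /wt /=; lia.
  have rT (r : nat) : Lie T (r%:R *: eta) by exact: Lie_scale.
  have rW (r : nat) := has_weights_loop Qu (rQ r).
  have lE : l%:R *: eta = xi by rewrite /eta scalerA mulfV // scale1r.
  split.
  + by split=> //; exact: expm_2pi Qu etaQ.
  + by move=> i il; apply: (lattice_preceq setup Qu xiQ (rT _) (rQ _)); lia.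
  + apply: (chain_factorization (c := wt k%:Z l%:Z) (m := 1)
      (xs := fun r => r%:R *: eta) (cs := fun r => wt (2 * r)%N%:Z r%:Z)
      Qu xiW gamma_U (fun r _ => rW r)).
    * by move=> r _; exact: LG (rT r).
    * move=> r rl; exists (@cap_half R l (l - r)) => M HM.
      rewrite -lk (cap_half_frame HM (leq_subr _ _)).
      by apply: frameW_wt; lia.
    * by apply/funext => -[[|[|[|[|[|[|[|//]]]]]]] h]; rewrite /wt /=; lia.
    * exact: lE.
    * by move=> r [[|[|[|[|[|[|[|//]]]]]]] h] rk; rewrite /wt /=; lia.
    * by move=> r rk; exists (Ordinal (isT : (2 < 7)%N)); rewrite /wt /=; lia.
  + move=> i il; apply: (Umap_formula (E := @cap_half R l i) Qu xiW gamma_U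
      (rW _) (LG _ (rT _))) => M HM.
    by rewrite -lk (cap_half_frame HM il).
- move=> l0 eta gs; rewrite l0 in xiQ xiW *.
  have kR : (k%:R : R) != 0 by rewrite pnatr_eq0 -lt0n.
  have kE : wt k%:Z 0 = fun a => k%:Z * wt 1 0 a.
    by apply/funext => -[[|[|[|[|[|[|[|//]]]]]]] h]; rewrite /wt /=; lia.
  have etaQ : has_weights Q eta (wt 1 0).
    by apply: has_weights_div k_ge1 _; rewrite -kE.
  have etaT : Lie T eta by exact: Lie_scale.
  have rQ (r : nat) : has_weights Q (r%:R *: eta) (wt r%:Z 0).
    have := has_weights_scale r%:Z etaQ; congr has_weights.
    by apply/funext => -[[|[|[|[|[|[|[|//]]]]]]] h]; rewrite /wt /=; lia.
  have rT (r : nat) : Lie T (r%:R *: eta) by exact: Lie_scale.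
  have rW (r : nat) := has_weights_loop Qu (rQ r).
  have kE' : k%:R *: eta = xi by rewrite /eta scalerA mulfV // scale1r.
  split.
  + by split=> //; exact: expm_2pi Qu etaQ.
  + by move=> i ik; apply: (lattice_preceq setup Qu xiQ (rT _) (rQ _)); lia.
  + apply: (chain_factorization (c := wt k%:Z 0) (m := 0)
      (xs := fun r => r%:R *: eta) (cs := fun r => wt r%:Z 0)
      Qu xiW gamma_U (fun r _ => rW r)).
    * by move=> r _; exact: LG (rT r).
    * move=> r rk; exists (@cap_zero R k (k - r)) => M HM.
      by rewrite (cap_zero_frame HM (leq_subr _ _)) (subKn rk).
    * by apply/funext => -[[|[|[|[|[|[|[|//]]]]]]] h]; rewrite /wt /=; lia.
    * exact: kE'.
    * by move=> r [[|[|[|[|[|[|[|//]]]]]]] h] rk; rewrite /wt /=; lia.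
    * by move=> r rk; exists (Ordinal (isT : (2 < 7)%N)); rewrite /wt /=; lia.
  + move=> i ik; apply: (Umap_formula (E := @cap_zero R k i) Qu xiW gamma_U
      (rW _) (LG _ (rT _))) => M HM.
    exact: cap_zero_frame HM ik.
Qed.
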